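(* Let $\overline{M}$ be a smooth manifold with boundary, of dimension $n\ge2$, endowed with a smooth projective structure such that at every boundary point $\Pi^0_\mu\in\mathrm{span}(\mathrm{d}r)$ for all $1\le\mu\le n-1$ in some (hence every) boundary chart $(r,y^1,\dots,y^{n-1})$. Let $i:\partial M\hookrightarrow\overline{M}$ be the inclusion and let $\{U_i\}$ be an open cover of $\partial M$ by boundary charts of $\overline{M}$. For each $U_i$ let $$\omega_{U_i}=\begin{pmatrix}\Pi^0_0&\Pi^0_\mu&\mathrm{d}r\\ \Pi^\mu_0&\Pi^\mu_\nu&\mathrm{d}y^\mu\\ -\tilde P_{k0}\,\mathrm{d}x^k&-\tilde P_{k\nu}\,\mathrm{d}x^k&0\end{pmatrix}$$ be the Cartan gauge on $U_i$ of the normal projective Cartan connection on $\overline{M}$. Define $\tilde\omega_i=i^*\omega_{U_i}\bmod\mathfrak k$, where $\mathfrak k$ is the Lie algebra of $K$. Then $\{U_i\cap\partial M,\tilde\omega_i\}$ is a Cartan atlas for a projective geometry on $\partial M$.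
   Context: **Indices and charts.** A boundary chart is a chart $(U,(r,y^1,\dots,y^{n-1}))$ with $\partial M\cap U=\{r=0\}$ and $\mathrm{d}r\neq0$ on $\partial M\cap U$. Put $x^0=r$, $x^\mu=y^\mu$; Latin tensor indices range over $0,\dots,n-1$, Greek over $1,\dots,n-1$; repeated indices are summed. **Projective structure.** A projective structure is a class of torsion-free affine connections modulo $\hat\nabla_XY=\nabla_XY+\Upsilon(X)Y+\Upsilon(Y)X$ with $\Upsilon$ a $1$-form. In a chart, if $\Gamma^i_{jk}$ are the Christoffel symbols of a connection in the class, the Thomas invariant is $\Pi^i_{jk}=\Gamma^i_{jk}-\frac1{n+1}\Gamma^l_{lk}\delta^i_j-\frac1{n+1}\Gamma^l_{lj}\delta^i_k$ (independent of the connection chosen), and $\Pi^i_j=\Pi^i_{jk}\,\mathrm{d}x^k$. Further, $\tilde\Omega^i_j=\mathrm{d}\Pi^i_j+\Pi^i_k\wedge\Pi^k_j$ and $\tilde P_{lj}=\frac1{n-1}\tilde\Omega^i_j\!\left(\frac{\partial}{\partial x^i},\frac{\partial}{\partial x^l}\right)$. **Groups.** $Z=\{\lambda I_{n+1}:\lambda\ne0\}$, $G=GL(n+1;\mathbb R)/Z$, $H=\left\{\begin{pmatrix}A&0\\ \Upsilon&a\end{pmatrix}\right\}/Z$ with $A\in GL(n;\mathbb R)$. In blocks of size $1,n-1,1$, $$\tilde G=\left\{\begin{pmatrix}a&0&0\\ b&A&u\\ \beta&\delta&\gamma\end{pmatrix}\bmod Z:\ a\ne0,\ \begin{pmatrix}A&u\\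 \delta&\gamma\end{pmatrix}\in GL(n;\mathbb R)\right\},\qquad \tilde H=\left\{\begin{pmatrix}a&0&0\\ b&A&0\\ \beta&\delta&\gamma\end{pmatrix}\bmod Z:\ a,\gamma\ne0,\ A\in GL(n-1;\mathbb R)\right\},$$ and in blocks of size $1,n$, $K=\left\{\begin{pmatrix}a&0\\ b&\lambda I_n\end{pmatrix}\bmod Z:\ a,\lambda\neq0,\ b\in\mathbb R^n\right\}$, the kernel of the action of $\tilde G$ on the hyperplane $\{X_0=0\}\subset\mathbb{RP}^n$. Then $K$ is normal in $\tilde G$, $K\subset\tilde H$, and $(\tilde G/K)/(\tilde H/K)\cong\mathbb{RP}^{n-1}$ is the model of projective geometry in dimension $n-1$. $\mathfrak g$ and $\tilde{\mathfrak g}$ denote the Lie algebras of $G$ and $\tilde G$. Matrices of $1$-forms of size $n+1$ represent forms with values in $\mathfrak g=\mathfrak{gl}(n+1;\mathbb R)/\mathbb R I$; under the stated assumption $i^*\omega_{U_i}$ is $\tilde{\mathfrak g}$-valued, so $\tilde\omega_i$ is $\tilde{\mathfrak g}/\mathfrak k$-valued. **Transition functions.** On overlaps of two charts $x,\bar x$ of $\overline{M}$ the gauges $\omega_{U}$ are related by $\omega_{U_j}=h_{ij}^*\omega_H+\mathrm{Ad}_{h_{ij}^{-1}}\omega_{U_i}$ with $h_{ij}=\begin{pmatrix}\frac{\partial x^i}{\partial\bar x^j}&0\\ -\frac1{n+1}\frac{\partial\bar x^l}{\partial x^k}\frac{\partial^2x^k}{\partial\bar x^l\partial\bar x^j}&1\end{pmatrix}\bmod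 Z$, where $\omega_H$ is the Maurer–Cartan form of $H$. **Cartan atlas.** For an effective Klein model $G'/H'$ with Lie algebras $\mathfrak g',\mathfrak h'$, a Cartan gauge on an open set $V$ of a manifold $N$ is a $\mathfrak g'$-valued $1$-form $\eta$ on $V$ such that $\eta\bmod\mathfrak h':T_xV\to\mathfrak g'/\mathfrak h'$ is a linear isomorphism at each $x\in V$. A Cartan atlas on $N$ is a collection $\{V_i,\eta_i\}$ with $\{V_i\}$ an open cover of $N$ and $\eta_i$ a Cartan gauge on $V_i$, such that there are smooth maps $h_{ij}:V_i\cap V_j\to H'$ with $\eta_j=h_{ij}^*\omega_{H'}+\mathrm{Ad}_{h_{ij}^{-1}}\eta_i$, where $\omega_{H'}$ is the Maurer–Cartan form of $H'$. ''For a projective geometry on $\partial M$'' means with $G'=\tilde G/K$, $H'=\tilde H/K$. *)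

(* Defs.v *)
From HB Require Import structures.
From mathcomp Require Import all_boot all_order all_algebra.
From mathcomp Require Import all_classical all_reals all_analysis.

Set Implicit Arguments.
Unset Strict Implicit.
Unset Printing Implicit Defensive.

Import Order.TTheory GRing.Theory Num.Theory.
Import numFieldNormedType.Exports.

Local Open Scope classical_set_scope.
Local Open Scope ring_scope.

Section Calculus.
Variables (R : realType) (n : nat).
Implicit Types (X S O : set 'rV[R]_n) (f g : 'rV[R]_n -> R).

Definition ebas (k : 'I_n) : 'rV[R]_n := delta_mx 0 k.

Definition iter_partial (s : seq 'I_n) g : 'rV[R]_n -> R :=
  foldr (fun k u => fun x => 'D_(ebas k) u x) g s.

Definition smooth_open O g : Prop :=
  forall s x, O x -> differentiable (iter_partial s g) x.

Definition smooth_on S f : Prop :=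
  forall x, S x -> exists O g,
    [/\ open O, O x, smooth_open O g & forall y, O y -> S y -> f y = g y].

(* Partial derivative inside the model space X, which is R^n or the half-space:
   only increments staying in X are used, so that it is one-sided in the
   direction transverse to the boundary of the half-space. *)
Definition pder X (k : 'I_n) f (x : 'rV[R]_n) : R :=
  lim ((h^-1 * (f (x + h *: ebas k) - f x))
         @[h --> within [set h | X (x + h *: ebas k)] (0 : R)^']).

(* A 1-form on (a part of) R^n is given by its components, a 2-form by its
   values on pairs of coordinate fields. *)
Definition coform := 'rV[R]_n -> 'I_n -> R.

(* (d alpha)(d/dx^a, d/dx^b) *)
Definition dform X (al : coform) (x : 'rV[R]_n) (a b : 'I_n) : R :=
  pder X a (fun y => al y b) x - pder X b (fun y => al y a) x.

(* (alpha /\ beta)(d/dx^a, d/dx^b), without the factor 1/2 *)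
Definition wedge (al be : coform) (x : 'rV[R]_n) (a b : 'I_n) : R :=
  al x a * be x b - al x b * be x a.

End Calculus.

(* Manifolds with boundary are modelled on r >= 0, where r = x^0. *)
Definition half_space (R : realType) (d : nat) : set 'rV[R]_(1 + d) :=
  [set x | 0 <= x 0 ord0].

(* cmap is only meaningful on cdom, and cinv on the image cmap @` cdom, where
   it is the inverse of cmap. *)
Record chart (R : realType) (T : topologicalType) (n : nat) := Chart {
  cdom : set T;
  cmap : T -> 'rV[R]_n;
  cinv : 'rV[R]_n -> T }.

(* Data of a manifold carried by a subset mcar of T, with charts in atl
   modelled on the subset msp of R^n. *)
Record mfd (R : realType) (T : topologicalType) (n : nat) := Mfd {
  msp : set 'rV[R]_n;
  mcar : set T;
  atl : set (chart R T n) }.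

(* Tangent vectors are families of components indexed by the charts. *)
Definition tvec (R : realType) (T : topologicalType) (n : nat) :=
  chart R T n -> 'rV[R]_n.

Section Manifold.
Variables (R : realType) (T : topologicalType) (n : nat) (M : mfd R T n).
Implicit Types (c : chart R T n) (p q : T) (v w : tvec R T n) (V W : set T).

Definition is_chart c : Prop :=
  [/\ exists2 O, open O & cdom c = O `&` mcar M,
      exists2 O, open O & cmap c @` cdom c = O `&` msp M,
      forall p, cdom c p -> cinv c (cmap c p) = p,
      {within cdom c, continuous (cmap c)} &
      {within cmap c @` cdom c, continuous (cinv c)}].

Definition smooth_transition c c' : Prop :=
  forall k, smooth_on (cmap c @` (cdom c `&` cdom c'))
                      (fun x => cmap c' (cinv c x) 0 k).

Definition compatible c c' : Prop :=
  smooth_transition c c' /\ smooth_transition c' c.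

Definition is_manifold : Prop :=
  [/\ hausdorff_space T, @second_countable T &
   [/\ forall p, mcar M p -> exists2 c, atl M c & cdom c p,
       forall c, atl M c -> is_chart c,
       forall c c', atl M c -> atl M c' -> compatible c c' &
       forall c, is_chart c -> (forall c', atl M c' -> compatible c c') ->
         atl M c]].

Definition chart_at p c : Prop := atl M c /\ cdom c p.

(* d x'^j / d x^i at row i, column j: components of vectors are rows *)
Definition jac c c' p : 'M[R]_n :=
  \matrix_(i, j) pder (msp M) i (fun x => cmap c' (cinv c x) 0 j) (cmap c p).

(* Components at charts which are not charts at p carry no information, and
   are 0. *)
Definition tangent p v : Prop :=
  (forall c c', chart_at p c -> chart_at p c' -> v c' = v c *m jac c c' p) /\
  (forall c, ~ chart_at p c -> v c = 0).

Definition coord_field c (k : 'I_n) : T -> tvec R T n := fun p c' =>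
  if `[< chart_at p c /\ chart_at p c' >] then row k (jac c c' p) else 0.

Definition open_in V : Prop := exists2 O, open O & V = O `&` mcar M.

Definition smooth_fun W (f : T -> R) : Prop :=
  forall c, atl M c ->
    smooth_on (cmap c @` (cdom c `&` W)) (fun x => f (cinv c x)).

(* v(f) for v tangent at p, computed in a chart c at p *)
Definition dfun c (f : T -> R) p v : R :=
  \sum_k v c 0 k * pder (msp M) k (fun x => f (cinv c x)) (cmap c p).

Definition vector_field W (Y : T -> tvec R T n) : Prop :=
  (forall p, W p -> tangent p (Y p)) /\
  (forall c k, atl M c ->
     smooth_on (cmap c @` (cdom c `&` W)) (fun x => Y (cinv c x) c 0 k)).

Definition one_form W (al : T -> tvec R T n -> R) : Prop :=
  (forall p a v w, W p -> tangent p v -> tangent p w ->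
     al p (a *: v + w) = a * al p v + al p w) /\
  (forall c k, atl M c ->
     smooth_on (cmap c @` (cdom c `&` W))
               (fun x => al (cinv c x) (coord_field c k (cinv c x)))).

(* nab p v Y is the covariant derivative at p, along the vector v tangent at p,
   of a vector field Y defined in a neighbourhood of p. *)
Definition connection :=
  T -> tvec R T n -> (T -> tvec R T n) -> tvec R T n.

Definition is_connection (nab : connection) : Prop :=
  [/\ forall W Y p a v w, open_in W -> vector_field W Y -> W p ->
        tangent p v -> tangent p w ->
        nab p (a *: v + w) Y = a *: nab p v Y + nab p w Y,
      forall W Y Y' p v, open_in W -> vector_field W Y -> vector_field W Y' ->
        W p -> tangent p v ->
        nab p v (fun q => Y q + Y' q) = nab p v Y + nab p v Y',
      forall W f Y p v c, open_in W -> smooth_fun W f -> vector_field W Y ->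
        W p -> tangent p v -> chart_at p c ->
        nab p v (fun q => f q *: Y q)
        = dfun c f p v *: Y p + f p *: nab p v Y,
      forall W Y Y' p v, open_in W -> vector_field W Y -> vector_field W Y' ->
        W p -> tangent p v -> (forall q, W q -> Y q = Y' q) ->
        nab p v Y = nab p v Y' &
      forall W X Y, open_in W -> vector_field W X -> vector_field W Y ->
        vector_field W (fun q => nab q (X q) Y)].

(* nabla_X Y - nabla_Y X = [X, Y], in components *)
Definition torsion_free (nab : connection) : Prop :=
  forall W X Y p c k, open_in W -> vector_field W X -> vector_field W Y ->
    W p -> chart_at p c ->
    nab p (X p) Y c 0 k - nab p (Y p) X c 0 k
    = dfun c (fun q => Y q c 0 k) p (X p) - dfun c (fun q => X q c 0 k) p (Y p).

Definition tf_connection nab : Prop := is_connection nab /\ torsion_free nab.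

Definition proj_equiv (nab nab' : connection) : Prop :=
  exists2 Ups, one_form (mcar M) Ups &
    forall W Y p v, open_in W -> vector_field W Y -> W p -> tangent p v ->
      nab' p v Y = nab p v Y + Ups p v *: Y p + Ups p (Y p) *: v.

Definition projective_structure (P : set connection) : Prop :=
  exists2 nab, tf_connection nab &
    P = [set nab' | tf_connection nab' /\ proj_equiv nab nab'].

Section Thomas.
Variables (nab : connection) (c : chart R T n).

Definition christoffel (p : T) (i j k : 'I_n) : R :=
  nab p (coord_field c j p) (coord_field c k) c 0 i.

Definition thomas (p : T) (i j k : 'I_n) : R :=
  christoffel p i j k
  - (n%:R + 1)^-1 * (\sum_l christoffel p l l k) * (i == j)%:R
  - (n%:R + 1)^-1 * (\sum_l christoffel p l l j) * (i == k)%:R.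

(* Pi^i_j = Pi^i_jk dx^k, at the point p *)
Definition thomas_form (p : T) (i j : 'I_n) (v : tvec R T n) : R :=
  \sum_k thomas p i j k * v c 0 k.

Definition thomas_coform (i j : 'I_n) : coform R n :=
  fun x k => thomas (cinv c x) i j k.

(* Omega~^i_j (d/dx^a, d/dx^b) *)
Definition thomas_curv (p : T) (i j a b : 'I_n) : R :=
  dform (msp M) (thomas_coform i j) (cmap c p) a b
  + \sum_k wedge (thomas_coform i k) (thomas_coform k j) (cmap c p) a b.

Definition thomas_P (p : T) (l j : 'I_n) : R :=
  (n%:R - 1)^-1 * \sum_i thomas_curv p i j i l.

(* - P~_kj dx^k *)
Definition schouten_form (p : T) (j : 'I_n) (v : tvec R T n) : R :=
  - \sum_k thomas_P p k j * v c 0 k.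

End Thomas.
End Manifold.

Section Boundary.
Variables (R : realType) (T : topologicalType) (d : nat).
Variable A : set (chart R T (1 + d)).

Definition bmfd : mfd R T (1 + d) := Mfd (@half_space R d) setT A.

Definition boundary : set T :=
  [set p | exists c, [/\ A c, cdom c p & cmap c p 0 ord0 = 0]].

Definition boundary_chart (c : chart R T (1 + d)) : Prop :=
  [/\ A c,
      boundary `&` cdom c = [set p | cdom c p /\ cmap c p 0 ord0 = 0] &
      forall p, boundary p -> cdom c p ->
        exists2 v, tangent bmfd p v & v c 0 ord0 != 0].

Definition restr_chart (c : chart R T (1 + d)) : chart R T d :=
  Chart (cdom c `&` boundary) (fun p => rsubmx (cmap c p))
        (fun y => cinv c (row_mx 0 y)).

Definition boundary_mfd : mfd R T d :=
  Mfd setT boundary [set restr_chart c | c in boundary_chart].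

(* Differential of the inclusion of the boundary: in a boundary chart the
   inclusion is y |-> (0, y). *)
Definition dincl (p : T) (v : tvec R T d) : tvec R T (1 + d) := fun c =>
  if `[< boundary_chart c /\ cdom c p >] then row_mx 0 (v (restr_chart c))
  else 0.

(* The gauge omega_U, for U the chart c, evaluated on v tangent at p.
   Matrices in blocks of size 1, d, 1. *)
Definition normal_gauge (nab : connection R T (1 + d)) (c : chart R T (1 + d))
    (p : T) (v : tvec R T (1 + d)) : 'M[R]_(1 + (d + 1)) :=
  let Pi : 'M[R]_(1 + d) := \matrix_(i, j) thomas_form bmfd nab c p i j v in
  let dx : 'cV[R]_(1 + d) := (v c)^T in
  let mP : 'rV[R]_(1 + d) := \row_j schouten_form bmfd nab c p j v in
  block_mx (ulsubmx Pi) (row_mx (ursubmx Pi) (usubmx dx))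
           (col_mx (dlsubmx Pi) (lsubmx mP))
           (block_mx (drsubmx Pi) (dsubmx dx) (rsubmx mP) 0).

End Boundary.

Section Cartan.
Variables (R : realType) (N : nat).
Implicit Types (S : set 'M[R]_N) (X Y : 'M[R]_N).

(* Lie algebra of a closed subgroup S of GL(N): velocities at 0 of curves
   in S through the identity. *)
Definition lie_alg S : set 'M[R]_N :=
  [set X | exists c : R -> 'M[R]_N,
     [/\ c 0 = 1%:M, \forall t \near (0 : R), S (c t) &
         forall a b, is_derive (0 : R) 1 (fun t => c t a b) (X a b)]].

Definition coset_of_lie S X : set 'M[R]_N := [set Y | lie_alg S (Y - X)].

Definition coset_of_grp S (g : 'M[R]_N) : set 'M[R]_N :=
  [set g *m k | k in S].

(* Stands for the Klein model G'/H' with G' = kG / kK and H' = kH / kK, where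
   kK <= kH <= kG are groups of matrices and kK is normal in kG. Elements of
   G' and of its Lie algebra Lie(kG) / Lie(kK) are cosets. *)
Record klein := Klein { kG : set 'M[R]_N; kH : set 'M[R]_N; kK : set 'M[R]_N }.

Variables (T : topologicalType) (m : nat) (M : mfd R T m) (K : klein).

(* 1-forms with values in Lie(kG) / Lie(kK) *)
Definition qform := T -> tvec R T m -> set 'M[R]_N.

(* The first condition says that eta is a smooth 1-form with values in
   Lie(kG) / Lie(kK) (it lifts to Lie(kG), by a linear section). The second
   one says that eta mod Lie(kH) / Lie(kK) is bijective from T_p M to
   Lie(kG) / Lie(kH): `<=` reads that both cosets agree modulo Lie(kH). *)
Definition cartan_gauge (V : set T) (eta : qform) : Prop :=
  (exists2 theta : T -> tvec R T m -> 'M[R]_N,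
     forall a b, one_form M V (fun p v => theta p v a b) &
     forall p v, V p -> tangent M p v ->
       lie_alg (kG K) (theta p v) /\
       eta p v = coset_of_lie (kK K) (theta p v)) /\
  (forall p X, V p -> lie_alg (kG K) X ->
     exists! v, tangent M p v /\ eta p v `<=` coset_of_lie (kH K) X).

(* h = h_ij is a smooth map from V to kH / kK, that is, it has smooth local
   lifts g to kH, and eta' = h^* omega_H' + Ad_(h^-1) eta on V; the pullback
   of the Maurer-Cartan form is the class of g^-1 dg. *)
Definition cartan_transition (V : set T) (eta eta' : qform)
    (h : T -> set 'M[R]_N) : Prop :=
  forall p, V p -> exists W (g : T -> 'M[R]_N),
    [/\ open W, W p,
        forall a b, smooth_fun M (W `&` V) (fun q => g q a b),
        forall q, (W `&` V) q -> kH K (g q) /\ h q = coset_of_grp (kK K) (g q) &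
        forall q v c X, (W `&` V) q -> tangent M q v -> chart_at M q c ->
          eta q v X ->
          eta' q v = coset_of_lie (kK K)
            (invmx (g q) *m (\matrix_(a, b) dfun M c (fun r => g r a b) q v)
             + invmx (g q) *m X *m g q)].

Definition cartan_atlas (I : Type) (V : I -> set T) (eta : I -> qform) : Prop :=
  [/\ forall i, open_in M (V i),
      mcar M = \bigcup_i V i,
      forall i, cartan_gauge (V i) (eta i) &
      forall i j, exists h, cartan_transition (V i `&` V j) (eta i) (eta j) h].

End Cartan.

(* All three contain the group Z of nonzero scalar matrices, and are not
   divided by Z: the quotients by K are the same. *)
Section Groups.
Variables (R : realType) (d : nat).

Definition grpGt : set 'M[R]_(1 + (d + 1)) :=
  [set X | exists (a : 'M[R]_1) (b : 'cV[R]_d) (be : 'M[R]_1)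
                  (B : 'M[R]_(d + 1)),
     [/\ a 0 0 != 0, B \in unitmx & X = block_mx a 0 (col_mx b be) B]].

Definition grpHt : set 'M[R]_(1 + (d + 1)) :=
  [set X | exists (a : 'M[R]_1) (b : 'cV[R]_d) (be : 'M[R]_1) (A : 'M[R]_d)
                  (de : 'rV[R]_d) (ga : 'M[R]_1),
     [/\ a 0 0 != 0, ga 0 0 != 0, A \in unitmx &
         X = block_mx a 0 (col_mx b be) (block_mx A 0 de ga)]].

Definition grpK : set 'M[R]_(1 + (d + 1)) :=
  [set X | exists (a : 'M[R]_1) (b : 'cV[R]_(d + 1)) (la : R),
     [/\ a 0 0 != 0, la != 0 & X = block_mx a 0 b la%:M]].

Definition proj_klein : klein R (1 + (d + 1)) := Klein grpGt grpHt grpK.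

End Groups.

(* Main.v *)
(* Modulo the Lie algebra of [grpK] only the lower right block of the gauge, up
   to scalars, survives on the boundary. The hypothesis says that
   [Pi^0_{mu nu} = 0] there; this does not depend on the boundary chart, because
   [dr / dybar^mu] and its tangential derivatives vanish along the boundary. So
   the first row of the restricted gauge is zero off the diagonal, and its last
   column [dy^mu] identifies the tangent spaces of the boundary with the
   quotient of the Lie algebras.

   For the transition functions, let [Pi_k] be the matrix of the Thomas symbols
   [Pi^i_jk] with row [j] and column [i], [J] the Jacobian matrix of the change
   of charts and [dl = - (n + 1)^-1 tr (dJ J^-1)]. Then
     [Pibar_k = (J (sum_b J_kb Pi_b) + d_k J) J^-1 + dl_k + dl^T e_k],
   a linear gauge transformation, under which the curvature is tensorial,
   followed by the projective change by the closed form [dl], whose effect on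
   the contracted curvature [P~] is a direct computation. Restricted to
   tangential directions, the resulting laws for [Pi] and [P~] say exactly that
   the lower right blocks [Y], [Ybar] of the gauges and [B] of [h_ij] satisfy
   [B (Ybar - s) = dB + Y B] for a scalar [s]. Partial derivatives at the boundary
   are one-sided; they are computed on smooth extensions across it. *)

Require Import Defs.
From HB Require Import structures.
From mathcomp Require Import all_boot all_order all_algebra.
From mathcomp Require Import all_classical all_reals all_analysis.
From mathcomp Require Import ring lra.

Set Implicit Arguments.
Unset Strict Implicit.
Unset Printing Implicit Defensive.

Import Order.TTheory GRing.Theory Num.Theory.
Import numFieldNormedType.Exports.

Local Open Scope classical_set_scope.
Local Open Scope ring_scope.

(** * Smooth functions on open sets *)

(** The contraction in [thomas_P] also runs over the normal index, so even its tangential entries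
    contain normal derivatives of the Thomas symbols, and the constants [n + 1] and [n - 1] are
    those of the ambient dimension. The laws are therefore proved on the whole manifold and
    restricted afterwards. Restriction works because a function that vanishes on the boundary has
    vanishing tangential derivatives, which makes the Jacobian matrices block triangular; the only
    normal quantity left in the law of [P~] is the component [dl_0], and its coefficient there is
    [Pi^0_{mu nu} = 0]. Up to the factor [- (n + 1)^-1], [dl] is the differential of [log |det J|],
    whence its closedness. The scalar [s] is [dl] evaluated on the tangent vector; it is forced by
    the zero in the corner of the gauges, and the Lie algebra of [grpK] absorbs it. The restricted
    charts are not shown to satisfy [is_manifold], which asks for a maximal atlas; what is needed of
    them is drawn from the ambient atlas. *)

Section FiniteSmoothness.
Variables (R : realType) (n : nat).
Implicit Types (O : set 'rV[R]_n) (f g : 'rV[R]_n -> R) (k l : 'I_n).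

(** A finite order makes induction possible: a partial derivative of a product or of a composite is
    a sum of products of functions of lower order, so the induction must run over all functions at
    once rather than over the list of directions. *)
Definition Cn (N : nat) O g : Prop :=
  forall s, (size s <= N)%N -> forall x, O x -> differentiable (iter_partial s g) x.

Lemma smooth_openP O g : smooth_open O g <-> forall N, Cn N O g.
Proof.
by split=> [h N s _ x Ox|h s x Ox]; [exact: h|exact: (h (size s))].
Qed.

Lemma iter_partial_rcons s k g :
  iter_partial (rcons s k) g = iter_partial s (fun x => 'D_(ebas R k) g x).
Proof. by rewrite /iter_partial foldr_rcons. Qed.

Lemma eq_iter_partial O f g s : open O -> (forall x, O x -> f x = g x) ->
  forall x, O x -> iter_partial s f x = iter_partial s g x.
Proof.
move=> oO fg; elim: s => [|k s IH] x Ox /=; first exact: fg.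
by apply: near_eq_derive; near=> y; apply: IH; near: y; exact: open_nbhs_nbhs.
Unshelve. all: by end_near. Qed.

Lemma near_eq_differentiable (f g : 'rV[R]_n -> R) x :
  {near x, f =1 g} -> differentiable f x -> differentiable g x.
Proof.
move=> fg df; have fgx := nbhs_singleton fg.
have gE : g \o shift x = cst (g x) + 'd f x +o_ 0 id.
  apply/eqaddoP => e e0; have /eqaddoP := diff_locally df.
  move=> /(_ e e0); apply: filter_app.
  have : \forall y \near (0 : 'rV[R]_n), f (y + x) = g (y + x).
    have : \forall y \near x, f y = g y := fg.
    rewrite (near_shift 0) /= subr0; exact.
  by apply: filterS => y fgy; rewrite /= !fctE /= fgy fgx.
apply/diff_locallyP; rewrite (diff_unique (diff_continuous df) gE).
by split=> //; exact: diff_continuous.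
Qed.

Lemma smooth_open_mono O O' g : O' `<=` O -> smooth_open O g -> smooth_open O' g.
Proof. by move=> sO h s x /sO; exact: h. Qed.

(** The innermost derivative, the last of the list, is split off, so that an induction hypothesis on
    [N] applies to the first partial derivatives. *)
Lemma CnS N O g : Cn N.+1 O g <->
  (forall x, O x -> differentiable g x) /\
  (forall k, Cn N O (fun x => 'D_(ebas R k) g x)).
Proof.
split=> [h|[h1 h2] s].
  split=> [|k s sN]; first exact: (h [::]).
  by rewrite -iter_partial_rcons; apply: h; rewrite size_rcons.
case/lastP: s => [//|s k]; rewrite size_rcons ltnS iter_partial_rcons.
by move=> sN; exact: h2.
Qed.

Lemma CnW N O g : Cn N.+1 O g -> Cn N O g.
Proof. by move=> h s sN; apply: h; apply: leqW. Qed.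

Lemma smooth_open_partial O g k : smooth_open O g ->
  smooth_open O (fun x => 'D_(ebas R k) g x).
Proof. by move=> h s; rewrite -iter_partial_rcons; exact: h. Qed.

Lemma Cn_eq N O f g : open O -> (forall x, O x -> f x = g x) ->
  Cn N O f -> Cn N O g.
Proof.
move=> oO fg hf s sN x Ox; apply: near_eq_differentiable (hf s sN x Ox).
near=> y; apply: (eq_iter_partial s oO fg).
by near: y; exact: open_nbhs_nbhs.
Unshelve. all: by end_near. Qed.

Lemma Cn_cst N O (a : R) : Cn N O (fun=> a).
Proof.
elim: N a => [|N IH] a; first by case=> // _ x _; exact: differentiable_cst.
apply/CnS; split=> [x _|k]; first exact: differentiable_cst.
rewrite (_ : (fun x => _) = (fun=> 0 : R)); first exact: (IH 0).
by apply/funext => x; rewrite derive_cst.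
Qed.

Lemma CnD N O f g : open O -> Cn N O f -> Cn N O g ->
  Cn N O (fun x => f x + g x).
Proof.
move=> oO; elim: N f g => [|N IH] f g.
  move=> hf hg [|//] _ x Ox; apply: differentiableD.
    exact: (hf [::]).
  exact: (hg [::]).
move=> /CnS[df hf] /CnS[dg hg]; apply/CnS; split=> [x Ox|k].
  by apply: differentiableD; [exact: df|exact: dg].
apply: Cn_eq (IH _ _ (hf k) (hg k)) => // x Ox.
by rewrite deriveD //; apply: diff_derivable; [exact: df|exact: dg].
Qed.

Lemma CnM N O f g : open O -> Cn N O f -> Cn N O g ->
  Cn N O (fun x => f x * g x).
Proof.
move=> oO; elim: N f g => [|N IH] f g.
  move=> hf hg [|//] _ x Ox; apply: differentiableM.
    exact: (hf [::]).
  exact: (hg [::]).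
move=> hf' hg'; have /CnS[df hf] := hf'; have /CnS[dg hg] := hg'.
apply/CnS; split=> [x Ox|k].
  by apply: differentiableM; [exact: df|exact: dg].
apply: Cn_eq (CnD oO (IH _ _ (CnW hf') (hg k)) (IH _ _ (CnW hg') (hf k))) => //.
by move=> x Ox; rewrite deriveM //; apply: diff_derivable; [exact: df|exact: dg].
Qed.

Lemma smooth_openD O f g : open O -> smooth_open O f -> smooth_open O g ->
  smooth_open O (fun x => f x + g x).
Proof.
move=> oO /smooth_openP hf /smooth_openP hg.
by apply/smooth_openP => N; exact: CnD.
Qed.

Lemma smooth_openM O f g : open O -> smooth_open O f -> smooth_open O g ->
  smooth_open O (fun x => f x * g x).
Proof.
move=> oO /smooth_openP hf /smooth_openP hg.
by apply/smooth_openP => N; exact: CnM.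
Qed.

Lemma smooth_open_cst O (a : R) : smooth_open O (fun=> a).
Proof. by apply/smooth_openP => N; exact: Cn_cst. Qed.

Lemma derive_coord (j : 'I_n) (v x : 'rV[R]_n) :
  'D_v (fun y : 'rV[R]_n => y 0 j) x = v 0 j.
Proof.
(* The coordinate is packaged as a continuous linear map, which is its own differential. *)
have @F : {linear 'rV[R]_n -> R}.
  by exists (fun N : 'rV[R]_n => N 0 j); do 2![eexists]; do ?[constructor];
     rewrite ?mxE// => ? *; rewrite ?mxE//; move=> ?; rewrite !mxE.
have cF : continuous (F : _ -> R) by exact: coord_continuous.
have dF := linear_differentiable x cF.
by rewrite -[LHS]/('D_v (F : _ -> R) x) (deriveE v dF) (diff_lin _ cF).
Qed.

Lemma smooth_open_coord O (j : 'I_n) : smooth_open O (fun x => x 0 j).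
Proof.
apply/smooth_openP; case=> [|N].
  by case=> // _ x _; exact: differentiable_coord.
apply/CnS; split=> [x _|k]; first exact: differentiable_coord.
rewrite (_ : (fun x => _) = (fun=> ebas R k 0 j)); first exact: Cn_cst.
by apply/funext => x; exact: derive_coord.
Qed.

End FiniteSmoothness.

Section FiniteSmoothnessComp.
Variables (R : realType) (m n : nat).
Implicit Types (phi : 'rV[R]_m -> 'rV[R]_n) (f : 'rV[R]_n -> R).

Lemma differentiable_coords phi x :
  (forall j, differentiable (fun y => phi y 0 j) x) -> differentiable phi x.
Proof.
move=> h.
rewrite (_ : phi = \sum_j (fun y => phi y 0 j *: (ebas R j : 'rV[R]_n))).
  apply: differentiable_sum => j; exact: differentiableZl.
by apply/funext => y; rewrite fct_sumE; exact: row_sum_delta.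
Qed.

Lemma derive_comp phi f x v :
  (forall j, differentiable (fun y => phi y 0 j) x) ->
  differentiable f (phi x) ->
  'D_v (fun y => f (phi y)) x =
  \sum_j 'D_(ebas R j) f (phi x) * 'D_v (fun y => phi y 0 j) x.
Proof.
move=> dphi df; have dp := differentiable_coords dphi.
rewrite deriveE; last exact: differentiable_comp.
rewrite (diff_comp dp df) /= [X in 'd f _ X]row_sum_delta linear_sum.
apply: eq_bigr => j _; rewrite linearZ /= -(deriveE _ df) mulrC; congr (_ * _).
rewrite (deriveE _ (dphi j)).
have dcj := differentiable_coord (phi x) 0 j.
rewrite [RHS](congr1 (fun h => h v) (diff_comp dp dcj)) /= -(deriveE _ dcj).
by rewrite derive_coord.
Qed.

(** By the chain rule a partial derivative of the composite is a sum of products of a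
    ['D_(ebas R j) f] composed with [phi], covered by induction, and a partial derivative of
    [phi]. *)
Lemma Cn_comp N (O : set 'rV[R]_m) (O' : set 'rV[R]_n) phi f :
  open O -> (forall x, O x -> O' (phi x)) ->
  (forall j, Cn N O (fun x => phi x 0 j)) -> Cn N O' f ->
  Cn N O (fun x => f (phi x)).
Proof.
move=> oO sO; elim: N f => [|N IH] f.
  move=> hp hf [|//] _ x Ox /=; apply: (@differentiable_comp _ _ _ _ phi f).
    by apply: differentiable_coords => j; exact: (hp j [::]).
  by apply: (hf [::]) => //; exact: sO.
move=> hp' /CnS[df hf].
have dp j x : O x -> differentiable (fun x => phi x 0 j) x.
  by move=> Ox; have /CnS[+ _] := hp' j; exact.
have hp j k : Cn N O (fun x => 'D_(ebas R k) (fun x => phi x 0 j) x).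
  by have /CnS[_] := hp' j; exact.
apply/CnS; split=> [x Ox|k].
  apply: (@differentiable_comp _ _ _ _ phi f).
    by apply: differentiable_coords => j; exact: dp.
  exact: (df _ (sO _ Ox)).
have hI j : Cn N O (fun x => 'D_(ebas R j) f (phi x)).
  by apply: (IH (fun z => 'D_(ebas R j) f z)) => // i; exact: CnW.
apply: (@Cn_eq _ _ _ _ (fun x => \sum_j 'D_(ebas R j) f (phi x) *
   'D_(ebas R k) (fun y => phi y 0 j) x)) => //.
  by move=> x Ox; rewrite -derive_comp // => [j|]; [exact: dp|exact: (df _ (sO _ Ox))].
elim: (index_enum _) => [|j r IHr].
  by under eq_fun do rewrite big_nil; exact: Cn_cst.
by under eq_fun do rewrite big_cons; apply: CnD => //; apply: CnM.
Qed.

Lemma smooth_open_comp (O : set 'rV[R]_m) (O' : set 'rV[R]_n) phi f :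
  open O -> (forall x, O x -> O' (phi x)) ->
  (forall j, smooth_open O (fun x => phi x 0 j)) -> smooth_open O' f ->
  smooth_open O (fun x => f (phi x)).
Proof.
move=> oO sO hp /smooth_openP hf; apply/smooth_openP => N.
by apply: Cn_comp (hf N) => // j; have /smooth_openP := hp j; exact.
Qed.

End FiniteSmoothnessComp.

(** * Symmetry of second partial derivatives *)

Section MixedPartials.
Variables (R : realType) (n : nat).
Implicit Types (O : set 'rV[R]_n) (f g : 'rV[R]_n -> R) (k l : 'I_n).

Lemma is_derive_line f (y e : 'rV[R]_n) (s : R) :
  differentiable f (y + s *: e) ->
  is_derive s 1 (fun t => f (y + t *: e)) ('D_e f (y + s *: e)).
Proof.
move=> /(@diff_derivable _ _ _ _ _ e) df.
have E : (fun h : R => h^-1 *: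
     (((fun t : R => f (y + t *: e)) \o shift s) (h *: 1) - f (y + s *: e))) =
   (fun h : R => h^-1 *: ((f \o shift (y + s *: e)) (h *: e) - f (y + s *: e))).
  apply/funext => h /=; congr (_ *: (f _ - _)).
  by rewrite scalerDl addrCA; congr (_ *: _ + _); rewrite /GRing.scale /= mulr1.
by apply: DeriveDef; rewrite /derivable /derive E.
Qed.

Lemma mean_value_from0 (g dg : R -> R) (t : R) : 0 <= t ->
  (forall s, 0 <= s <= t -> is_derive s (1 : R) g (dg s)) ->
  exists2 a, 0 <= a <= t & g t - g 0 = t * dg a.
Proof.
move=> t0 gP; have [s|s|a] := @MVT_segment _ g dg 0 t t0.
- by rewrite in_itv /= => /andP[/ltW s0 /ltW st]; apply: gP; rewrite s0.
- apply: continuous_in_subspaceT => {}s; rewrite inE /= in_itv /= => /gP[+ _].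
  by move=> /derivable1_diffP; exact: differentiable_continuous.
by rewrite in_itv /= subr0 mulrC => ha E; exists a.
Qed.

(** The mean value theorem is applied twice: in direction [k] to the increment of [f] along
    [t *: ebas R l], then in direction [l] to the resulting partial derivative. *)
Lemma second_difference O f x k l (t : R) :
  Cn 2 O f -> 0 < t ->
  (forall a b, 0 <= a <= t -> 0 <= b <= t ->
     O (x + a *: ebas R k + b *: ebas R l)) ->
  exists a b, [/\ 0 <= a <= t, 0 <= b <= t &
    f (x + t *: ebas R k + t *: ebas R l) - f (x + t *: ebas R k)
      - (f (x + t *: ebas R l) - f x)
    = t * (t * 'D_(ebas R l) (fun y => 'D_(ebas R k) f y)
                 (x + a *: ebas R k + b *: ebas R l))].
Proof.
set ek := ebas R k; set el := ebas R l.
move=> /CnS[df /(_ k) /CnS[dkf _]] t0 sO.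
have t0' := ltW t0.
have O1 s : 0 <= s <= t -> O (x + s *: ek).
  by move=> hs; have := sO s 0 hs; rewrite scale0r addr0 lexx t0'; exact.
have O2 s : 0 <= s <= t -> O (x + t *: el + s *: ek).
  by move=> hs; rewrite addrAC; apply: sO => //; rewrite lexx t0'.
pose phi s := f (x + t *: el + s *: ek) - f (x + s *: ek).
pose dphi s := 'D_ek f (x + t *: el + s *: ek) - 'D_ek f (x + s *: ek).
have dphiP s : 0 <= s <= t -> is_derive s (1 : R) phi (dphi s).
  by move=> hs; apply: is_deriveB; apply: is_derive_line; apply: df; auto.
have [a ha Ea] := mean_value_from0 t0' dphiP.
pose psi s := 'D_ek f (x + a *: ek + s *: el).
pose dpsi s := 'D_el (fun y => 'D_ek f y) (x + a *: ek + s *: el).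
have dpsiP s : 0 <= s <= t -> is_derive s (1 : R) psi (dpsi s).
  by move=> hs; apply: (@is_derive_line (fun y => 'D_ek f y)); apply: dkf; exact: sO.
have [b hb Eb] := mean_value_from0 t0' dpsiP.
exists a, b; split=> //.
rewrite -{}Eb /psi scale0r addr0.
move: Ea; rewrite /phi /dphi !scale0r !addr0 => Ea.
by rewrite (addrAC x (t *: ek)) Ea (addrAC x (t *: el)).
Qed.

(** Two different points [y] and [z] are allowed because the two orders of differentiation yield
    different intermediate points in the mean value theorem. *)
Lemma continuous_eq_at_limit (D1 D2 : 'rV[R]_n -> R) x :
  {for x, continuous D1} -> {for x, continuous D2} ->
  (forall r, 0 < r -> exists y z, [/\ ball x r y, ball x r z & D1 y = D2 z]) ->
  D1 x = D2 x.
Proof.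
move=> /cvgrPdist_lt c1 /cvgrPdist_lt c2 h.
apply/eqP; rewrite -subr_eq0; apply/eqP/normr0_eq0.
apply/le_anti; rewrite normr_ge0 andbT; apply/ler_addgt0Pl => e e0; rewrite addr0.
have e2 : 0 < e / 2 by rewrite divr_gt0.
have /nbhs_ballP[r /= r0 hr] :
    \forall y \near x, `|D1 x - D1 y| < e / 2 /\ `|D2 x - D2 y| < e / 2.
  by near=> y; split; near: y; [exact: c1|exact: c2].
have [y [z [/hr[/= hy _] /hr[_ /= hz] E]]] := h r r0.
have -> : D1 x - D2 x = (D1 x - D1 y) - (D2 x - D2 z) by rewrite E; ring.
by rewrite (le_trans (ler_normB _ _)) // [e]splitr lerD // ltW.
Unshelve. all: by end_near. Qed.

Lemma ball_corner x k l (r a b : R) : 0 < r ->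
  0 <= a <= r / 4 -> 0 <= b <= r / 4 ->
  ball x r (x + a *: ebas R k + b *: ebas R l).
Proof.
move=> r0 /andP[a0 ar] /andP[b0 br].
rewrite -ball_normE /= -addrA opprD addNKr normrN.
apply: (le_lt_trans (ler_normD _ _)); rewrite !normrZ (ger0_norm a0) (ger0_norm b0).
(* In the sup norm basis vectors have norm at most 1, so two steps of length at most [r / 4] stay
   within [r / 2]. *)
have He (q : 'I_n) : `|ebas R q| <= 1.
  rewrite /Num.norm /= mx_normrE; apply: bigmax_le => // -[u v] _ /=.
  by rewrite mxE; case: (_ && _); rewrite ?normr1 ?normr0.
have : a * `|ebas R k| <= r / 4 * 1 by apply: ler_pM.
have : b * `|ebas R l| <= r / 4 * 1 by apply: ler_pM.
by rewrite !mulr1; lra.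
Qed.

(* Both sides are, up to the factor [t ^ 2], limits of one and the same second
   difference over a square of side [t]. *)
Lemma schwarz O f x k l : open O -> O x -> Cn 3 O f ->
  'D_(ebas R l) (fun y => 'D_(ebas R k) f y) x =
  'D_(ebas R k) (fun y => 'D_(ebas R l) f y) x.
Proof.
move=> oO Ox hf; have hf2 := CnW hf.
have cD (i j : 'I_n) : {for x, continuous
    (fun y => 'D_(ebas R j) (fun y => 'D_(ebas R i) f y) y)}.
  move/CnS: hf => [_ /(_ i) /CnS[_ /(_ j) /CnS[h _]]].
  exact/differentiable_continuous/h.
apply: (continuous_eq_at_limit (cD k l) (cD l k)) => r r0.
have /nbhs_ballP[r' /= r'0 hr'] : nbhs x O by exact: open_nbhs_nbhs.
pose s := Num.min r r'.
have s0 : 0 < s by rewrite lt_min r0 r'0.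
have t0 : 0 < s / 4 by rewrite divr_gt0.
have sr : ball x s `<=` ball x r by apply: le_ball; rewrite ge_min lexx.
have sO i j a b : 0 <= a <= s / 4 -> 0 <= b <= s / 4 ->
    O (x + a *: ebas R i + b *: ebas R j).
  move=> ha hb; apply: hr'; apply: le_ball (ball_corner x i j s0 ha hb).
  by rewrite ge_min lexx orbT.
have [a [b [ha hb E1]]] := second_difference hf2 t0 (sO k l).
have [a' [b' [ha' hb' E2]]] := second_difference hf2 t0 (sO l k).
exists (x + a *: ebas R k + b *: ebas R l), (x + a' *: ebas R l + b' *: ebas R k).
split; [exact/sr/ball_corner|exact/sr/ball_corner|].
apply: (mulfI (lt0r_neq0 t0)); apply: (mulfI (lt0r_neq0 t0)).
refine (eq_trans (esym E1) (eq_trans _ E2)).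
have -> : x + s / 4 *: ebas R k + s / 4 *: ebas R l =
          x + s / 4 *: ebas R l + s / 4 *: ebas R k by exact: addrAC.
by rewrite opprB opprB addrACA [RHS]addrACA [- _ - _]addrC.
Qed.

End MixedPartials.

(** * One-sided partial derivatives *)

Section SmoothOn.
Variables (R : realType) (n : nat).
Implicit Types (S O X : set 'rV[R]_n) (f g : 'rV[R]_n -> R) (k l : 'I_n).

Lemma smooth_on_sub S S' f : S' `<=` S -> smooth_on S f -> smooth_on S' f.
Proof.
move=> sS hf x /sS /hf[ O [g [oO Ox sg fg]]].
by exists O, g; split=> // y Oy /sS; exact: fg.
Qed.

Lemma eq_smooth_on S f g : (forall x, S x -> f x = g x) ->
  smooth_on S f -> smooth_on S g.
Proof.
move=> fg hf x Sx; have [ O [h [oO Ox sh fh]]] := hf x Sx.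
by exists O, h; split=> // y Oy Sy; rewrite -fg // fh.
Qed.

Lemma smooth_on_cst S (a : R) : smooth_on S (fun=> a).
Proof.
move=> x _; exists setT, (fun=> a); split=> //; first exact: openT.
exact: smooth_open_cst.
Qed.

Lemma smooth_on_coord S j : smooth_on S (fun x => x 0 j).
Proof.
move=> x _; exists setT, (fun x => x 0 j); split=> //; first exact: openT.
exact: smooth_open_coord.
Qed.

Lemma smooth_onD S f g : smooth_on S f -> smooth_on S g ->
  smooth_on S (fun x => f x + g x).
Proof.
move=> hf hg x Sx; have [ O [f' [oO Ox sf ff]]] := hf x Sx.
have [ O' [g' [oO' Ox' sg gg]]] := hg x Sx.
have oI : open (O `&` O') by exact: openI.
exists (O `&` O'), (fun y => f' y + g' y); split=> //.
  apply: smooth_openD => //; [apply: smooth_open_mono sf|apply: smooth_open_mono sg];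
  by move=> ? [].
by move=> y [Oy O'y] Sy; rewrite ff // gg.
Qed.

Lemma smooth_onM S f g : smooth_on S f -> smooth_on S g ->
  smooth_on S (fun x => f x * g x).
Proof.
move=> hf hg x Sx; have [ O [f' [oO Ox sf ff]]] := hf x Sx.
have [ O' [g' [oO' Ox' sg gg]]] := hg x Sx.
have oI : open (O `&` O') by exact: openI.
exists (O `&` O'), (fun y => f' y * g' y); split=> //.
  apply: smooth_openM => //; [apply: smooth_open_mono sf|apply: smooth_open_mono sg];
  by move=> ? [].
by move=> y [Oy O'y] Sy; rewrite ff // gg.
Qed.

End SmoothOn.

Section SmoothOnComp.
Variables (R : realType) (m n : nat).
Variables (S : set 'rV[R]_m) (S' : set 'rV[R]_n).
Variable phi : 'rV[R]_m -> 'rV[R]_n.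
Hypothesis sphi : forall j, smooth_on S (fun x => phi x 0 j).
Hypothesis phiS : forall x, S x -> S' (phi x).

(** [smooth_on] gives every component its own extension and its own neighbourhood. There are
    finitely many, so they can be intersected; continuity of the extended map then allows shrinking
    until it takes values in [O']. *)
Lemma smooth_map_extension x (O' : set 'rV[R]_n) : S x -> open O' -> O' (phi x) ->
  exists O (psi : 'rV[R]_m -> 'rV[R]_n),
    [/\ open O, O x, forall j, smooth_open O (fun y => psi y 0 j),
        forall y, O y -> S y -> phi y = psi y & forall y, O y -> O' (psi y)].
Proof.
move=> Sx oO' O'x.
have /choice[u hu] : forall j, exists Og : set 'rV[R]_m * ('rV[R]_m -> R),
    [/\ open Og.1, Og.1 x, smooth_open Og.1 Og.2 &
        forall y, Og.1 y -> S y -> phi y 0 j = Og.2 y].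
  by move=> j; have [ O [g h]] := sphi j Sx; exists (O, g).
pose psi y : 'rV[R]_n := \row_j (u j).2 y.
pose O1 := interior [set y | forall j, (u j).1 y].
have oO1 : open O1 by exact: open_interior.
have O1x : O1 x.
  have nu j : nbhs x (u j).1.
    by have [oj xj _ _] := hu j; exact: open_nbhs_nbhs.
  exact: (@filter_forall _ _ (fun j => (u j).1) (nbhs x) _ nu).
have sub1 y : O1 y -> forall j, (u j).1 y by move=> /interior_subset.
have spsi j : smooth_open O1 (fun y => psi y 0 j).
  rewrite (_ : (fun _ => _) = (u j).2); last by apply/funext => y; rewrite mxE.
  have [_ _ sj _] := hu j; apply: smooth_open_mono sj => y /sub1; exact.
have Epsi y : O1 y -> S y -> phi y = psi y.
  move=> /sub1 hy Sy; apply/rowP => j; rewrite mxE.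
  by have [_ _ _] := hu j; apply.
exists (O1 `&` interior (psi @^-1` O')), psi; split.
- by apply: openI => //; exact: open_interior.
- split=> //; rewrite /interior /=.
  have : {for x, continuous psi}.
    apply: differentiable_continuous; apply: differentiable_coords => j.
    exact: (spsi j [::]).
  by apply; apply: open_nbhs_nbhs; split=> //; rewrite -Epsi.
- by move=> j; apply: smooth_open_mono (spsi j) => y [].
- by move=> y [ O1y _]; exact: Epsi.
- by move=> y [_ /interior_subset].
Qed.

Lemma smooth_on_comp (f : 'rV[R]_n -> R) :
  smooth_on S' f -> smooth_on S (fun x => f (phi x)).
Proof.
move=> hf x Sx; have [ O' [g [oO' O'x sg fg]]] := hf _ (phiS Sx).
have [ O [psi [oO Ox spsi Epsi sO]]] := smooth_map_extension Sx oO' O'x.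
exists O, (fun y => g (psi y)); split=> //; first exact: smooth_open_comp sg.
move=> y Oy Sy; have O'y : O' (phi y) by rewrite Epsi //; exact: sO.
by rewrite (fg _ O'y (phiS Sy)) Epsi.
Qed.

End SmoothOnComp.

Section PartialDerivatives.
Variables (R : realType) (n : nat).
Implicit Types (S O X : set 'rV[R]_n) (f g : 'rV[R]_n -> R) (k l : 'I_n).

Definition relopen X S := forall x, S x -> X x /\ \forall y \near x, X y -> S y.

(* Makes [pder X] a limit along a proper filter, hence unique. *)
Definition approachable X := forall x k, X x ->
  ProperFilter (within [set h : R | X (x + h *: ebas R k)] (0 : R)^').

Lemma cvg_along_line (x : 'rV[R]_n) k : x + h *: ebas R k @[h --> (0 : R)] --> x.
Proof.
have c : {for (0 : R), continuous (fun h : R => x + h *: ebas R k)}.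
  apply: (@continuousD _ _ _ (cst x) (fun h : R => h *: ebas R k)).
    exact: cst_continuous.
  exact: scalel_continuous.
have := c; rewrite /prop_for /continuous_at. by rewrite scale0r addr0.
Qed.

Lemma near_line X (P : 'rV[R]_n -> Prop) (x : 'rV[R]_n) k :
  (\forall y \near x, X y -> P y) ->
  \forall h \near within [set h : R | X (x + h *: ebas R k)] (0 : R)^',
    P (x + h *: ebas R k).
Proof.
move=> /(cvg_along_line k); rewrite /= => h.
by apply: nbhs_dnbhs; exact: h.
Qed.

Lemma eq_pder X S f g k x : relopen X S -> S x ->
  (forall y, S y -> f y = g y) -> pder X k f x = pder X k g x.
Proof.
move=> oS Sx fg; have [_ nS] := oS x Sx; rewrite /pder; congr (lim _).
have E : \forall h \near within [set h : R | X (x + h *: ebas R k)] (0 : R)^',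
    h^-1 * (f (x + h *: ebas R k) - f x) = h^-1 * (g (x + h *: ebas R k) - g x).
  have := near_line k nS; apply: filterS => h Sh.
  by rewrite !fg.
rewrite eqEsubset; split; apply: near_eq_cvg => //.
by apply: filterS E => h ->.
Qed.

(** Near 0, along increments that stay in [X], the difference quotients of [f] are those of [g]. The
    filter of such increments refines the punctured neighbourhoods of 0, so the limit of [g] is
    inherited; [approachable] makes it unique. All rules for [pder] are transported from ['D] in
    this way. *)
Lemma pder_extension X S f g k x O : approachable X -> relopen X S -> S x ->
  nbhs x O -> (forall y, O y -> S y -> f y = g y) -> differentiable g x ->
  pder X k f x = 'D_(ebas R k) g x.
Proof.
move=> aX oS Sx Ox fg dg; have [Xx nS] := oS x Sx; have := aX x k Xx => pf.
rewrite /pder; apply: cvg_lim => //.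
have E : \forall h \near within [set h : R | X (x + h *: ebas R k)] (0 : R)^',
    h^-1 *: ((g \o shift x) (h *: ebas R k) - g x) =
    h^-1 * (f (x + h *: ebas R k) - f x).
  have nSO : \forall y \near x, X y -> O y /\ S y.
    by near=> y => Xy; split; [near: y|exact: (near nS y)].
  have := near_line k nSO; apply: filterS => h [Oh Sh].
  by rewrite (fg _ Oh Sh) (fg _ (nbhs_singleton Ox) Sx) /= [_ *: _ + x]addrC.
apply: cvg_trans (near_eq_cvg E) _.
apply: cvg_trans (diff_derivable (v := ebas R k) dg).
by apply: cvg_app; exact: cvg_within.
Unshelve. all: by end_near. Qed.

Lemma pder_smooth_extension X S f g k x O : approachable X -> relopen X S ->
  S x -> open O -> O x -> smooth_open O g -> (forall y, O y -> S y -> f y = g y) ->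
  pder X k f x = 'D_(ebas R k) g x.
Proof.
move=> aX oS Sx oO Ox sg fg; apply: (@pder_extension X S f g k x O) => //.
  exact: open_nbhs_nbhs.
exact: (sg [::]).
Qed.

Lemma smooth_on_pder X S f k : approachable X -> relopen X S ->
  smooth_on S f -> smooth_on S (pder X k f).
Proof.
move=> aX oS hf x Sx; have [ O [g [oO Ox sg fg]]] := hf x Sx.
exists O, (fun y => 'D_(ebas R k) g y); split=> //.
  exact: smooth_open_partial.
by move=> y Oy Sy; exact: (pder_smooth_extension k aX oS Sy oO Oy sg fg).
Qed.

Lemma pder_cst X S k (a : R) x : approachable X -> relopen X S -> S x ->
  pder X k (fun=> a) x = 0.
Proof.
move=> aX oS Sx.
rewrite (@pder_smooth_extension X S _ (fun=> a) k x setT) //.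
- by rewrite derive_cst.
- exact: openT.
- exact: smooth_open_cst.
Qed.

Lemma pder_coord X S k j x : approachable X -> relopen X S -> S x ->
  pder X k (fun y => y 0 j) x = (k == j)%:R.
Proof.
move=> aX oS Sx.
rewrite (@pder_smooth_extension X S _ (fun y => y 0 j) k x setT) //.
- by rewrite derive_coord /ebas mxE eqxx eq_sym.
- exact: openT.
- exact: smooth_open_coord.
Qed.

Lemma pderD X S f g k x : approachable X -> relopen X S -> S x ->
  smooth_on S f -> smooth_on S g ->
  pder X k (fun y => f y + g y) x = pder X k f x + pder X k g x.
Proof.
move=> aX oS Sx hf hg; have [ O [f' [oO Ox sf ff]]] := hf x Sx.
have [ O' [g' [oO' Ox' sg gg]]] := hg x Sx.
have nI : nbhs x (O `&` O') by apply: open_nbhs_nbhs; split=> //; exact: openI.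
rewrite (pder_smooth_extension k aX oS Sx oO Ox sf ff).
rewrite (pder_smooth_extension k aX oS Sx oO' Ox' sg gg).
have df : differentiable f' x by exact: (sf [::]).
have dg : differentiable g' x by exact: (sg [::]).
rewrite (@pder_extension X S _ (fun y => f' y + g' y) k x (O `&` O')) //.
- by rewrite deriveD //; exact: diff_derivable.
- by move=> y [Oy O'y] Sy; rewrite ff // gg.
- exact: differentiableD.
Qed.

Lemma pderM X S f g k x : approachable X -> relopen X S -> S x ->
  smooth_on S f -> smooth_on S g ->
  pder X k (fun y => f y * g y) x = pder X k f x * g x + f x * pder X k g x.
Proof.
move=> aX oS Sx hf hg; have [ O [f' [oO Ox sf ff]]] := hf x Sx.
have [ O' [g' [oO' Ox' sg gg]]] := hg x Sx.
have nI : nbhs x (O `&` O') by apply: open_nbhs_nbhs; split=> //; exact: openI.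
rewrite (pder_smooth_extension k aX oS Sx oO Ox sf ff).
rewrite (pder_smooth_extension k aX oS Sx oO' Ox' sg gg).
have df : differentiable f' x by exact: (sf [::]).
have dg : differentiable g' x by exact: (sg [::]).
rewrite (@pder_extension X S _ (fun y => f' y * g' y) k x (O `&` O')) //.
- rewrite deriveM; [|exact: diff_derivable|exact: diff_derivable].
  rewrite (ff x Ox Sx) (gg x Ox' Sx) addrC; congr (_ + _); exact: mulrC.
- by move=> y [Oy O'y] Sy; rewrite ff // gg.
- exact: differentiableM.
Qed.

Lemma pder_comm X S f k l x : approachable X -> relopen X S -> S x ->
  smooth_on S f -> pder X l (pder X k f) x = pder X k (pder X l f) x.
Proof.
move=> aX oS Sx hf; have [ O [g [oO Ox sg fg]]] := hf x Sx.
have E i y : O y -> S y -> pder X i f y = 'D_(ebas R i) g y.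
  by move=> Oy Sy; exact: (pder_smooth_extension i aX oS Sy oO Oy sg fg).
have sD i := smooth_open_partial i sg.
rewrite (pder_smooth_extension l aX oS Sx oO Ox (sD k) (E k)).
rewrite (pder_smooth_extension k aX oS Sx oO Ox (sD l) (E l)).
by apply: schwarz oO Ox _; move/smooth_openP: sg.
Qed.

End PartialDerivatives.

Lemma pder_comp (R : realType) (m n : nat) (X S : set 'rV[R]_m)
  (X' S' : set 'rV[R]_n) (phi : 'rV[R]_m -> 'rV[R]_n) f k x :
  approachable X -> relopen X S -> approachable X' -> relopen X' S' ->
  (forall j, smooth_on S (fun x => phi x 0 j)) ->
  (forall x, S x -> S' (phi x)) -> smooth_on S' f -> S x ->
  pder X k (fun y => f (phi y)) x =
  \sum_j pder X k (fun y => phi y 0 j) x * pder X' j f (phi x).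
Proof.
move=> aX oS aX' oS' hp pS hf Sx.
have [ O' [g [oO' O'x sg fg]]] := hf _ (pS _ Sx).
have [ O [psi [oO Ox spsi Epsi sO]]] := smooth_map_extension hp Sx oO' O'x.
have Ex := Epsi x Ox Sx.
rewrite (@pder_extension _ _ X S _ (fun y => g (psi y)) k x O) //.
- rewrite derive_comp; last 2 first.
  + by move=> j; exact: (spsi j [::]).
  + by apply: (sg [::]); exact: sO.
  apply: eq_bigr => j _; rewrite mulrC.
  rewrite (pder_smooth_extension j aX' oS' (pS _ Sx) oO' O'x sg fg) Ex.
  congr (_ * _); apply/esym.
  apply: (pder_smooth_extension k aX oS Sx oO Ox (spsi j)) => y Oy Sy.
  by rewrite Epsi.
- exact: open_nbhs_nbhs.
- move=> y Oy Sy; have O'y : O' (phi y) by rewrite Epsi //; exact: sO.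
  by rewrite (fg _ O'y (pS _ Sy)) Epsi.
- exact: (smooth_open_comp oO sO spsi sg [::]).
Qed.

(** Small positive increments keep a point in the half-space in every coordinate direction, so the
    filter cannot contain the empty set. *)
Lemma approachable_half_space (R : realType) (d : nat) :
  approachable (@half_space R d).
Proof.
move=> x k; rewrite /half_space /= => x0; split; last exact: within_filter.
rewrite /within /= => h.
have [t [t0 ht]] : exists t : R, 0 < t /\ (0 <= (x + t *: ebas R k) 0 ord0 -> False).
  have h' : \forall t \near (0 : R)^'+, 0 <= (x + t *: ebas R k) 0 ord0 -> False.
    move: h; rewrite !near_withinE => h; apply: filterS h => t ht /= t0.
    by apply: ht; rewrite gt_eqF.
  apply: (@filter_ex _ (0 : R)^'+); near=> t; split; near: t => //.
  exact: nbhs_right_gt.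
by apply: ht; rewrite !mxE addr_ge0 // mulr_ge0 // ltW.
Unshelve. all: by end_near. Qed.

(** * Calculus in charts *)

Section ChartCalculus.
Variables (R : realType) (T : topologicalType) (n : nat) (M : mfd R T n).
Hypothesis aX : approachable (msp M).
Hypothesis hM : is_manifold M.
Implicit Types (c : chart R T n) (p q : T) (F G : T -> R) (W : set T)
  (j k l : 'I_n).

Definition pd c k F p : R := pder (msp M) k (fun x => F (cinv c x)) (cmap c p).

Lemma chart_of c : atl M c -> is_chart M c.
Proof. by have [_ _ [_ h _ _]] := hM; exact: h. Qed.

Lemma chart_compatible c c' : atl M c -> atl M c' -> compatible c c'.
Proof. by have [_ _ [_ _ h _]] := hM; exact: h. Qed.

Lemma cinvK c p : atl M c -> cdom c p -> cinv c (cmap c p) = p.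
Proof. by move=> /chart_of[_ _ h _ _]; exact: h. Qed.

Lemma open_in_cdom c : atl M c -> open_in M (cdom c).
Proof. by move=> /chart_of[]. Qed.

Lemma open_inI W W' : open_in M W -> open_in M W' -> open_in M (W `&` W').
Proof.
move=> [ O oO ->] [ O' oO' ->]; exists (O `&` O'); first exact: openI.
by rewrite setIACA setIid.
Qed.

(** The image of the whole domain is relatively open by the definition of a chart; continuity of
    [cinv c] on it keeps nearby points in [W]. *)
Lemma relopen_image c W : atl M c -> open_in M W ->
  relopen (msp M) (cmap c @` (cdom c `&` W)).
Proof.
move=> ac [ O oO ->] x [p [cp [Op Mp]] <-{x}].
have [ [ O1 oO1 E1] [ O2 oO2 E2] cK _ cc] := chart_of ac.
have ix : (cmap c @` cdom c) (cmap c p) by exists p.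
have [ O2p Xp] : (O2 `&` msp M) (cmap c p) by rewrite -E2.
split=> //.
have nO' : nbhs (cinv c (cmap c p)) O by rewrite cK //; exact: open_nbhs_nbhs.
have := cc (cmap c p) _ nO'.
rewrite /nbhs /= -nbhs_subspace_in // => nO.
have nO2 : nbhs (cmap c p) O2 by exact: open_nbhs_nbhs.
near=> y => Xy.
have iy : (cmap c @` cdom c) y by rewrite E2; split=> //; near: y.
have [q cq qy] := iy.
have Oq : O (cinv c y) by move: (iy); near: y.
exists q => //; split=> //; split; first by rewrite -(cK q cq) qy.
by move: cq; rewrite E1 => -[].
Unshelve. all: by end_near. Qed.

Lemma eq_smooth_fun W F G : (forall q, W q -> F q = G q) ->
  smooth_fun M W F -> smooth_fun M W G.
Proof.
move=> FG hF c ac; apply: eq_smooth_on (hF c ac) => x [q [cq Wq] <-].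
by rewrite cinvK // FG.
Qed.

Lemma smooth_fun_sub W W' F : W' `<=` W -> smooth_fun M W F -> smooth_fun M W' F.
Proof.
move=> sW hF c ac; apply: smooth_on_sub (hF c ac) => x [q [cq /sW Wq] <-].
by exists q.
Qed.

Lemma smooth_fun_cst W (a : R) : smooth_fun M W (fun=> a).
Proof. by move=> c _; exact: smooth_on_cst. Qed.

Lemma smooth_funD W F G : smooth_fun M W F -> smooth_fun M W G ->
  smooth_fun M W (fun q => F q + G q).
Proof. by move=> hF hG c ac; apply: smooth_onD; [exact: hF|exact: hG]. Qed.

Lemma smooth_funM W F G : smooth_fun M W F -> smooth_fun M W G ->
  smooth_fun M W (fun q => F q * G q).
Proof. by move=> hF hG c ac; apply: smooth_onM; [exact: hF|exact: hG]. Qed.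

Lemma smooth_funN W F : smooth_fun M W F -> smooth_fun M W (fun q => - F q).
Proof.
move=> hF; apply: (@eq_smooth_fun W (fun q => -1 * F q)) => [q _|].
  by rewrite mulN1r.
by apply: smooth_funM => //; exact: smooth_fun_cst.
Qed.

Lemma smooth_funB W F G : smooth_fun M W F -> smooth_fun M W G ->
  smooth_fun M W (fun q => F q - G q).
Proof. by move=> hF hG; apply: smooth_funD => //; exact: smooth_funN. Qed.

Lemma smooth_fun_sum (I : Type) (r : seq I) (P : pred I) W (F : I -> T -> R) :
  (forall i, P i -> smooth_fun M W (F i)) ->
  smooth_fun M W (fun q => \sum_(i <- r | P i) F i q).
Proof.
move=> hF; elim: r => [|i r IH].
  by under eq_fun do rewrite big_nil; exact: smooth_fun_cst.
under eq_fun do rewrite big_cons; case Pi: (P i) => //.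
by apply: (@smooth_funD W (F i) (fun q => \sum_(j <- r | P j) F j q)) => //; exact: hF.
Qed.

(** Any other chart is reached by composing with a transition map, which is smooth by
    compatibility. *)
Lemma smooth_fun_in_chart c W F : atl M c -> W `<=` cdom c ->
  smooth_on (cmap c @` W) (fun x => F (cinv c x)) -> smooth_fun M W F.
Proof.
move=> ac sW hF c' ac'; have [st _] := chart_compatible ac' ac.
apply: (@eq_smooth_on _ _ _ (fun x => F (cinv c (cmap c (cinv c' x))))).
  by move=> x [q [cq Wq] <-]; rewrite cinvK // cinvK //; exact: sW.
apply: (@smooth_on_comp _ _ _ _ (cmap c @` W) (fun x => cmap c (cinv c' x))) hF => [j|].
  apply: smooth_on_sub (st j) => x [q [cq Wq] <-].
  by exists q => //; split=> //; exact: sW.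
by move=> x [q [cq Wq] <-]; exists q => //; rewrite cinvK.
Qed.

Lemma smooth_fun_coord c j : atl M c -> smooth_fun M (cdom c) (fun q => cmap c q 0 j).
Proof. by move=> ac c' ac'; have [+ _] := chart_compatible ac' ac; apply. Qed.

Lemma smooth_fun_pd c W F k : atl M c -> open_in M W -> smooth_fun M W F ->
  smooth_fun M (cdom c `&` W) (pd c k F).
Proof.
move=> ac oW hF; apply: (smooth_fun_in_chart ac); first by move=> ? [].
apply: eq_smooth_on (smooth_on_pder k aX (relopen_image ac oW) (hF c ac)).
by move=> x [q [cq Wq] <-]; rewrite /pd cinvK.
Qed.

Section AtPoint.
Variables (c : chart R T n) (W : set T) (p : T).
Hypotheses (ac : atl M c) (oW : open_in M W) (Wp : W p) (cp : cdom c p).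

Let im : (cmap c @` (cdom c `&` W)) (cmap c p). Proof. by exists p. Qed.
Let oS := relopen_image ac oW.

Lemma eq_pd F G k : (forall q, W q -> F q = G q) -> pd c k F p = pd c k G p.
Proof.
move=> FG; apply: (eq_pder k oS im) => x [q [cq Wq] <-].
by rewrite cinvK // FG.
Qed.

Lemma pd_cst k (a : R) : pd c k (fun=> a) p = 0.
Proof. exact: (pder_cst _ _ aX oS im). Qed.

Lemma pdD F G k : smooth_fun M W F -> smooth_fun M W G ->
  pd c k (fun q => F q + G q) p = pd c k F p + pd c k G p.
Proof. by move=> hF hG; exact: (pderD k aX oS im (hF c ac) (hG c ac)). Qed.

Lemma pdM F G k : smooth_fun M W F -> smooth_fun M W G ->
  pd c k (fun q => F q * G q) p = pd c k F p * G p + F p * pd c k G p.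
Proof.
move=> hF hG; rewrite /pd (pderM k aX oS im (hF c ac) (hG c ac)).
by rewrite cinvK.
Qed.

Lemma pdZ F k (a : R) : smooth_fun M W F ->
  pd c k (fun q => a * F q) p = a * pd c k F p.
Proof.
by move=> hF; rewrite pdM // ?pd_cst ?mul0r ?add0r //; exact: smooth_fun_cst.
Qed.

Lemma pd_sum (I : Type) (r : seq I) (P : pred I) (F : I -> T -> R) k :
  (forall i, P i -> smooth_fun M W (F i)) ->
  pd c k (fun q => \sum_(i <- r | P i) F i q) p = \sum_(i <- r | P i) pd c k (F i) p.
Proof.
move=> hF; elim: r => [|i r IH].
  by rewrite big_nil (@eq_pd _ (fun=> 0)) ?pd_cst // => q _; rewrite big_nil.
rewrite big_cons (@eq_pd _ (fun q => (if P i then F i q else 0) +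
    \sum_(i <- r | P i) F i q)); last first.
  by move=> q _; rewrite big_cons; case: ifP => //; rewrite add0r.
case: ifPn => Pi; last first.
  by rewrite -IH; apply: eq_pd => q _; rewrite add0r.
by rewrite pdD ?IH //; [exact: hF|exact: smooth_fun_sum].
Qed.

Lemma pd_comm F k l : smooth_fun M W F ->
  pd c l (pd c k F) p = pd c k (pd c l F) p.
Proof.
move=> hF; have E i j : pd c j (pd c i F) p =
    pder (msp M) j (pder (msp M) i (fun x => F (cinv c x))) (cmap c p).
  apply: (eq_pder j oS im) => x [q [cq Wq] <-].
  by rewrite /pd cinvK.
by rewrite !E (pder_comm k l aX oS im (hF c ac)).
Qed.

Lemma pd_coord k j : pd c k (fun q => cmap c q 0 j) p = (k == j)%:R.
Proof.
rewrite /pd -(pder_coord k j aX oS im); apply: (eq_pder k oS im).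
by move=> x [q [cq Wq] <-]; rewrite cinvK.
Qed.

(** The representative of [F] in [c] factors through the transition map only over the common part of
    both domains and [W], which is why a smaller relatively open image is used. *)
Lemma pd_chain c' F k : atl M c' -> cdom c' p -> smooth_fun M W F ->
  pd c k F p = \sum_j jac M c c' p k j * pd c' j F p.
Proof.
move=> ac' cp' hF.
have oW' : open_in M (cdom c' `&` W) by apply: open_inI => //; exact: open_in_cdom.
have im' : (cmap c @` (cdom c `&` (cdom c' `&` W))) (cmap c p) by exists p.
have oS' := relopen_image ac oW'.
have [st _] := chart_compatible ac ac'.
have E := @pder_comp R n n (msp M) (cmap c @` (cdom c `&` (cdom c' `&` W)))
  (msp M) (cmap c' @` (cdom c' `&` W)) (fun x => cmap c' (cinv c x))
  (fun x => F (cinv c' x)) k (cmap c p) aX oS' aX (relopen_image ac' oW).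
rewrite /pd; transitivity (pder (msp M) k
    (fun x => F (cinv c' (cmap c' (cinv c x)))) (cmap c p)).
  apply: (eq_pder k oS' im') => x [q [cq [cq' Wq]] <-].
  by rewrite !cinvK.
rewrite E //.
- by rewrite cinvK //; apply: eq_bigr => j _; rewrite mxE.
- move=> j; apply: smooth_on_sub (st j) => x [q [cq [cq' _]] <-].
  by exists q.
- by move=> x [q [cq [cq' Wq]] <-]; exists q => //; rewrite cinvK.
- exact: hF.
Qed.

End AtPoint.

Lemma jacE c c' p i j : jac M c c' p i j = pd c i (fun q => cmap c' q 0 j) p.
Proof. by rewrite mxE. Qed.

Lemma jac_id c p : chart_at M p c -> jac M c c p = 1%:M.
Proof.
move=> [ac cp]; apply/matrixP => i j; rewrite jacE mxE.
exact: (pd_coord ac (open_in_cdom ac) cp cp).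
Qed.

Lemma jac_cocycle c c' c'' p : chart_at M p c -> chart_at M p c' ->
  chart_at M p c'' -> jac M c c'' p = jac M c c' p *m jac M c' c'' p.
Proof.
move=> [ac cp] [ac' cp'] [ac'' cp'']; apply/matrixP => i j; rewrite jacE !mxE.
rewrite (pd_chain ac (open_in_cdom ac'') cp'' cp i ac' cp' (smooth_fun_coord j ac'')).
by apply: eq_bigr => l _; rewrite [jac M c' c'' p l j]jacE.
Qed.

Lemma smooth_fun_jac c c' i j : atl M c -> atl M c' ->
  smooth_fun M (cdom c `&` cdom c') (fun q => jac M c c' q i j).
Proof.
move=> ac ac'; under eq_fun do rewrite jacE.
by apply: smooth_fun_pd => //; [exact: open_in_cdom|exact: smooth_fun_coord].
Qed.

End ChartCalculus.

(** * Connections in charts *)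

Section TangentFields.
Variables (R : realType) (T : topologicalType) (n : nat) (M : mfd R T n).
Hypothesis aX : approachable (msp M).
Hypothesis hM : is_manifold M.
Implicit Types (c : chart R T n) (p q : T) (v w : tvec R T n) (W : set T)
  (Y : T -> tvec R T n) (i j k l : 'I_n).

(** One chart determines the components in all charts at [p], and the convention that the others are
    0 yields equality of the whole families. *)
Lemma tangent_inj c p v w : chart_at M p c -> tangent M p v -> tangent M p w ->
  v c = w c -> v = w.
Proof.
move=> pc [hv v0] [hw w0] vw; apply/funext => c'.
have [pc'|npc'] := pselect (chart_at M p c').
  by rewrite (hv c c') // (hw c c') // vw.
by rewrite v0 // w0.
Qed.

Lemma tangent0 p : tangent M p 0.
Proof. by split=> // c c' _ _; rewrite /= mul0mx. Qed.

Lemma tangentD p v w : tangent M p v -> tangent M p w -> tangent M p (v + w).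
Proof.
move=> [hv v0] [hw w0]; split=> [c c' pc pc'|c npc].
  by rewrite !fctE (hv c c') // (hw c c') // mulmxDl.
by rewrite !fctE v0 // w0 // addr0.
Qed.

Lemma tangentZ p (a : R) v : tangent M p v -> tangent M p (a *: v).
Proof.
move=> [hv v0]; split=> [c c' pc pc'|c npc].
  by rewrite !fctE (hv c c') // scalemxAl.
by rewrite !fctE v0 // scaler0.
Qed.

Lemma tangent_sum (I : Type) (r : seq I) p (v : I -> tvec R T n) :
  (forall a, tangent M p (v a)) -> tangent M p (\sum_(a <- r) v a).
Proof.
move=> hv; elim: r => [|a r IH]; first by rewrite big_nil; exact: tangent0.
by rewrite big_cons; exact: tangentD.
Qed.

Lemma coord_field_in c k p c' : chart_at M p c -> chart_at M p c' ->
  coord_field M c k p c' = row k (jac M c c' p).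
Proof. by move=> pc pc'; rewrite /coord_field asboolT. Qed.

Lemma coord_field_self c k j p : chart_at M p c ->
  coord_field M c k p c 0 j = (k == j)%:R.
Proof. by move=> pc; rewrite coord_field_in // jac_id // !mxE. Qed.

Lemma tangent_coord_field c k p : chart_at M p c -> tangent M p (coord_field M c k p).
Proof.
move=> pc; split=> [c1 c2 pc1 pc2|c1 npc1].
  by rewrite !coord_field_in // (jac_cocycle aX hM pc pc1 pc2) row_mul.
by rewrite /coord_field asboolF // => -[].
Qed.

Lemma tangent_expand c p v : chart_at M p c -> tangent M p v ->
  v = \sum_l v c 0 l *: coord_field M c l p.
Proof.
move=> pc hv; apply: (tangent_inj pc hv).
  by apply: tangent_sum => l; apply: tangentZ; exact: tangent_coord_field.
rewrite fct_sumE [LHS]row_sum_delta; apply: eq_bigr => l _.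
by rewrite !fctE coord_field_in // jac_id // row1.
Qed.

Lemma coord_field_expand c c' k p : chart_at M p c -> chart_at M p c' ->
  coord_field M c k p = \sum_l jac M c c' p k l *: coord_field M c' l p.
Proof.
move=> pc pc'; rewrite [LHS](tangent_expand pc' (tangent_coord_field k pc)).
by apply: eq_bigr => l _; rewrite coord_field_in // !mxE.
Qed.

Lemma vector_field_sub W W' Y : W' `<=` W -> vector_field M W Y -> vector_field M W' Y.
Proof.
move=> sW [h1 h2]; split=> [p /sW|c k ac]; first exact: h1.
apply: smooth_on_sub (h2 c k ac) => x [q [cq /sW Wq] <-].
by exists q.
Qed.

Lemma vector_field0 W : vector_field M W (fun=> 0).
Proof.
split=> [p _|c k ac]; first exact: tangent0.
apply: (@eq_smooth_on _ _ _ (fun=> 0)); last exact: smooth_on_cst.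
by move=> x _; rewrite mxE.
Qed.

Lemma vector_fieldD W Y Y' : vector_field M W Y -> vector_field M W Y' ->
  vector_field M W (fun q => Y q + Y' q).
Proof.
move=> [h1 h2] [h1' h2']; split=> [p Wp|c k ac].
  by apply: tangentD; [exact: h1|exact: h1'].
apply: eq_smooth_on (smooth_onD (h2 c k ac) (h2' c k ac)) => x _.
by rewrite !fctE mxE.
Qed.

Lemma vector_fieldZ W (F : T -> R) Y : smooth_fun M W F -> vector_field M W Y ->
  vector_field M W (fun q => F q *: Y q).
Proof.
move=> hF [h1 h2]; split=> [p Wp|c k ac].
  by apply: tangentZ; exact: h1.
apply: eq_smooth_on (smooth_onM (hF c ac) (h2 c k ac)) => x _.
by rewrite !fctE mxE.
Qed.

Lemma vector_field_sum (I : Type) (r : seq I) W (Y : I -> T -> tvec R T n) :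
  (forall a, vector_field M W (Y a)) ->
  vector_field M W (fun q => \sum_(a <- r) Y a q).
Proof.
move=> hY; elim: r => [|a r IH].
  by under eq_fun do rewrite big_nil; exact: vector_field0.
under eq_fun do rewrite big_cons.
exact: (vector_fieldD (hY a) IH).
Qed.

Lemma vector_field_coord c k : atl M c -> vector_field M (cdom c) (coord_field M c k).
Proof.
move=> ac; split=> [p cp|c' l ac']; first exact: tangent_coord_field.
have := smooth_fun_jac aX hM k l ac ac' ac'.
rewrite (_ : cdom c' `&` (cdom c `&` cdom c') = cdom c' `&` cdom c); last first.
  by rewrite setIC -setIA setIid setIC.
apply: eq_smooth_on => x [q [cq' cq] <-].
by rewrite (cinvK hM) // coord_field_in // [RHS]mxE.
Qed.

Lemma dfun_pd c (F : T -> R) p v : dfun M c F p v = \sum_k v c 0 k * pd M c k F p.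
Proof. by []. Qed.

Section Connection.
Variable nab : connection R T n.
Hypothesis cnab : is_connection M nab.

Lemma nab_sum_field (I : Type) (r : seq I) W (Y : I -> T -> tvec R T n) p v :
  open_in M W -> W p -> tangent M p v -> (forall a, vector_field M W (Y a)) ->
  nab p v (fun q => \sum_(a <- r) Y a q) = \sum_(a <- r) nab p v (Y a).
Proof.
move=> oW Wp hv hY; have [_ addP _ _ _] := cnab; elim: r => [|a r IH].
  rewrite big_nil; under eq_fun do rewrite big_nil.
  (* For the empty sum, additivity applied to [0 + 0] shows that the derivative of the zero field
     vanishes. *)
  have := addP W _ _ p v oW (vector_field0 W) (vector_field0 W) Wp hv.
  by under eq_fun do rewrite addr0; move/eqP; rewrite -subr_eq subrr eq_sym => /eqP.
rewrite big_cons -IH; under eq_fun do rewrite big_cons.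
by apply: (addP W) => //; exact: vector_field_sum.
Qed.

Lemma nab_sum_vec (I : Type) (r : seq I) W (a : I -> R) (v : I -> tvec R T n) Y p :
  open_in M W -> W p -> vector_field M W Y -> (forall b, tangent M p (v b)) ->
  nab p (\sum_(b <- r) a b *: v b) Y = \sum_(b <- r) a b *: nab p (v b) Y.
Proof.
move=> oW Wp hY hv; have [linP _ _ _ _] := cnab; elim: r => [|b r IH].
  rewrite !big_nil; have t0 := tangent0 p.
  have := linP W Y p 1 0 0 oW hY Wp t0 t0.
  rewrite !scale1r addr0; move/eqP.
  by rewrite -subr_eq subrr eq_sym => /eqP.
rewrite !big_cons -IH (linP W) //.
by apply: tangent_sum => i; exact: tangentZ.
Qed.

Lemma nab_tangent W X Y p : open_in M W -> vector_field M W X ->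
  vector_field M W Y -> W p -> tangent M p (nab p (X p) Y).
Proof.
move=> oW hX hY Wp; have [_ _ _ _ h] := cnab.
by have [h1 _] := h W X Y oW hX hY; exact: h1.
Qed.

(** The coordinate fields of [c] are combinations of those of [c'] with the Jacobian entries as
    coefficients. Linearity in the direction and the Leibniz rule in the field give the two terms,
    and [jac M c' c] converts the components back to [c]. *)
Lemma christoffel_transform c c' p i j k : chart_at M p c -> chart_at M p c' ->
  christoffel M nab c p i j k =
  \sum_m (\sum_a \sum_b jac M c c' p j a * jac M c c' p k b *
             christoffel M nab c' p m a b
          + pd M c j (fun q => jac M c c' q k m) p) * jac M c' c p m i.
Proof.
move=> pc pc'; have [[ac cp] [ac' cp']] := (pc, pc').
have [_ _ leibP congP _] := cnab.
pose W := cdom c `&` cdom c'.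
have oW : open_in M W by apply: open_inI; exact: open_in_cdom.
have Wp : W p by [].
have tj := tangent_coord_field j pc.
have vf : vector_field M W (coord_field M c k).
  by apply: vector_field_sub (vector_field_coord k ac) => ? [].
have vf' l : vector_field M W (coord_field M c' l).
  by apply: vector_field_sub (vector_field_coord l ac') => ? [].
have sJ m : smooth_fun M W (fun q => jac M c c' q k m) by exact: smooth_fun_jac.
have vJ m := vector_fieldZ (sJ m) (vf' m).
have vS := vector_field_sum (index_enum 'I_n) vJ.
rewrite /christoffel (congP W _ _ p _ oW vf vS Wp tj); last first.
  by move=> q [cq cq']; exact: coord_field_expand.
rewrite (nab_sum_field _ oW Wp tj vJ) !fct_sumE summxE.
have E m b : nab p (coord_field M c j p) (coord_field M c' m) c 0 b =
    \sum_a \sum_l jac M c c' p j a *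
       christoffel M nab c' p l a m * jac M c' c p l b.
  rewrite (coord_field_expand j pc pc') (nab_sum_vec _ _ oW Wp (vf' m)); last first.
    by move=> a; exact: tangent_coord_field.
  rewrite fct_sumE summxE; apply: eq_bigr => a _.
  have [+ _] := nab_tangent oW (vf' a) (vf' m) Wp.
  move=> /(_ c' c pc' pc); rewrite !fctE !mxE => ->.
  rewrite mxE big_distrr; apply: eq_bigr => l _ /=.
  by rewrite mulrA.
under eq_bigr => m _.
  rewrite (leibP W _ _ p _ c oW (sJ m) (vf' m) Wp tj pc) !fctE !mxE E dfun_pd.
  rewrite (bigD1 j) //= big1 ?addr0; last first.
    by move=> l; rewrite eq_sym coord_field_self // => /negPf ->; rewrite mul0r.
  rewrite coord_field_self // eqxx mul1r coord_field_in // mxE.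
  over.
rewrite big_split /= [RHS](eq_bigr _ (fun m _ => mulrDl _ _ _)) big_split /= addrC.
congr (_ + _).
under [RHS]eq_bigr => m _.
  rewrite big_distrl /=.
  under eq_bigr => a _ do rewrite big_distrl /=.
  over.
rewrite [RHS]exchange_big /=.
under eq_bigr => b _ do rewrite big_distrr /=.
rewrite [LHS]exchange_big /=; apply: eq_bigr => a _.
under eq_bigr => b _ do rewrite big_distrr /=.
rewrite [LHS]exchange_big /=; apply: eq_bigr => m _; apply: eq_bigr => b _.
by rewrite /christoffel [jac M c c' p k b]mxE; ring.
Qed.

Lemma smooth_fun_christoffel c i j k : atl M c ->
  smooth_fun M (cdom c) (fun q => christoffel M nab c q i j k).
Proof.
move=> ac; have [_ _ _ _ h] := cnab.
have [_ /(_ c i ac)] := h _ _ _ (open_in_cdom hM ac) (vector_field_coord j ac)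
                          (vector_field_coord k ac).
by rewrite setIid; apply: smooth_fun_in_chart.
Qed.

(** The components of coordinate fields in their own chart are constant, so their bracket
    vanishes. *)
Lemma christoffel_sym c p i j k : torsion_free M nab -> chart_at M p c ->
  christoffel M nab c p i j k = christoffel M nab c p i k j.
Proof.
move=> tf pc; have [ac cp] := pc; apply/eqP; rewrite -subr_eq0; apply/eqP.
have oW := open_in_cdom hM ac.
rewrite (tf (cdom c) _ _ p c i oW (vector_field_coord j ac)
  (vector_field_coord k ac) cp pc).
have E a b : dfun M c (fun q => coord_field M c a q c 0 i) p (coord_field M c b p) = 0.
  rewrite dfun_pd big1 // => l _.
  rewrite (eq_pd hM ac oW cp cp (G := fun=> (a == i)%:R)).
    by rewrite (pd_cst aX hM ac oW cp cp) mulr0.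
  by move=> q cq; rewrite coord_field_self.
by rewrite !E subrr.
Qed.

End Connection.
End TangentFields.

(** * Matrix-valued functions and curvature *)

Section Entries.
Variables (V : pzRingType) (m n : nat).
Implicit Types X Y : 'M[V]_(m, n).

Lemma entryD X Y i j : (X + Y) i j = X i j + Y i j. Proof. by rewrite mxE. Qed.
Lemma entryN X i j : (- X) i j = - X i j. Proof. by rewrite mxE. Qed.
Lemma entryZ (a : V) X i j : (a *: X) i j = a * X i j. Proof. by rewrite mxE. Qed.

End Entries.

Section MatrixCalculus.
Variables (R : realType) (T : topologicalType) (n : nat) (M : mfd R T n).
Hypothesis aX : approachable (msp M).
Hypothesis hM : is_manifold M.
Implicit Types (c : chart R T n) (p q : T) (W : set T) (k l : 'I_n).

Definition pdm r s c k (F : T -> 'M[R]_(r, s)) p : 'M[R]_(r, s) :=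
  \matrix_(i, j) pd M c k (fun q => F q i j) p.

Lemma pdmE r s c k (F : T -> 'M[R]_(r, s)) p i j :
  pdm c k F p i j = pd M c k (fun q => F q i j) p.
Proof. by rewrite mxE. Qed.

Definition smooth_mx r s W (F : T -> 'M[R]_(r, s)) : Prop :=
  forall i j, smooth_fun M W (fun q => F q i j).

Lemma smooth_mxD r s W (F G : T -> 'M[R]_(r, s)) :
  smooth_mx W F -> smooth_mx W G -> smooth_mx W (fun q => F q + G q).
Proof.
move=> hF hG i j; under eq_fun do rewrite mxE.
exact: (smooth_funD (hF i j) (hG i j)).
Qed.

Lemma smooth_mxB r s W (F G : T -> 'M[R]_(r, s)) :
  smooth_mx W F -> smooth_mx W G -> smooth_mx W (fun q => F q - G q).
Proof.
move=> hF hG i j; under eq_fun do rewrite !mxE.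
exact: (smooth_funB hM (hF i j) (hG i j)).
Qed.

Lemma smooth_mxZ r s W (f : T -> R) (F : T -> 'M[R]_(r, s)) :
  smooth_fun M W f -> smooth_mx W F -> smooth_mx W (fun q => f q *: F q).
Proof.
move=> hf hF i j; under eq_fun do rewrite !mxE.
exact: (smooth_funM hf (hF i j)).
Qed.

Lemma smooth_mxM r s t W (F : T -> 'M[R]_(r, s)) (G : T -> 'M[R]_(s, t)) :
  smooth_mx W F -> smooth_mx W G -> smooth_mx W (fun q => F q *m G q).
Proof.
move=> hF hG i j; under eq_fun do rewrite !mxE.
apply: (@smooth_fun_sum R T n M _ _ _ W (fun b q => F q i b * G q b j)) => b _.
exact: (smooth_funM (hF i b) (hG b j)).
Qed.

Lemma smooth_mx_sum (I : Type) (e : seq I) r s W (F : I -> T -> 'M[R]_(r, s)) :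
  (forall a, smooth_mx W (F a)) -> smooth_mx W (fun q => \sum_(a <- e) F a q).
Proof.
move=> hF i j; under eq_fun do rewrite summxE.
by apply: (@smooth_fun_sum R T n M _ _ _ W ( fun a q => F a q i j)) => a _; exact: hF.
Qed.

Lemma smooth_mx_sub r s W W' (F : T -> 'M[R]_(r, s)) : W' `<=` W ->
  smooth_mx W F -> smooth_mx W' F.
Proof. by move=> sW hF i j; exact: smooth_fun_sub (hF i j). Qed.

Lemma smooth_mx_pdm r s W c k (F : T -> 'M[R]_(r, s)) : atl M c -> open_in M W ->
  smooth_mx W F -> smooth_mx (cdom c `&` W) (pdm c k F).
Proof.
move=> ac oW hF i j; under eq_fun do rewrite mxE.
exact: smooth_fun_pd.
Qed.

Section AtPoint.
Variables (c : chart R T n) (W : set T) (p : T).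
Hypotheses (ac : atl M c) (oW : open_in M W) (Wp : W p) (cp : cdom c p).

Lemma eq_pdm r s (F G : T -> 'M[R]_(r, s)) k : (forall q, W q -> F q = G q) ->
  pdm c k F p = pdm c k G p.
Proof.
move=> FG; apply/matrixP => i j; rewrite !mxE.
by apply: (eq_pd hM ac oW Wp cp) => q Wq; rewrite FG.
Qed.

Lemma pdmD r s (F G : T -> 'M[R]_(r, s)) k : smooth_mx W F -> smooth_mx W G ->
  pdm c k (fun q => F q + G q) p = pdm c k F p + pdm c k G p.
Proof.
move=> hF hG; apply/matrixP => i j; rewrite !mxE.
rewrite -(pdD aX hM ac oW Wp cp) //; congr (pd M c k _ p).
by apply/funext => q; rewrite mxE.
Qed.

Lemma pdm_sum (I : Type) (e : seq I) r s (F : I -> T -> 'M[R]_(r, s)) k :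
  (forall a, smooth_mx W (F a)) ->
  pdm c k (fun q => \sum_(a <- e) F a q) p = \sum_(a <- e) pdm c k (F a) p.
Proof.
move=> hF; apply/matrixP => i j; rewrite !mxE summxE.
under [RHS]eq_bigr => a _ do rewrite mxE.
rewrite -(pd_sum aX hM ac oW Wp cp) => [|a _]; last exact: hF.
by congr (pd M c k _ p); apply/funext => q; rewrite summxE.
Qed.

Lemma pdmZ r s (f : T -> R) (F : T -> 'M[R]_(r, s)) k :
  smooth_fun M W f -> smooth_mx W F ->
  pdm c k (fun q => f q *: F q) p = pd M c k f p *: F p + f p *: pdm c k F p.
Proof.
move=> hf hF; apply/matrixP => i j; rewrite !mxE.
rewrite -(pdM aX hM ac oW Wp cp) //; congr (pd M c k _ p).
by apply/funext => q; rewrite mxE.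
Qed.

Lemma pdmM r s t (F : T -> 'M[R]_(r, s)) (G : T -> 'M[R]_(s, t)) k :
  smooth_mx W F -> smooth_mx W G ->
  pdm c k (fun q => F q *m G q) p = pdm c k F p *m G p + F p *m pdm c k G p.
Proof.
move=> hF hG; apply/matrixP => i j; rewrite !mxE -big_split /=.
transitivity (pd M c k (fun q => \sum_b F q i b * G q b j) p).
  by congr (pd M c k _ p); apply/funext => q; rewrite mxE.
rewrite (pd_sum aX hM ac oW Wp cp) => [|b _]; last exact: smooth_funM.
by apply: eq_bigr => b _; rewrite (pdM aX hM ac oW Wp cp) // !mxE.
Qed.

Lemma pd_trace r (F : T -> 'M[R]_r) k : smooth_mx W F ->
  pd M c k (fun q => \tr (F q)) p = \tr (pdm c k F p).
Proof.
move=> hF; rewrite /mxtrace (pd_sum aX hM ac oW Wp cp) => [|i _]; last exact: hF.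
by apply: eq_bigr => i _; rewrite mxE.
Qed.

Lemma pdm_comm r s (F : T -> 'M[R]_(r, s)) k l : smooth_mx W F ->
  pdm c l (pdm c k F) p = pdm c k (pdm c l F) p.
Proof.
move=> hF; apply/matrixP => i j; rewrite [LHS]mxE [RHS]mxE.
have E (a : 'I_n) : (fun q => pdm c a F q i j) = pd M c a (fun q => F q i j).
  by apply/funext => q; rewrite mxE.
by rewrite !E (pd_comm aX hM ac oW Wp cp).
Qed.

Lemma pdm_chain c' r s (F : T -> 'M[R]_(r, s)) k : chart_at M p c' -> smooth_mx W F ->
  pdm c k F p = \sum_a jac M c c' p k a *: pdm c' a F p.
Proof.
move=> [ac' cp'] hF; apply/matrixP => i j; rewrite mxE summxE.
rewrite (pd_chain aX hM ac oW Wp cp k ac' cp' (hF i j)).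
by apply: eq_bigr => a _; rewrite [RHS]mxE [pdm _ _ _ _ i j]mxE.
Qed.

End AtPoint.

(* For matrices [S_k], entry [(j,i)] of [S_k] being the coefficient [S^i_jk] of a
   connection form, [curv c S a b] has entry [(j,i)] equal to
   [(dS^i_j + S^i_k /\ S^k_j)(d/dx^a, d/dx^b)]. *)
Definition curv m c (S : 'I_n -> T -> 'M[R]_m) (a b : 'I_n) p : 'M[R]_m :=
  pdm c a (S b) p - pdm c b (S a) p + S b p *m S a p - S a p *m S b p.

(** The gauge relation is differentiated and antisymmetrised in the two directions: the second
    derivatives of [J] cancel, and its first derivatives are eliminated by the relation itself. *)
Lemma curv_gauge c W p m (S Q : 'I_n -> T -> 'M[R]_m) (J : T -> 'M[R]_m) a b :
  atl M c -> open_in M W -> W p -> W `<=` cdom c ->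
  (forall k, smooth_mx W (S k)) -> (forall k, smooth_mx W (Q k)) -> smooth_mx W J ->
  (forall k q, W q -> S k q *m J q = J q *m Q k q + pdm c k J q) ->
  curv c S a b p *m J p = J p *m curv c Q a b p.
Proof.
move=> ac oW Wp sW sS sQ sJ H.
have cp := sW _ Wp.
have sdJ k : smooth_mx W (pdm c k J).
  by apply: smooth_mx_sub (smooth_mx_pdm k ac oW sJ) => q Wq; split=> //; exact: sW.
have E k l : pdm c l (S k) p *m J p + S k p *m pdm c l J p =
    pdm c l J p *m Q k p + J p *m pdm c l (Q k) p + pdm c l (pdm c k J) p.
  rewrite -(pdmM ac oW Wp cp) // (eq_pdm ac oW Wp cp l (H k)).
  rewrite (pdmD ac oW Wp cp) //; last exact: smooth_mxM.
  by rewrite (pdmM ac oW Wp cp).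
have E1 := E b a; have E2 := E a b.
rewrite (pdm_comm ac oW Wp cp a b sJ) in E2.
have D k : pdm c k J p = S k p *m J p - J p *m Q k p.
  by rewrite H // addrC addKr.
move: E1 E2; rewrite !D /curv !(mulmxDl, mulmxDr, mulmxBl, mulmxBr, mulNmx, mulmxN).
rewrite !mulmxA.
(* After expansion both relations and the goal are linear in the matrix products, which can be
   treated as atoms, entry by entry. *)
move: (pdm c a (pdm c b J) p) => Z.
do 12?[move: (_ *m _) => ?].
move=> E1 E2; apply/matrixP => i j.
move: (congr1 (fun X : 'M[R]_m => X i j) E1) (congr1 (fun X : 'M[R]_m => X i j) E2).
rewrite !mxE; lra.
Qed.

End MatrixCalculus.

(** * Algebra of projective changes and their effect on the contracted curvature *)

Section ProjectiveChange.
Variables (R : realType) (n : nat).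
Implicit Types (u w : 'I_n -> R) (i j k l : 'I_n) (S : 'I_n -> 'M[R]_n).

(* The change of the matrices [Pi_k], in the convention of [curv], when
   [u(X)Y + u(Y)X] is added to the connection. *)
Definition tau u k : 'M[R]_n := (u k)%:M + (\col_j u j) *m delta_mx 0 k.

Lemma tauE u k j i : tau u k j i = u k * (j == i)%:R + u j * (i == k)%:R.
Proof. by rewrite !mxE big_ord1 !mxE eqxx /= [u k * _]mulr_natr. Qed.

Lemma tauD u w k : tau (fun l => u l + w l) k = tau u k + tau w k.
Proof. by apply/matrixP => j i; rewrite [RHS]mxE !tauE; ring. Qed.

Lemma tauZ (a : R) u k : tau (fun l => a * u l) k = a *: tau u k.
Proof. by apply/matrixP => j i; rewrite [RHS]mxE !tauE; ring. Qed.

Lemma tau_sym u k j i : tau u k j i = tau u j k i.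
Proof. by rewrite !tauE eq_sym [i == k]eq_sym; ring. Qed.

(** [tau] is built from a covector and the identity only, hence it is natural under changes of
    basis: its scalar part is preserved by conjugation, its rank-one part is moved by [J] on the
    column and on the row. *)
Lemma tau_transform (J K : 'M[R]_n) u k : J *m K = 1%:M ->
  tau (fun l => \sum_b J l b * u b) k =
  J *m (\sum_b J k b *: tau u b) *m K.
Proof.
move=> JK.
have -> : \sum_b J k b *: tau u b =
    (\sum_b J k b * u b)%:M + (\col_b u b) *m row k J.
  apply/matrixP => a i; rewrite summxE mxE [((_)%:M) _ _]mxE [((_ *m _) _ _)]mxE.
  under eq_bigr do rewrite mxE tauE mulrDr.
  rewrite big_split /= big_ord1 !mxE; congr (_ + _).
    by rewrite -[RHS]mulr_natr big_distrl; apply: eq_bigr => b _ /=; rewrite mulrA.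
  rewrite (bigD1 i) //= big1 ?addr0 => [|b]; first by rewrite eqxx mulr1 mulrC.
  by rewrite eq_sym => /negPf ->; rewrite !mulr0.
rewrite mulmxDr mulmxDl mul_mx_scalar -scalemxAl JK scalemx1 /tau; congr (_ + _).
rewrite -!mulmxA -row_mul JK row1 mulmxA; congr (_ *m _).
by apply/colP => j; rewrite !mxE; apply: eq_bigr => b _; rewrite mxE.
Qed.

(** This is the cost of replacing the symbols before a projective change by those after it when they
    are contracted with [u] itself. *)
Lemma tau_mul_col u l j :
  (tau u l *m \col_k u k) j 0 = u l * u j + u l * u j.
Proof.
rewrite /tau mulmxDl mul_scalar_mx -mulmxA -rowE mxE; congr (_ + _).
  by rewrite !mxE.
by rewrite mxE big_ord1 !mxE mulrC.
Qed.

(** The scalar parts of [tau] commute with everything. Symmetry of [S] cancels the terms in which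
    [S] stands to the right of the rank-one part. What remains is the same for every [i != l] and
    vanishes for [i = l], hence the factor [n - 1], which the normalisation of [thomas_P] divides
    out. *)
Lemma sum_commutator_tau S u l j :
  (forall i k, S k i =1 S i k) ->
  \sum_i ((S l + tau u l) *m (S i + tau u i) - (S i + tau u i) *m (S l + tau u l)) j i =
  \sum_i (S l *m S i - S i *m S l) j i
  + (n%:R - 1) * ((S l *m \col_k u k) j 0 + u l * u j).
Proof.
move=> Ssym; set d := \col_k u k.
have E i : (S l + tau u l) *m (S i + tau u i) - (S i + tau u i) *m (S l + tau u l) =
    (S l *m S i - S i *m S l) + (S l *m (d *m delta_mx 0 i) - d *m delta_mx 0 i *m S l)
    + (d *m delta_mx 0 l *m S i - S i *m (d *m delta_mx 0 l))
    + (d *m delta_mx 0 l *m (d *m delta_mx 0 i)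
       - d *m delta_mx 0 i *m (d *m delta_mx 0 l)).
  rewrite /tau -/d; set X := d *m delta_mx 0 l; set Y := d *m delta_mx 0 i.
  rewrite !(mulmxDl, mulmxDr) !mul_scalar_mx !mul_mx_scalar !scale_scalar_mx.
  apply/matrixP => a b; rewrite !mxE; ring.
have de (A : 'M[R]_n) k a b :
    (A *m (d *m delta_mx 0 k)) a b = (A *m d) a 0 * (b == k)%:R.
  by rewrite mulmxA mxE big_ord1 [delta_mx _ _ _ _]mxE eqxx.
have ed (A : 'M[R]_n) k a b : (d *m delta_mx 0 k *m A) a b = u a * A k b.
  by rewrite -mulmxA mxE big_ord1 -rowE !mxE.
have dd k : (d *m delta_mx (0 : 'I_1) k *m d) = u k *: d.
  apply/colP => a; rewrite -mulmxA -rowE !mxE big_ord1 !mxE mulrC; ring.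
have Ei i : ((S l + tau u l) *m (S i + tau u i)
             - (S i + tau u i) *m (S l + tau u l)) j i =
    (S l *m S i - S i *m S l) j i
    + (1 - (i == l)%:R) * ((S l *m d) j 0 + u l * u j).
  rewrite E !(entryD, entryN) !de !ed !dd [(u l *: d) j 0]mxE [(u i *: d) j 0]mxE.
  rewrite eqxx (Ssym i l).
  rewrite [d j 0]mxE; have [->|_] := eqVneq i l; rewrite /= ?mulr1n ?mulr0n; ring.
rewrite (eq_bigr _ (fun i _ => Ei i)) big_split /= -big_distrl /=; congr (_ + _ * _).
rewrite sumrB sumr_const card_ord (bigD1 l) //= eqxx big1 ?addr0 //.
by move=> i /negPf ->.
Qed.

End ProjectiveChange.

Section ProjectiveCurvature.
Variables (R : realType) (T : topologicalType) (n : nat) (M : mfd R T n).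
Hypothesis aX : approachable (msp M).
Hypothesis hM : is_manifold M.
Implicit Types (c : chart R T n) (p q : T) (W : set T) (k l : 'I_n).

Lemma smooth_mx_tau W (u : 'I_n -> T -> R) k : (forall j, smooth_fun M W (u j)) ->
  smooth_mx M W (fun q => tau (u^~ q) k).
Proof.
move=> su j i.
apply: (eq_smooth_fun hM (F := fun q => u k q * (j == i)%:R + u j q * (i == k)%:R)).
  by move=> q _; rewrite tauE.
apply: (smooth_funD (F := fun q => u k q * _) (G := fun q => u j q * _));
  by apply: smooth_funM => //; exact: smooth_fun_cst.
Qed.

(** This is the classical change of the projective Schouten tensor by [- nabla u + u (x) u], with
    [nabla] the covariant derivative whose symbols are [S]; closedness of [u] removes its
    antisymmetric part. *)
Lemma ricci_tau c W p (S : 'I_n -> T -> 'M[R]_n) (u : 'I_n -> T -> R) l j :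
  atl M c -> open_in M W -> W p -> cdom c p ->
  (forall k, smooth_mx M W (S k)) -> (forall k, smooth_fun M W (u k)) ->
  (forall i k, S k p i =1 S i p k) ->
  (forall i k, pd M c i (u k) p = pd M c k (u i) p) ->
  \sum_i curv M c (fun k q => S k q + tau (u^~ q) k) i l p j i =
  \sum_i curv M c S i l p j i
  + (n%:R - 1) * ((S l p *m \col_k u k p) j 0 + u l p * u j p - pd M c l (u j) p).
Proof.
move=> ac oW Wp cp sS su Ssym cu.
have st k := smooth_mx_tau k su.
have dE k m : pdm M c m (fun q => S k q + tau (u^~ q) k) p =
    pdm M c m (S k) p + tau (fun i => pd M c m (u i) p) k.
  rewrite (pdmD aX hM ac oW Wp cp) //; congr (_ + _).
  apply/matrixP => a b; rewrite mxE tauE.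
  rewrite (eq_pd hM ac oW Wp cp
     (G := fun q => u k q * (a == b)%:R + u a q * (b == k)%:R)); last first.
    by move=> q _; rewrite tauE.
  have s1 (r : R) : smooth_fun M W (fun=> r) by exact: smooth_fun_cst.
  rewrite (pdD aX hM ac oW Wp cp); [|exact: smooth_funM|exact: smooth_funM].
  rewrite !(pdM aX hM ac oW Wp cp) // !(pd_cst aX hM ac oW Wp cp).
  by rewrite !mulr0 !addr0.
have Ei i : curv M c (fun k q => S k q + tau (u^~ q) k) i l p j i =
    (pdm M c i (S l) p - pdm M c l (S i) p) j i
    + (tau (fun k => pd M c i (u k) p) l - tau (fun k => pd M c l (u k) p) i) j i
    + ((S l p + tau (u^~ p) l) *m (S i p + tau (u^~ p) i)
       - (S i p + tau (u^~ p) i) *m (S l p + tau (u^~ p) l)) j i.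
  by rewrite /curv !dE !(entryD, entryN); ring.
rewrite (eq_bigr _ (fun i _ => Ei i)) !big_split /=.
rewrite (sum_commutator_tau (S := S^~ p)) //.
have -> : \sum_i curv M c S i l p j i =
    \sum_i (pdm M c i (S l) p - pdm M c l (S i) p) j i
    + \sum_i (S l p *m S i p - S i p *m S l p) j i.
  by rewrite -big_split; apply: eq_bigr => i _ /=; rewrite /curv !(entryD, entryN); ring.
(* The two terms with [j = i] cancel because [u] is closed; of the others, one survives only for
   [i = l] and the other occurs [n] times. *)
have -> : \sum_i (tau (fun k => pd M c i (u k) p) l
                  - tau (fun k => pd M c l (u k) p) i) j i
    = - (n%:R - 1) * pd M c l (u j) p.
  have Et i : (tau (fun k => pd M c i (u k) p) l
       - tau (fun k => pd M c l (u k) p) i) j i =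
      (i == l)%:R * pd M c l (u j) p - pd M c l (u j) p.
    rewrite entryD entryN !tauE eqxx (cu i l).
    by have [->|_] := eqVneq i l; rewrite /= ?mulr1n ?mulr0n; ring.
  rewrite (eq_bigr _ (fun i _ => Et i)) sumrB sumr_const card_ord -big_distrl /=.
  rewrite (bigD1 l) //= eqxx big1 ?addr0 => [|i /negPf -> //].
  by rewrite -[_ *+ n]mulr_natl /= mulr1n; ring.
ring.
Qed.

End ProjectiveCurvature.

#[local] Opaque pd pdm jac.

(** * Transformation of the Thomas invariant *)

Section ThomasTransformation.
Variables (R : realType) (T : topologicalType) (n : nat) (M : mfd R T n).
Hypothesis aX : approachable (msp M).
Hypothesis hM : is_manifold M.
Implicit Types (c : chart R T n) (p q : T) (W : set T) (i j k l : 'I_n).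

Lemma jac_inv c c' p : chart_at M p c -> chart_at M p c' ->
  jac M c c' p *m jac M c' c p = 1%:M.
Proof. by move=> pc pc'; rewrite -(jac_cocycle aX hM) // (jac_id aX hM). Qed.

Lemma pd_jac_sym c c' p k l m : chart_at M p c -> chart_at M p c' ->
  pd M c k (fun q => jac M c c' q l m) p = pd M c l (fun q => jac M c c' q k m) p.
Proof.
move=> [ac cp] [ac' cp'].
under eq_fun do rewrite jacE; under [in RHS]eq_fun do rewrite jacE.
exact: (pd_comm aX hM ac (open_in_cdom hM ac') cp' cp _ _ (smooth_fun_coord hM m ac')).
Qed.

Lemma open_in_overlap c c' : atl M c -> atl M c' -> open_in M (cdom c `&` cdom c').
Proof. by move=> ac ac'; apply: open_inI; exact: (open_in_cdom hM). Qed.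

(** The curvature of a pulled back connection form is the pulled back curvature; the derivatives of
    the Jacobian entries cancel because second derivatives of the transition map are symmetric. *)
Lemma curv_pullback c c' p m (P : 'I_n -> T -> 'M[R]_m) x y :
  chart_at M p c -> chart_at M p c' ->
  (forall b, smooth_mx M (cdom c `&` cdom c') (P b)) ->
  curv M c (fun k q => \sum_b jac M c c' q k b *: P b q) x y p =
  \sum_b \sum_e (jac M c c' p x e * jac M c c' p y b) *: curv M c' P e b p.
Proof.
move=> pc pc' sP; have [[ac cp] [ac' cp']] := (pc, pc').
have oW := open_in_overlap ac ac'; set W := _ `&` _ in oW sP.
have Wp : W p by [].
have sJ k b : smooth_fun M W (fun q => jac M c c' q k b) by exact: smooth_fun_jac.
have dQ a b : pdm M c a (fun q => \sum_e jac M c c' q b e *: P e q) p =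
    \sum_e pd M c a (fun q => jac M c c' q b e) p *: P e p +
    \sum_f \sum_e (jac M c c' p a e * jac M c c' p b f) *: pdm M c' e (P f) p.
  rewrite (pdm_sum aX hM ac oW Wp cp) => [|e]; last exact: smooth_mxZ.
  rewrite -big_split /=; apply: eq_bigr => e _.
  rewrite (pdmZ aX hM ac oW Wp cp) //; congr (_ + _).
  rewrite (pdm_chain aX hM ac oW Wp cp a pc') // scaler_sumr.
  by apply: eq_bigr => f _; rewrite scalerA mulrC.
have QQ a b : (\sum_e jac M c c' p a e *: P e p) *m (\sum_e jac M c c' p b e *: P e p)
    = \sum_f \sum_e (jac M c c' p b e * jac M c c' p a f) *: (P f p *m P e p).
  rewrite mulmx_suml; apply: eq_bigr => f _; rewrite mulmx_sumr; apply: eq_bigr => e _.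
  by rewrite -scalemxAl -scalemxAr scalerA mulrC.
rewrite /curv !dQ !QQ.
have -> : \sum_e pd M c x (fun q => jac M c c' q y e) p *: P e p =
          \sum_e pd M c y (fun q => jac M c c' q x e) p *: P e p.
  by apply: eq_bigr => e _; rewrite (pd_jac_sym x y e pc pc').
have -> : \sum_f \sum_e (jac M c c' p y e * jac M c c' p x f) *: pdm M c' e (P f) p =
    \sum_f \sum_e (jac M c c' p x e * jac M c c' p y f) *: pdm M c' f (P e) p.
  by rewrite exchange_big; apply: eq_bigr => f _; apply: eq_bigr => e _; rewrite mulrC.
have -> : \sum_f \sum_e (jac M c c' p y e * jac M c c' p x f) *: (P f p *m P e p) =
    \sum_f \sum_e (jac M c c' p x e * jac M c c' p y f) *: (P e p *m P f p).
  by rewrite exchange_big; apply: eq_bigr => f _; apply: eq_bigr => e _; rewrite mulrC.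
rewrite opprD addrACA subrr add0r -sumrB -big_split -sumrB /=; apply: eq_bigr => f _.
rewrite -sumrB -big_split -sumrB /=; apply: eq_bigr => e _.
by rewrite !(scalerBr, scalerDr).
Qed.

(** Here [t] is the logarithmic derivative of the Jacobian determinant. Determinants are avoided:
    differentiating [J *m K = 1] gives the derivative of the inverse [K], after which second
    derivatives commute and the quadratic term is symmetric by cyclicity of the trace. *)
Lemma trace_pd_jac_closed c c' p k l : chart_at M p c -> chart_at M p c' ->
  let t := fun k q => \tr (pdm M c k (jac M c c') q *m jac M c' c q) in
  pd M c k (t l) p = pd M c l (t k) p.
Proof.
move=> pc pc' /=; have [[ac cp] [ac' cp']] := (pc, pc').
have oW := open_in_overlap ac ac'; set W := _ `&` _ in oW.
have Wp : W p by [].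
have sJ : smooth_mx M W (jac M c c') by move=> a b; exact: smooth_fun_jac.
have sK : smooth_mx M W (jac M c' c).
  by move=> a b; rewrite /W setIC; exact: smooth_fun_jac.
have sdJ a : smooth_mx M W (pdm M c a (jac M c c')).
  by apply: smooth_mx_sub (smooth_mx_pdm aX hM a ac oW sJ) => q [].
have dK a : pdm M c a (jac M c' c) p =
    - (jac M c' c p *m pdm M c a (jac M c c') p *m jac M c' c p).
  have : pdm M c a (fun q => jac M c c' q *m jac M c' c q) p = 0.
    rewrite (eq_pdm hM ac oW Wp cp (G := fun=> 1%:M)); last first.
      by move=> q [cq cq']; rewrite jac_inv.
    by apply/matrixP => r s; rewrite pdmE (pd_cst aX hM ac oW Wp cp) mxE.
  rewrite (pdmM aX hM ac oW Wp cp a sJ sK) => /(congr1 (mulmx (jac M c' c p))).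
  rewrite mulmx0 mulmxDr mulmxA [X in _ + X]mulmxA jac_inv // mul1mx addrC.
  by move/eqP; rewrite addr_eq0 => /eqP.
have dt a b : pd M c a (fun q => \tr (pdm M c b (jac M c c') q *m jac M c' c q)) p =
    \tr (pdm M c a (pdm M c b (jac M c c')) p *m jac M c' c p)
    - \tr (pdm M c b (jac M c c') p *m jac M c' c p
            *m (pdm M c a (jac M c c') p *m jac M c' c p)).
  rewrite (pd_trace aX hM ac oW Wp cp a (smooth_mxM (sdJ b) sK)).
  apply: (etrans (congr1 mxtrace (pdmM aX hM ac oW Wp cp a (sdJ b) sK))).
  rewrite dK.
  set X := pdm M c a (pdm M c b (jac M c c')) p.
  set Y := pdm M c b (jac M c c') p; set Z := pdm M c a (jac M c c') p.
  by move: X Y Z => X Y Z; rewrite mulmxN raddfB /= !mulmxA.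
apply: (etrans (dt k l)); apply: (etrans _ (esym (dt l k))).
exact: (congr2 (fun X y => \tr (X *m jac M c' c p) - y)
  (pdm_comm aX hM ac oW Wp cp l k sJ) (mxtrace_mulC _ _)).
Qed.

Section Thomas.
Variable nab : connection R T n.
Hypothesis cnab : is_connection M nab.
Hypothesis tnab : torsion_free M nab.

Definition chris_mx c k p : 'M[R]_n := \matrix_(j, i) christoffel M nab c p i j k.
Definition thomas_mx c k p : 'M[R]_n := \matrix_(j, i) thomas M nab c p i j k.

(* The entries of the last row of the transition function [h_ij] of the paper. *)
Definition proj_factor c c' k p : R :=
  - (n%:R + 1)^-1 * \tr (pdm M c k (jac M c c') p *m jac M c' c p).

(** In a fixed chart, the Thomas symbols arise from the Christoffel symbols by the projective change
    that removes their trace. *)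
Lemma thomas_mxE c k p : thomas_mx c k p =
  chris_mx c k p - tau (fun l => (n%:R + 1)^-1 * \tr (chris_mx c l p)) k.
Proof.
apply/matrixP => j i.
rewrite entryD entryN tauE !mxE /thomas /mxtrace.
have E l : \sum_i0 chris_mx c l p i0 i0 = \sum_i0 christoffel M nab c p i0 i0 l.
  by apply: eq_bigr => a _; rewrite mxE.
by rewrite !E [j == i]eq_sym; ring.
Qed.

Lemma chris_mx_transform c c' k p : chart_at M p c -> chart_at M p c' ->
  chris_mx c k p = (jac M c c' p *m (\sum_b jac M c c' p k b *: chris_mx c' b p)
                    + pdm M c k (jac M c c') p) *m jac M c' c p.
Proof.
move=> pc pc'; apply/matrixP => j i; rewrite [LHS]mxE.
rewrite (christoffel_transform aX hM cnab i j k pc pc') [RHS]mxE.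
apply: eq_bigr => m _; congr (_ * _); rewrite [RHS]mxE; congr (_ + _).
  rewrite [RHS]mxE; apply: eq_bigr => a _; rewrite summxE big_distrr /=.
  apply: eq_bigr => b _ /=.
  by rewrite entryZ [chris_mx _ _ _ a m]mxE mulrA.
by rewrite pdmE (pd_jac_sym k j m pc pc').
Qed.

(** The trace of the Christoffel law has a tensorial part, which [tau_transform] absorbs into the
    Thomas symbols of [c'], and the term [\tr (dJ K)], which is left over as [proj_factor]. *)
Lemma thomas_mx_transform c c' k p : chart_at M p c -> chart_at M p c' ->
  thomas_mx c k p = (jac M c c' p *m (\sum_b jac M c c' p k b *: thomas_mx c' b p)
                     + pdm M c k (jac M c c') p) *m jac M c' c p
                    + tau (fun l => proj_factor c c' l p) k.
Proof.
move=> pc pc'; set J := jac M c c' p; set K := jac M c' c p.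
have JK : J *m K = 1%:M by exact: jac_inv.
have KJ : K *m J = 1%:M by exact: jac_inv.
set r : R := (n%:R + 1)^-1.
pose u' l := r * \tr (chris_mx c' l p).
have trE l : r * \tr (chris_mx c l p) =
    \sum_b J l b * u' b + - proj_factor c c' l p.
  rewrite (chris_mx_transform l pc pc') -/J -/K mulmxDl mxtraceD mulrDr.
  rewrite /proj_factor -/K -/r mulNr opprK; congr (_ + _).
  rewrite -mulmxA mxtrace_mulC -mulmxA KJ mulmx1 raddf_sum /= big_distrr /=.
  by apply: eq_bigr => b _; rewrite linearZ /= mulrCA.
rewrite thomas_mxE (chris_mx_transform k pc pc') -/J -/K.
under [X in tau X k]eq_fun do rewrite trE.
rewrite tauD (tau_transform _ _ JK).
have -> : tau (fun l => - proj_factor c c' l p) k =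
    - tau (fun l => proj_factor c c' l p) k.
  rewrite -scaleN1r -tauZ; congr (tau _ k); apply/funext => l.
  by rewrite mulN1r.
have -> : \sum_b J k b *: thomas_mx c' b p =
    \sum_b J k b *: chris_mx c' b p - \sum_b J k b *: tau u' b.
  by rewrite -sumrB; apply: eq_bigr => b _; rewrite thomas_mxE scalerBr.
rewrite mulmxBr !mulmxDl mulNmx opprD opprK addrA; congr (_ + _).
by rewrite addrAC.
Qed.

Lemma thomas_mx_sym c p k j i : chart_at M p c ->
  thomas_mx c k p j i = thomas_mx c j p k i.
Proof.
move=> pc; rewrite !mxE /thomas (christoffel_sym aX hM i j k tnab pc).
ring.
Qed.

Lemma smooth_mx_thomas c k : atl M c -> smooth_mx M (cdom c) (thomas_mx c k).
Proof.
move=> ac.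
have sG l : smooth_mx M (cdom c) (chris_mx c l).
  move=> j i; apply: (eq_smooth_fun hM (F := fun q => christoffel M nab c q i j l)).
    by move=> q _; rewrite mxE.
  exact: (smooth_fun_christoffel aX hM cnab).
pose u l q := (n%:R + 1)^-1 * \tr (chris_mx c l q).
have su l : smooth_fun M (cdom c) (u l).
  apply: (@smooth_funM R T n M (cdom c) (fun=> _) (fun q => \tr (chris_mx c l q))).
    exact: smooth_fun_cst.
  apply: (@smooth_fun_sum R T n M _ _ _ _ (fun a q => chris_mx c l q a a)) => a _.
  exact: sG.
have -> : thomas_mx c k = fun q => chris_mx c k q - tau (u^~ q) k.
  by apply/funext => q; rewrite thomas_mxE.
apply: (@smooth_mxB R T n M hM n n _ _ (fun q => tau (u^~ q) k) (sG k)).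
exact: smooth_mx_tau.
Qed.

Lemma thomas_curvE c p i j a b : chart_at M p c ->
  thomas_curv M nab c p i j a b = curv M c (thomas_mx c) a b p j i.
Proof.
move=> pc; have [ac cp] := pc.
rewrite /curv !mxE /thomas_curv /dform /wedge /thomas_coform (cinvK hM) //.
have E k : (fun q => thomas_mx c k q j i) = (fun q => thomas M nab c q i j k).
  by apply/funext => q; rewrite mxE.
rewrite !E -addrA; congr (_ - _ + _).
rewrite -sumrB; apply: eq_bigr => m _; rewrite !mxE; ring.
Qed.

End Thomas.

End ThomasTransformation.

(** * Transformation of the contracted curvature under changes of charts *)

Section SchoutenTransformation.
Variables (R : realType) (T : topologicalType) (n : nat) (M : mfd R T n).
Hypothesis aX : approachable (msp M).
Hypothesis hM : is_manifold M.
Variable nab : connection R T n.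
Hypothesis cnab : is_connection M nab.
Hypothesis tnab : torsion_free M nab.
Implicit Types (c : chart R T n) (p q : T) (W : set T) (i j k l : 'I_n).

Lemma thomas_P_curv c p l j : chart_at M p c ->
  thomas_P M nab c p l j =
  (n%:R - 1)^-1 * \sum_i curv M c (thomas_mx M nab c) i l p j i.
Proof.
move=> pc; rewrite /thomas_P; congr (_ * _); apply: eq_bigr => i _.
exact: thomas_curvE.
Qed.

Lemma smooth_proj_factor c c' k : atl M c -> atl M c' ->
  smooth_fun M (cdom c `&` cdom c') (proj_factor M c c' k).
Proof.
move=> ac ac'; have oW := open_in_overlap hM ac ac'.
have sJ : smooth_mx M (cdom c `&` cdom c') (jac M c c').
  by move=> a b; exact: smooth_fun_jac.
have sK : smooth_mx M (cdom c `&` cdom c') (jac M c' c).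
  by move=> a b; rewrite setIC; exact: smooth_fun_jac.
have sdJ : smooth_mx M (cdom c `&` cdom c') (pdm M c k (jac M c c')).
  by apply: smooth_mx_sub (smooth_mx_pdm aX hM k ac oW sJ) => q [].
apply: (@smooth_funM R T n M _ (fun=> _)); first exact: smooth_fun_cst.
apply: (@smooth_fun_sum R T n M _ _ _ _
  (fun a q => (pdm M c k (jac M c c') q *m jac M c' c q) a a)) => a _.
exact: (smooth_mxM sdJ sK).
Qed.

Lemma proj_factor_closed c c' p k l : chart_at M p c -> chart_at M p c' ->
  pd M c k (proj_factor M c c' l) p = pd M c l (proj_factor M c c' k) p.
Proof.
move=> pc pc'; have [[ac cp] [ac' cp']] := (pc, pc').
have oW := open_in_overlap hM ac ac'.
have sJ : smooth_mx M (cdom c `&` cdom c') (jac M c c').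
  by move=> a b; exact: smooth_fun_jac.
have sK : smooth_mx M (cdom c `&` cdom c') (jac M c' c).
  by move=> a b; rewrite setIC; exact: smooth_fun_jac.
have st m : smooth_fun M (cdom c `&` cdom c')
    (fun q => \tr (pdm M c m (jac M c c') q *m jac M c' c q)).
  apply: (@smooth_fun_sum R T n M _ _ _ _
    (fun a q => (pdm M c m (jac M c c') q *m jac M c' c q) a a)) => a _.
  apply: (smooth_mxM _ sK).
  by apply: smooth_mx_sub (smooth_mx_pdm aX hM m ac oW sJ) => q [].
have E a b : pd M c a (proj_factor M c c' b) p = - (n%:R + 1)^-1 *
    pd M c a (fun q => \tr (pdm M c b (jac M c c') q *m jac M c' c q)) p.
  exact: (pdZ aX hM ac oW (conj cp cp') cp a _ (st b)).
apply: (etrans (E k l)); apply: (etrans _ (esym (E l k))).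
exact: (congr1 (fun t => - (n%:R + 1)^-1 * t) (trace_pd_jac_closed aX hM k l pc pc')).
Qed.

(** The contraction over [i] joins the factor [K] of the conjugation with the factor [J i e] of the
    pullback; as [K *m J = 1], it becomes the contraction over [e]. *)
Lemma contract_gauge (J K : 'M[R]_n) (C : 'I_n -> 'I_n -> 'M[R]_n) l j :
  K *m J = 1%:M ->
  \sum_i (J *m (\sum_b \sum_e (J i e * J l b) *: C e b) *m K) j i =
  \sum_b \sum_a J l b * J j a * \sum_e C e b a e.
Proof.
move=> KJ.
have E i : (J *m (\sum_b \sum_e (J i e * J l b) *: C e b) *m K) j i =
    \sum_b \sum_e J l b * ((J *m C e b *m K) j i * J i e).
  rewrite mulmx_sumr mulmx_suml summxE; apply: eq_bigr => b _.
  rewrite mulmx_sumr mulmx_suml summxE; apply: eq_bigr => e _.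
  by rewrite -scalemxAr -scalemxAl entryZ; ring.
rewrite (eq_bigr _ (fun i _ => E i)) exchange_big; apply: eq_bigr => b _ /=.
rewrite exchange_big /=.
under eq_bigr => e _.
  rewrite -big_distrr /=.
  have -> : \sum_i (J *m C e b *m K) j i * J i e = (J *m C e b *m K *m J) j e.
    by rewrite [RHS]mxE.
  rewrite -mulmxA KJ mulmx1 mxE big_distrr /=.
  over.
rewrite exchange_big; apply: eq_bigr => a _; rewrite big_distrr /=.
by apply: eq_bigr => e _; rewrite mulrA.
Qed.

Lemma thomas_P_transform c c' p l j : n%:R - 1 != 0 :> R ->
  chart_at M p c -> chart_at M p c' ->
  thomas_P M nab c p l j =
  \sum_b \sum_a jac M c c' p l b * jac M c c' p j a * thomas_P M nab c' p b a
  + (thomas_mx M nab c l p *m \col_k proj_factor M c c' k p) j 0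
  - proj_factor M c c' l p * proj_factor M c c' j p
  - pd M c l (proj_factor M c c' j) p.
Proof.
move=> n1 pc pc'; have [[ac cp] [ac' cp']] := (pc, pc').
have oW := open_in_overlap hM ac ac'; set W := _ `&` _ in oW.
have Wp : W p by [].
pose u k q := proj_factor M c c' k q.
have su k : smooth_fun M W (u k) by exact: smooth_proj_factor.
(* Without its projective part, the Thomas matrix is exactly a linear gauge transform of the
   pullback [Q], so its curvature is tensorial; [ricci_tau] then restores the projective part. *)
pose S k q := thomas_mx M nab c k q - tau (u^~ q) k.
pose Q k q := \sum_b jac M c c' q k b *: thomas_mx M nab c' b q.
have sT k : smooth_mx M W (thomas_mx M nab c k).
  by apply: smooth_mx_sub (smooth_mx_thomas aX hM cnab k ac) => q [].
have sT' k : smooth_mx M W (thomas_mx M nab c' k).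
  by apply: smooth_mx_sub (smooth_mx_thomas aX hM cnab k ac') => q [].
have sS k : smooth_mx M W (S k).
  apply: (@smooth_mxB R T n M hM n n _ _ (fun q => tau (u^~ q) k) (sT k)).
  exact: smooth_mx_tau.
have sJ : smooth_mx M W (jac M c c') by move=> a b; exact: smooth_fun_jac.
have sQ k : smooth_mx M W (Q k).
  apply: (@smooth_mx_sum R T n M _ _ _ _ _
    (fun b q => jac M c c' q k b *: thomas_mx M nab c' b q)) => b.
  exact: (@smooth_mxZ R T n M _ _ _ (fun q => jac M c c' q k b)).
have gauge k q : W q ->
    S k q *m jac M c c' q = jac M c c' q *m Q k q + pdm M c k (jac M c c') q.
  move=> [cq cq'].
  rewrite /S (thomas_mx_transform aX hM cnab k (conj ac cq) (conj ac' cq')).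
  rewrite addrK -mulmxA (jac_inv aX hM (conj ac' cq') (conj ac cq)).
  exact: mulmx1.
have symS i k : S k p i =1 S i p k.
  by move=> b; rewrite !entryD !entryN (thomas_mx_sym aX hM tnab k i b pc) tau_sym.
have KJ := jac_inv aX hM pc' pc.
have TE : thomas_mx M nab c = fun k q => S k q + tau (u^~ q) k.
  by apply/funext => k; apply/funext => q; rewrite /S subrK.
have sumS : \sum_i curv M c S i l p j i =
    \sum_b \sum_a jac M c c' p l b * jac M c c' p j a *
      \sum_e curv M c' (thomas_mx M nab c') e b p a e.
  rewrite -(contract_gauge (fun e b => curv M c' (thomas_mx M nab c') e b p) l j KJ).
  apply: eq_bigr => i _; congr (fun_of_matrix _ j i).
  have sW : W `<=` cdom c by move=> q [].
  have := curv_gauge aX hM i l ac oW Wp sW sS sQ sJ gauge.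
  rewrite (curv_pullback aX hM i l pc pc' sT') => <-.
  by rewrite -mulmxA (jac_inv aX hM pc pc') mulmx1.
(* Passing from [S] to the Thomas symbols costs twice [u l * u j], which turns the [+ u l * u j] of
   [ricci_tau] into the minus sign of the statement. *)
have SD : (S l p *m \col_k u k p) j 0 =
    (thomas_mx M nab c l p *m \col_k u k p) j 0 - (u l p * u j p + u l p * u j p).
  rewrite -(tau_mul_col (u^~ p)) /S mulmxBl.
  by rewrite entryD entryN.
have ric := ricci_tau aX hM l j ac oW Wp cp sS su symS
  (fun i k => proj_factor_closed i k pc pc').
rewrite -TE sumS SD in ric.
rewrite thomas_P_curv // ric mulrDr mulKf // big_distrr /=.
have -> : \sum_b (n%:R - 1)^-1 * (\sum_a jac M c c' p l b * jac M c c' p j a *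
      \sum_e curv M c' (thomas_mx M nab c') e b p a e) =
    \sum_b \sum_a jac M c c' p l b * jac M c c' p j a * thomas_P M nab c' p b a.
  apply: eq_bigr => b _; rewrite big_distrr; apply: eq_bigr => a _ /=.
  by rewrite (thomas_P_curv _ _ pc') mulrCA.
have arith (X A B C D : R) : X + (A - (B * C + B * C) + B * C - D) = X + A - B * C - D.
  by ring.
exact: arith.
Qed.

Lemma smooth_fun_thomas_P c l j : atl M c ->
  smooth_fun M (cdom c) (fun q => thomas_P M nab c q l j).
Proof.
move=> ac; have oW := open_in_cdom hM ac.
have sT k := smooth_mx_thomas aX hM cnab k ac.
have sdT a b : smooth_mx M (cdom c) (pdm M c a (thomas_mx M nab c b)).
  by apply: smooth_mx_sub (smooth_mx_pdm aX hM a ac oW (sT b)) => q.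
apply: (eq_smooth_fun hM (F := fun q => (n%:R - 1)^-1 *
   \sum_i curv M c (thomas_mx M nab c) i l q j i)).
  by move=> q cq; rewrite thomas_P_curv.
apply: (@smooth_funM R T n M _ (fun=> _)); first exact: smooth_fun_cst.
apply: (@smooth_fun_sum R T n M _ _ _ _
  (fun i q => curv M c (thomas_mx M nab c) i l q j i)) => i _.
have h1 := smooth_mxB hM (sdT i l) (sdT l i).
have h2 := smooth_mxD h1 (smooth_mxM (sT l) (sT i)).
exact: (smooth_mxB hM h2 (smooth_mxM (sT i) (sT l)) j i).
Qed.

End SchoutenTransformation.

(** * Lie algebras of the groups of the model *)

Section LieAlgebras.
Variable R : realType.

(** The determinant is a polynomial in [t] with value 1 at 0, hence nonzero nearby. *)
Lemma near_unitmx m (B : 'M[R]_m) : \forall t \near (0 : R), (1%:M + t *: B) \in unitmx.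
Proof.
pose p : {poly R} := \det (1%:M + 'X *: map_mx polyC B).
have pE t : p.[t] = \det (1%:M + t *: B).
  rewrite -[LHS]/(horner_eval t p) /p -det_map_mx map_mxD map_mx1; congr (\det (_ + _)).
  by apply/matrixP => i j; rewrite !mxE /= /horner_eval hornerM hornerX hornerC.
have p0 : p.[0] != 0 by rewrite pE scale0r addr0 det1 oner_eq0.
have cp : {for (0 : R), continuous (horner p)} by exact: continuous_horner.
have nz : \forall t \near (0 : R), p.[t] != 0.
  have nO : nbhs p.[0] [set x : R | x != 0].
    by apply: open_nbhs_nbhs; split=> //; exact: open_neq.
  exact: (cp _ nO).
by apply: filterS nz => t; rewrite unitmxE unitfE pE.
Qed.

Lemma near_unit (x : R) : \forall t \near (0 : R), 1 + t * x != 0.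
Proof.
have := near_unitmx (x%:M : 'M[R]_1); apply: filterS => t.
by rewrite unitmxE unitfE det_mx11 !mxE mulr1n.
Qed.

Variable N : nat.
Implicit Types (S : set 'M[R]_N) (X : 'M[R]_N).

(** Each group of the model is cut out of a linear space of matrices by open conditions, so a
    straight line through the identity can serve as the curve. Conversely, linear relations between
    entries pass from the group to velocities. *)
Lemma lie_alg_line S X : (\forall t \near (0 : R), S (1%:M + t *: X)) -> lie_alg S X.
Proof.
move=> SX; exists (fun t => 1%:M + t *: X); split=> //.
  by rewrite scale0r addr0.
move=> a b; have -> : (fun t => (1%:M + t *: X) a b) =
    (cst (1%:M a b : R) + X a b \*: (id : R -> R)).
  by apply/funext => t; rewrite !mxE /= fctE /GRing.scale /= mulrC.
have d1 : is_derive (0 : R) (1 : R) (cst (1%:M a b : R)) 0 by exact: is_derive_cst.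
have d2 : is_derive (0 : R) (1 : R) (X a b \*: (id : R -> R)) (X a b *: 1).
  by apply: is_deriveZ.
apply: (is_derive_eq (is_deriveD d1 d2)).
by rewrite add0r /GRing.scale /= mulr1.
Qed.

Lemma lie_alg_entry0 S X a b : (forall Y, S Y -> Y a b = 0) -> lie_alg S X -> X a b = 0.
Proof.
move=> S0 [c [_ Sc dc]]; have [_ <-] := dc a b.
rewrite (@near_eq_derive _ _ _ _ (cst 0)); first exact: derive_cst.
by apply: filterS Sc => t /S0.
Qed.

Lemma lie_alg_entry_eq S X a b a' b' : (forall Y, S Y -> Y a b = Y a' b') ->
  lie_alg S X -> X a b = X a' b'.
Proof.
move=> SE [c [_ Sc dc]]; have [_ <-] := dc a b; have [_ <-] := dc a' b'.
by apply: near_eq_derive; apply: filterS Sc => t /SE.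
Qed.

End LieAlgebras.

Section BlockLinearity.
Variables (V : zmodType) (m1 m2 n1 n2 : nat).
Implicit Types X Y : 'M[V]_(m1 + m2, n1 + n2).

Lemma ursubmxD X Y : ursubmx (X + Y) = ursubmx X + ursubmx Y.
Proof. by apply/matrixP => i j; rewrite !mxE. Qed.

Lemma drsubmxD X Y : drsubmx (X + Y) = drsubmx X + drsubmx Y.
Proof. by apply/matrixP => i j; rewrite !mxE. Qed.

Lemma ursubmxN X : ursubmx (- X) = - ursubmx X.
Proof. by apply/matrixP => i j; rewrite !mxE. Qed.

Lemma drsubmxN X : drsubmx (- X) = - drsubmx X.
Proof. by apply/matrixP => i j; rewrite !mxE. Qed.

End BlockLinearity.

Section ProjectiveLieAlgebras.
Variables (R : realType) (d : nat).
Implicit Types X Y : 'M[R]_(1 + (d + 1)).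

Lemma lie_grpGtP X : lie_alg (@grpGt R d) X <-> ursubmx X = 0.
Proof.
split=> [hX|X0].
  apply/matrixP => i j; rewrite [LHS]mxE [LHS]mxE [RHS]mxE.
  apply: lie_alg_entry0 hX => Y [a [b [be [B [_ _ ->]]]]].
  by rewrite block_mxEur mxE.
apply: lie_alg_line.
have := near_unitmx (drsubmx X); have := near_unit (X (lshift _ 0) (lshift _ 0)).
apply: filterS2 => t ha hB.
exists (1%:M + t *: ulsubmx X), (usubmx (t *: dlsubmx X)), (dsubmx (t *: dlsubmx X)),
  (1%:M + t *: drsubmx X); split=> //.
  by rewrite !mxE /= mulr1n.
rewrite vsubmxK -[in LHS](submxK X) X0 scale_block_mx scalar_mx_block add_block_mx.
by rewrite scaler0 !add0r.
Qed.

Lemma lie_grpHtP X : lie_alg (@grpHt R d) X <->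
  ursubmx X = 0 /\ ursubmx (drsubmx X) = 0.
Proof.
split=> [hX|[X0 X1]].
  split; apply/matrixP => i j.
    rewrite [LHS]mxE [LHS]mxE [RHS]mxE.
    apply: lie_alg_entry0 hX => Y [a [b [be [A [de [ga [_ _ _ ->]]]]]]].
    by rewrite block_mxEur mxE.
  rewrite [LHS]mxE [LHS]mxE [LHS]mxE [LHS]mxE [RHS]mxE.
  apply: lie_alg_entry0 hX => Y [a [b [be [A [de [ga [_ _ _ ->]]]]]]].
  by rewrite block_mxEdr block_mxEur mxE.
apply: lie_alg_line.
have := near_unitmx (ulsubmx (drsubmx X)).
have := near_unit (X (lshift _ 0) (lshift _ 0)).
have := near_unit ((drsubmx X) (rshift _ 0) (rshift _ 0)).
apply: filterS3 => t hg ha hA.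
exists (1%:M + t *: ulsubmx X), (usubmx (t *: dlsubmx X)), (dsubmx (t *: dlsubmx X)),
  (1%:M + t *: ulsubmx (drsubmx X)), (t *: dlsubmx (drsubmx X)),
  (1%:M + t *: drsubmx (drsubmx X)); split=> //.
- by rewrite !mxE /= mulr1n.
- by rewrite !mxE /= mulr1n; move: hg; rewrite !mxE.
rewrite vsubmxK -[in LHS](submxK X) X0 scale_block_mx scalar_mx_block add_block_mx.
rewrite -[in LHS](submxK (drsubmx X)) X1 scale_block_mx.
rewrite [in LHS](@scalar_mx_block _ d 1) add_block_mx.
by rewrite !scaler0 !add0r.
Qed.

Lemma lie_grpKP X : lie_alg (@grpK R d) X <->
  ursubmx X = 0 /\ exists la, drsubmx X = la%:M.
Proof.
split=> [hX|[X0 [la X1]]].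
  split; first apply/matrixP => i j.
    rewrite [LHS]mxE [LHS]mxE [RHS]mxE.
    apply: lie_alg_entry0 hX => Y [a [b [la [_ _ ->]]]].
    by rewrite block_mxEur mxE.
  (* The last diagonal entry is taken as the scalar; all diagonal entries of the block agree on the
     group, hence on velocities. *)
  exists (drsubmx X (rshift d 0) (rshift d 0)); apply/matrixP => i j.
  rewrite [LHS]mxE [LHS]mxE [RHS]mxE; have [->|ij] := eqVneq i j.
    rewrite mulr1n [RHS]mxE [RHS]mxE.
    apply: lie_alg_entry_eq hX => Y [a [b [la [_ _ ->]]]].
    by rewrite !block_mxEdr !mxE !eqxx.
  rewrite mulr0n.
  apply: lie_alg_entry0 hX => Y [a [b [la [_ _ ->]]]].
  by rewrite !block_mxEdr !mxE (negPf ij).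
apply: lie_alg_line.
have := near_unit la; have := near_unit (X (lshift _ 0) (lshift _ 0)).
apply: filterS2 => t ha hl.
exists (1%:M + t *: ulsubmx X), (t *: dlsubmx X), (1 + t * la); split=> //.
  by rewrite !mxE /= mulr1n.
rewrite -[in LHS](submxK X) X0 X1 scale_block_mx scalar_mx_block add_block_mx.
by rewrite scaler0 !add0r scale_scalar_mx -raddfD.
Qed.

(** Velocities of curves in a set need not be closed under addition a priori; for [grpK] the
    explicit description [lie_grpKP] shows that they are. *)
Lemma coset_of_lieK_eq X Y : lie_alg (@grpK R d) (X - Y) ->
  coset_of_lie (@grpK R d) X = coset_of_lie (@grpK R d) Y.
Proof.
move=> /lie_grpKP[u0 [la dE]].
have E Z : Z - Y = (Z - X) + (X - Y) by rewrite addrA subrK.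
apply/seteqP; split=> Z /lie_grpKP[v0 [lb ZE]]; apply/lie_grpKP.
  rewrite E ursubmxD drsubmxD u0 v0 addr0 dE ZE; split=> //; exists (lb + la).
  by rewrite raddfD.
have E' : Z - X = (Z - Y) + (- (X - Y)) by rewrite opprB addrA subrK.
rewrite E' ursubmxD drsubmxD [ursubmx (- _)]ursubmxN [drsubmx (- _)]drsubmxN.
rewrite u0 v0 dE ZE oppr0 addr0; split=> //; exists (lb - la).
by rewrite raddfB.
Qed.

End ProjectiveLieAlgebras.

(** * The boundary *)

Section Slices.
Variables (R : realType) (d : nat).

Lemma ord0_lshift : ord0 = lshift d (ord0 : 'I_1) :> 'I_(1 + d).
Proof. exact: val_inj. Qed.

Lemma big_split_ord1 (F : 'I_(1 + d) -> R) :
  \sum_i F i = F ord0 + \sum_(m < d) F (rshift 1 m).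
Proof. by rewrite big_split_ord /= big_ord1 -ord0_lshift. Qed.

(** Tangential increments from a boundary point never leave the half-space, so the restriction on
    increments is void on both sides. *)
Lemma pder_slice (g : 'rV[R]_(1 + d) -> R) (m : 'I_d) (y : 'rV[R]_d) :
  pder setT m (fun z => g (row_mx 0 z)) y =
  pder (@half_space R d) (rshift 1 m) g (row_mx 0 y).
Proof.
have E (h : R) : row_mx 0 (y + h *: ebas R m) =
    row_mx (0 : 'rV_1) y + h *: ebas R (rshift 1 m).
  apply/rowP => j; case: (split_ordP j) => l ->.
    rewrite row_mxEl !mxE (unsplitK (inl l)) mxE add0r (ord1 l).
    by rewrite eq_lrshift andbF mulr0.
  by rewrite row_mxEr !mxE (unsplitK (inr l)) eq_rshift.
rewrite /pder.
have -> : [set h : R | setT (y + h *: ebas R m)] = setT by apply/seteqP; split.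
have -> : [set h : R |
    half_space (row_mx (0 : 'rV_1) y + h *: ebas R (rshift 1 m))] = setT.
  apply/seteqP; split=> // h _; rewrite /half_space /= -E ord0_lshift row_mxEl mxE.
  exact: lexx.
rewrite (_ : (fun h : R => h^-1 * (g (row_mx 0 (y + h *: ebas R m)) - _)) =
  fun h => h^-1 * (g (row_mx 0 y + h *: ebas R (rshift 1 m)) - g (row_mx 0 y))) //.
by apply/funext => h; rewrite E.
Qed.

Lemma smooth_on_row_mx0 (S : set 'rV[R]_d) (j : 'I_(1 + d)) :
  smooth_on S (fun z : 'rV[R]_d => row_mx (0 : 'rV[R]_1) z 0 j).
Proof.
case: (split_ordP j) => l ->.
  apply: (@eq_smooth_on _ _ _ (fun=> 0)); last exact: smooth_on_cst.
  by move=> z _; rewrite row_mxEl mxE.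
apply: (@eq_smooth_on _ _ _ (fun z => z 0 l)); last exact: smooth_on_coord.
by move=> z _; rewrite row_mxEr.
Qed.

Lemma continuous_row_mx0 (z : 'rV[R]_d) :
  {for z, continuous (fun z : 'rV[R]_d => row_mx (0 : 'rV[R]_1) z)}.
Proof.
apply: differentiable_continuous; apply: differentiable_coords => j.
case: (split_ordP j) => l ->.
  by under eq_fun do rewrite row_mxEl mxE; exact: differentiable_cst.
by under eq_fun do rewrite row_mxEr; exact: differentiable_coord.
Qed.

End Slices.

Section BoundaryRestriction.
Variables (R : realType) (d : nat) (T : topologicalType).
Variable A : set (chart R T (1 + d)).
Hypothesis hM : is_manifold (bmfd A).
Implicit Types (c : chart R T (1 + d)) (p q : T) (W : set T) (F : T -> R).

Local Notation M := (bmfd A).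
Local Notation M' := (boundary_mfd A).
Let aX : approachable (msp M) := @approachable_half_space R d.

Lemma atl_boundary_chart c : boundary_chart A c -> atl M c.
Proof. by case. Qed.

Lemma boundary_cmap0 c p : boundary_chart A c -> cdom c p -> boundary A p ->
  cmap c p 0 ord0 = 0.
Proof.
move=> [_ E _] cp bp; have : (boundary A `&` cdom c) p by [].
by rewrite E => -[].
Qed.

Lemma boundary_of_cmap0 c p : boundary_chart A c -> cdom c p ->
  cmap c p 0 ord0 = 0 -> boundary A p.
Proof.
move=> [_ E _] cp cp0.
by have : [set p | cdom c p /\ cmap c p 0 ord0 = 0] p by []; rewrite -E => -[].
Qed.

Lemma boundary_cmapE c p : boundary_chart A c -> cdom c p -> boundary A p ->
  row_mx 0 (rsubmx (cmap c p)) = cmap c p.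
Proof.
move=> bc cp bp; rewrite -[RHS]hsubmxK; congr row_mx.
by apply/rowP => j; rewrite !mxE ord1 -(boundary_cmap0 bc cp bp) ord0_lshift.
Qed.

(** The tangential derivative only sees the slice [r = 0], on which [F] vanishes near [p]. *)
Lemma pd_tangential0 c W p F m : boundary_chart A c -> open_in M W -> W p ->
  cdom c p -> boundary A p -> (forall q, W q -> cdom c q -> boundary A q -> F q = 0) ->
  pd M c (rshift 1 m) F p = 0.
Proof.
move=> bc oW Wp cp bp F0; have ac := atl_boundary_chart bc.
have oS := relopen_image hM ac oW.
have im : (cmap c @` (cdom c `&` W)) (cmap c p) by exists p.
have [Xp nS] := oS _ im.
transitivity (pder (@half_space R d) (rshift 1 m) (fun=> 0) (cmap c p)); last first.
  exact: (pder_cst _ _ aX oS im).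
rewrite -(boundary_cmapE bc cp bp) -pder_slice.
rewrite -[cmap c p](boundary_cmapE bc cp bp) in im nS.
(* The trace on the slice of a relatively open part of the half-space is open, by continuity of
   [z |-> (0, z)]. *)
have oS0 : relopen setT [set z | (cmap c @` (cdom c `&` W)) (row_mx 0 z)].
  move=> z Sz; split=> //; have [_ nz] := oS _ Sz.
  have := @continuous_row_mx0 R d z _ nz; rewrite nbhs_simpl /=.
  apply: filterS => w hw _; apply: hw.
  by rewrite /half_space /= ord0_lshift row_mxEl mxE.
transitivity (pder setT m (fun z => F (cinv c (row_mx 0 z))) (rsubmx (cmap c p))).
  by rewrite (pder_slice (fun x => F (cinv c x))) (boundary_cmapE bc cp bp).
apply: (eq_pder m oS0 im) => z [q [cq Wq] qz].
rewrite -qz (cinvK hM) //; apply: F0 => //.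
apply: (boundary_of_cmap0 bc cq); rewrite qz ord0_lshift row_mxEl mxE //.
Qed.

(** The first coordinate of [c'] vanishes on the boundary, hence so do its derivatives along it. *)
Lemma jac_normal0 c c' p m : boundary_chart A c -> boundary_chart A c' ->
  cdom c p -> cdom c' p -> boundary A p -> jac M c c' p (rshift 1 m) ord0 = 0.
Proof.
move=> bc bc' cp cp' bp; have ac' := atl_boundary_chart bc'.
rewrite jacE; apply: (pd_tangential0 _ bc (open_in_cdom hM ac') cp') => // q cq' _.
exact: boundary_cmap0.
Qed.

Lemma jac_restr c c' p i j : boundary_chart A c -> cdom c p -> boundary A p ->
  jac M' (restr_chart A c) (restr_chart A c') p i j =
  jac M c c' p (rshift 1 i) (rshift 1 j).
Proof.
move=> bc cp bp; rewrite [LHS]mxE [RHS]mxE -[in RHS](boundary_cmapE bc cp bp).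
rewrite -(pder_slice (fun x => cmap c' (cinv c x) 0 (rshift 1 j))).
by congr (pder _ _ _ _); apply/funext => y; rewrite mxE.
Qed.

(** By [jac_normal0] the ambient Jacobians are block triangular, so the tangential block of their
    product is the product of the tangential blocks. *)
Lemma jac_restr_cocycle c c' c'' p : boundary_chart A c -> boundary_chart A c' ->
  boundary_chart A c'' -> cdom c p -> cdom c' p -> cdom c'' p -> boundary A p ->
  jac M' (restr_chart A c) (restr_chart A c'') p =
  jac M' (restr_chart A c) (restr_chart A c') p *m
  jac M' (restr_chart A c') (restr_chart A c'') p.
Proof.
move=> bc bc' bc'' cp cp' cp'' bp; apply/matrixP => i j.
have [ac ac' ac''] := And3 (atl_boundary_chart bc) (atl_boundary_chart bc')
                           (atl_boundary_chart bc'').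
rewrite jac_restr // (jac_cocycle aX hM (conj ac cp) (conj ac' cp') (conj ac'' cp'')).
rewrite mxE big_split_ord1 jac_normal0 // mul0r add0r [RHS]mxE.
by apply: eq_bigr => l _; rewrite !jac_restr.
Qed.

Lemma jac_restr_inv c c' p : boundary_chart A c -> boundary_chart A c' ->
  cdom c p -> cdom c' p -> boundary A p ->
  jac M' (restr_chart A c) (restr_chart A c') p *m
  jac M' (restr_chart A c') (restr_chart A c) p = 1%:M.
Proof.
move=> bc bc' cp cp' bp; rewrite -jac_restr_cocycle //.
apply/matrixP => i j; rewrite jac_restr //.
rewrite (jac_id aX hM (conj (atl_boundary_chart bc) cp)) !mxE.
by rewrite eq_rshift.
Qed.

Lemma boundary_chart_at c p : boundary_chart A c -> cdom c p -> boundary A p ->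
  chart_at M' p (restr_chart A c).
Proof. by move=> bc cp bp; split=> //; exists c. Qed.

Lemma chart_at_boundaryP p (c0 : chart R T d) : chart_at M' p c0 ->
  exists c, [/\ boundary_chart A c, cdom c p, boundary A p & c0 = restr_chart A c].
Proof. by move=> [[c bc <-] [cp bp]]; exists c. Qed.

Lemma exists_tangent_boundary c p (w : 'rV[R]_d) : boundary_chart A c -> cdom c p ->
  boundary A p -> exists2 v, tangent M' p v & v (restr_chart A c) = w.
Proof.
move=> bc cp bp; have pc := boundary_chart_at bc cp bp.
exists (fun c0 : chart R T d => if `[< chart_at M' p c0 >] then
                    w *m jac M' (restr_chart A c) c0 p else 0).
  split=> [c1 c2 pc1 pc2|c1 npc1]; last by rewrite asboolF.
  rewrite !asboolT //.
  have [c1' [bc1 cp1 _ ->]] := chart_at_boundaryP pc1.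
  have [c2' [bc2 cp2 _ ->]] := chart_at_boundaryP pc2.
  by rewrite -mulmxA -jac_restr_cocycle.
rewrite asboolT //.
suff -> : jac M' (restr_chart A c) (restr_chart A c) p = 1%:M by rewrite mulmx1.
apply/matrixP => i j; rewrite jac_restr //.
rewrite (jac_id aX hM (conj (atl_boundary_chart bc) cp)) !mxE.
by rewrite eq_rshift.
Qed.

End BoundaryRestriction.

(** * Tangential parts of the transformation laws *)

Section TangentialBlock.
Variables (R : realType) (d : nat).
Implicit Types (J K Q X Y : 'M[R]_(1 + d)) (u : 'I_(1 + d) -> R) (j k i : 'I_d).
Local Notation r := (rshift 1).

(** Block triangularity is stable under products, and both Kronecker symbols in this entry of [tau]
    compare a tangential index with the normal one. *)
Lemma normal_entry_gauge J K Q Y u j k :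
  (forall m, J (r m) ord0 = 0) -> (forall m, K (r m) ord0 = 0) ->
  (forall m, Q (r m) ord0 = 0) -> Y (r j) ord0 = 0 ->
  ((J *m Q + Y) *m K + tau u (r k)) (r j) ord0 = 0.
Proof.
move=> J0 K0 Q0 Y0; rewrite mxE tauE ord0_lshift eq_rlshift eq_lrshift !mulr0 !addr0.
rewrite -ord0_lshift mxE big_split_ord1 big1 ?addr0 => [|m _]; last by rewrite K0 mulr0.
rewrite mxE Y0 addr0 mxE big_split_ord1 J0 mul0r add0r big1 ?mul0r // => m _.
by rewrite Q0 mulr0.
Qed.

Lemma tangential_entry_gauge J Q X Y u j k i :
  (forall m, J (r m) ord0 = 0) -> X (r j) ord0 = 0 ->
  X *m J = J *m Q + Y + tau u (r k) *m J ->
  \sum_a X (r j) (r a) * J (r a) (r i) =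
  \sum_a J (r j) (r a) * Q (r a) (r i) + Y (r j) (r i)
  + (u (r k) * J (r j) (r i) + u (r j) * J (r k) (r i)).
Proof.
move=> J0 X0 E.
transitivity ((X *m J) (r j) (r i)); first by rewrite mxE big_split_ord1 X0 mul0r add0r.
rewrite E [LHS]mxE [(_ + Y) _ _]mxE; congr (_ + _ + _).
  by rewrite mxE big_split_ord1 J0 mul0r add0r.
rewrite /tau mulmxDl mul_scalar_mx -mulmxA -rowE !mxE big_ord1 !mxE //.
Qed.

Lemma normal_entry_sum J (P : 'I_(1 + d) -> 'M[R]_(1 + d)) k (j i : 'I_(1 + d)) :
  (forall m, J (r m) ord0 = 0) ->
  (\sum_b J (r k) b *: P b) j i = \sum_b J (r k) (r b) * P (r b) j i.
Proof.
move=> J0; rewrite summxE big_split_ord1 mxE J0 mul0r add0r.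
by apply: eq_bigr => b _; rewrite mxE.
Qed.

End TangentialBlock.

Section BoundaryLaws.
Variables (R : realType) (d : nat) (T : topologicalType).
Variable A : set (chart R T (1 + d)).
Hypothesis hM : is_manifold (bmfd A).
Implicit Types (c : chart R T (1 + d)) (p q : T) (W : set T) (F : T -> R).

Local Notation M := (bmfd A).
Local Notation M' := (boundary_mfd A).
Local Notation r := (rshift 1).
Let aX : approachable (msp M) := @approachable_half_space R d.

Lemma smooth_fun_restr W F : smooth_fun M W F -> smooth_fun M' (W `&` boundary A) F.
Proof.
move=> hF c0 [c bc <-] /=; have ac := atl_boundary_chart bc.
apply: (@smooth_on_comp _ _ _ _ (cmap c @` (cdom c `&` W))
  (fun y => row_mx (0 : 'rV_1) y) _ _ (fun x => F (cinv c x))).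
- exact: smooth_on_row_mx0.
- move=> y [q [[cq bq] [Wq _]] <-] /=; exists q => //.
  by rewrite (boundary_cmapE bc cq bq).
- exact: hF.
Qed.

Lemma dfun_restr c p F (v : tvec R T d) : boundary_chart A c -> cdom c p ->
  boundary A p ->
  dfun M' (restr_chart A c) F p v =
  \sum_m v (restr_chart A c) 0 m * pd M c (r m) F p.
Proof.
move=> bc cp bp; apply: eq_bigr => m _; congr (_ * _).
rewrite [LHS](pder_slice (fun x => F (cinv c x))) (boundary_cmapE bc cp bp).
by [].
Qed.

Lemma tangent_restr c c' p v : boundary_chart A c -> boundary_chart A c' ->
  cdom c p -> cdom c' p -> boundary A p -> tangent M' p v ->
  v (restr_chart A c') = v (restr_chart A c) *m
    jac M' (restr_chart A c) (restr_chart A c') p.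
Proof.
by move=> bc bc' cp cp' bp [+ _]; apply; exact: boundary_chart_at.
Qed.

Lemma pd_chain_tangential c c' W p F m : boundary_chart A c -> boundary_chart A c' ->
  cdom c p -> cdom c' p -> boundary A p -> open_in M W -> W p -> smooth_fun M W F ->
  pd M c (r m) F p = \sum_l jac M c c' p (r m) (r l) * pd M c' (r l) F p.
Proof.
move=> bc bc' cp cp' bp oW Wp hF.
have [ac ac'] := (atl_boundary_chart bc, atl_boundary_chart bc').
rewrite (pd_chain aX hM ac oW Wp cp _ ac' cp' hF).
by rewrite big_split_ord1 (jac_normal0 hM) // mul0r add0r.
Qed.

(** [cartan_transition] differentiates in an arbitrary chart [c0] of the boundary; the tangential
    chain rule brings this back to [c], where the gauge laws are known. *)
Lemma dfun_restr_chart c (c0 : chart R T d) W p F v : boundary_chart A c -> cdom c p ->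
  boundary A p -> chart_at M' p c0 -> open_in M W -> W p -> smooth_fun M W F ->
  tangent M' p v ->
  dfun M' c0 F p v = \sum_m v (restr_chart A c) 0 m * pd M c (r m) F p.
Proof.
move=> bc cp bp pc0 oW Wp hF hv; have [c' [bc' cp' _ ->]] := chart_at_boundaryP pc0.
rewrite dfun_restr //.
rewrite (tangent_restr bc bc' cp cp' bp hv).
under eq_bigr => m _ do rewrite mxE big_distrl /=.
rewrite exchange_big /=; apply: eq_bigr => l _.
rewrite (pd_chain_tangential l bc bc' cp cp' bp oW Wp hF) big_distrr /=.
by apply: eq_bigr => m _; rewrite jac_restr // mulrA.
Qed.

Variable nab : connection R T (1 + d).
Hypothesis cnab : is_connection M nab.
Hypothesis tnab : torsion_free M nab.

(** For tangential lower indices the trace terms vanish, so these are the Christoffel symbols with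
    upper normal index: the second fundamental form of the boundary, whose vanishing means that the
    boundary is totally geodesic. *)
Definition geodesic_boundary c p : Prop :=
  forall j k : 'I_d, thomas M nab c p ord0 (r j) (r k) = 0.

Lemma thomas_mx_gauge c c' k p : chart_at M p c -> chart_at M p c' ->
  thomas_mx M nab c k p *m jac M c c' p =
  jac M c c' p *m (\sum_b jac M c c' p k b *: thomas_mx M nab c' b p)
  + pdm M c k (jac M c c') p
  + tau (fun l => proj_factor M c c' l p) k *m jac M c c' p.
Proof.
move=> pc pc'; rewrite (thomas_mx_transform aX hM cnab k pc pc') mulmxDl.
by rewrite -mulmxA (jac_inv aX hM pc' pc) mulmx1.
Qed.

Lemma pd_jac_normal0 c c' p k j : boundary_chart A c -> boundary_chart A c' ->
  cdom c p -> cdom c' p -> boundary A p ->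
  pd M c (r k) (fun q => jac M c c' q (r j) ord0) p = 0.
Proof.
move=> bc bc' cp cp' bp.
apply: (pd_tangential0 hM k bc (open_in_cdom hM (atl_boundary_chart bc')) cp') => //.
by move=> q cq' cq bq; exact: jac_normal0.
Qed.

Lemma geodesic_boundary_transfer c c' p : boundary_chart A c -> boundary_chart A c' ->
  cdom c p -> cdom c' p -> boundary A p -> geodesic_boundary c' p ->
  geodesic_boundary c p.
Proof.
move=> bc bc' cp cp' bp g j k.
have pc : chart_at M p c by split=> //; exact: atl_boundary_chart.
have pc' : chart_at M p c' by split=> //; exact: atl_boundary_chart.
have -> : thomas M nab c p ord0 (r j) (r k) = thomas_mx M nab c (r k) p (r j) ord0.
  by rewrite mxE.
rewrite (thomas_mx_transform aX hM cnab (r k) pc pc').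
apply: normal_entry_gauge => [m|m|m|].
- exact: jac_normal0.
- exact: jac_normal0.
- rewrite normal_entry_sum => [|l]; last exact: jac_normal0.
  by rewrite big1 // => b _; rewrite [thomas_mx _ _ _ _ _ _ _]mxE g mulr0.
- by rewrite pdmE pd_jac_normal0.
Qed.

Section Overlap.
Variables (c c' : chart R T (1 + d)) (p : T).
Hypotheses (bc : boundary_chart A c) (bc' : boundary_chart A c').
Hypotheses (cp : cdom c p) (cp' : cdom c' p) (bp : boundary A p).
Hypothesis g : geodesic_boundary c p.

Let pc : chart_at M p c. Proof. by split=> //; exact: atl_boundary_chart. Qed.
Let pc' : chart_at M p c'. Proof. by split=> //; exact: atl_boundary_chart. Qed.

Lemma thomas_tangential k j i :
  \sum_a thomas M nab c p (r a) (r j) (r k) * jac M c c' p (r a) (r i) =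
  \sum_a jac M c c' p (r j) (r a) *
    \sum_b jac M c c' p (r k) (r b) * thomas M nab c' p (r i) (r a) (r b)
  + pd M c (r k) (fun q => jac M c c' q (r j) (r i)) p
  + (proj_factor M c c' (r k) p * jac M c c' p (r j) (r i)
     + proj_factor M c c' (r j) p * jac M c c' p (r k) (r i)).
Proof.
have J0 m : jac M c c' p (r m) ord0 = 0 by exact: jac_normal0.
have X0 : thomas_mx M nab c (r k) p (r j) ord0 = 0 by rewrite mxE.
have := tangential_entry_gauge i J0 X0 (thomas_mx_gauge (r k) pc pc').
rewrite pdmE; under eq_bigr => a _ do rewrite [thomas_mx _ _ _ _ _ _ _]mxE.
move=> ->; congr (_ + _ + _); apply: eq_bigr => a _; congr (_ * _).
rewrite normal_entry_sum //; apply: eq_bigr => b _.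
by rewrite [thomas_mx _ _ _ _ _ _ _]mxE.
Qed.

(** Among the contractions with [proj_factor], the one with its normal component is removed by [g];
    block triangularity removes the other normal indices. The bound on [d] makes [n - 1]
    invertible. *)
Lemma thomas_P_tangential l j : (1 <= d)%N ->
  thomas_P M nab c p (r l) (r j) =
  \sum_b \sum_a jac M c c' p (r l) (r b) * jac M c c' p (r j) (r a) *
     thomas_P M nab c' p (r b) (r a)
  + \sum_a thomas M nab c p (r a) (r j) (r l) * proj_factor M c c' (r a) p
  - proj_factor M c c' (r l) p * proj_factor M c c' (r j) p
  - pd M c (r l) (proj_factor M c c' (r j)) p.
Proof.
move=> hd; have n1 : (1 + d)%:R - 1 != 0 :> R.
  by rewrite natrD addrAC subrr add0r pnatr_eq0 -lt0n.
rewrite (thomas_P_transform aX hM cnab tnab (r l) (r j) n1 pc pc').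
congr (_ + _ - _ - _).
  rewrite big_split_ord1 big1 ?add0r => [|a _]; last first.
    by rewrite (jac_normal0 hM) // !mul0r.
  apply: eq_bigr => b _; rewrite big_split_ord1 (jac_normal0 hM j bc bc' cp cp' bp).
  by rewrite mulr0 mul0r add0r.
rewrite mxE big_split_ord1 [thomas_mx _ _ _ _ _ _ _]mxE g mul0r add0r.
by apply: eq_bigr => a _; rewrite [thomas_mx _ _ _ _ _ _ _]mxE [(\col_k _) _ _]mxE.
Qed.

End Overlap.

(** A multiple of [dr] vanishes on the tangential coordinate fields, whose values under the form are
    the individual symbols. *)
Lemma geodesic_boundary_form c p : boundary_chart A c -> cdom c p -> 
  (forall mu : 'I_d, exists a : R, forall v, tangent M p v ->
     thomas_form M nab c p ord0 (r mu) v = a * v c 0 ord0) ->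
  geodesic_boundary c p.
Proof.
move=> bc cp h j k; have [a ha] := h j.
have pc : chart_at M p c by split=> //; exact: atl_boundary_chart.
have := ha _ (tangent_coord_field aX hM (r k) pc).
rewrite (coord_field_self aX hM) // ord0_lshift eq_rlshift mulr0 => <-.
rewrite /thomas_form (bigD1 (r k)) //= (coord_field_self aX hM) // eqxx mulr1.
rewrite big1 ?addr0 // => l; rewrite eq_sym (coord_field_self aX hM) //.
by move=> /negPf ->; rewrite mulr0.
Qed.

End BoundaryLaws.

(** * The gauge law, block by block *)

Section GaugeBlocks.
Variables (R : realType) (d : nat).
Implicit Types (J th dJ : 'I_d -> 'I_d -> R) (dl jk P ddl : 'I_d -> R) (s : R).

(** In the gauges the row is the upper index, the opposite of [thomas_mx]; this is why [J] enters
    transposed. *)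
Lemma gauge_block_ul J th (th' : 'I_d -> 'I_d -> R) dJ dl jk s :
  (forall j i, \sum_a th a j * J a i =
     \sum_a J j a * th' i a + dJ j i + (s * J j i + dl j * jk i)) ->
  \matrix_(i, j) J j i *m (\matrix_(i, j) th i j - s%:M) =
  \matrix_(i, j) dJ j i + (\matrix_(i, j) th' i j *m \matrix_(i, j) J j i
                           + \col_i jk i *m \row_j dl j).
Proof.
move=> E; apply/matrixP => i j.
rewrite mulmxBr mul_mx_scalar !entryD entryN entryZ ![(_ *m _) i j]mxE big_ord1 !mxE.
have -> : \sum_a (\matrix_(i, j) J j i) i a * (\matrix_(i, j) th i j) a j =
    \sum_a th a j * J a i by apply: eq_bigr => a _; rewrite !mxE mulrC.
have -> : \sum_a (\matrix_(i, j) th' i j) i a * (\matrix_(i, j) J j i) a j =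
    \sum_a J j a * th' i a by apply: eq_bigr => a _; rewrite !mxE mulrC.
rewrite E; ring.
Qed.

Lemma gauge_block_ur J k :
  \matrix_(i, j) J j i *m (delta_mx k 0 : 'cV_d) = \col_i J k i.
Proof.
apply/colP => i; rewrite !mxE (bigD1 k) //= !mxE !eqxx mulr1 big1 ?addr0 //.
by move=> b /negPf bk; rewrite !mxE bk mulr0.
Qed.

Lemma gauge_block_dl J th dl ddl P (P' : 'I_d -> R) s :
  (forall j, P j = \sum_a J j a * P' a + \sum_a th a j * dl a - s * dl j - ddl j) ->
  \row_j dl j *m (\matrix_(i, j) th i j - s%:M) + \row_j - P j =
  \row_j ddl j + \row_j - P' j *m \matrix_(i, j) J j i.
Proof.
move=> E; apply/rowP => j.
rewrite mulmxBr mul_mx_scalar !entryD entryN entryZ ![(_ *m _) 0 j]mxE !mxE E.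
have -> : \sum_a (\row_j dl j) 0 a * (\matrix_(i, j) th i j) a j =
    \sum_a th a j * dl a by apply: eq_bigr => a _; rewrite !mxE mulrC.
have -> : \sum_a (\row_j - P' j) 0 a * (\matrix_(i, j) J j i) a j =
    - \sum_a J j a * P' a.
  by rewrite -sumrN; apply: eq_bigr => a _; rewrite !mxE mulNr mulrC.
ring.
Qed.

(** The corner determines the scalar to be subtracted from the gauge: it has to be [dl k]. *)
Lemma gauge_block_dr dl k :
  \row_j dl j *m (delta_mx k 0 : 'cV_d) - (dl k)%:M = 0 :> 'M[R]_1.
Proof.
apply/matrixP => i j; rewrite !ord1 !mxE (bigD1 k) //= !mxE !eqxx mulr1 big1 ?addr0.
  by rewrite mulr1n subrr.
by move=> b /negPf bk; rewrite !mxE bk mulr0.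
Qed.

End GaugeBlocks.

Section TangentialGauge.
Variables (R : realType) (d : nat) (T : topologicalType).
Variable A : set (chart R T (1 + d)).
Hypothesis hM : is_manifold (bmfd A).
Variable nab : connection R T (1 + d).
Hypothesis cnab : is_connection (bmfd A) nab.
Hypothesis tnab : torsion_free (bmfd A) nab.
Implicit Types (c : chart R T (1 + d)) (p q : T).

Local Notation M := (bmfd A).
Local Notation M' := (boundary_mfd A).
Local Notation r := (rshift 1).
Let aX : approachable (msp M) := @approachable_half_space R d.

(* The block of [normal_gauge] that survives modulo the Lie algebra of [grpK],
   evaluated on the k-th coordinate field of the boundary. *)
Definition tangential_gauge c (k : 'I_d) p : 'M[R]_(d + 1) :=
  block_mx (\matrix_(i, j) thomas M nab c p (r i) (r j) (r k)) (delta_mx k 0)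
           (\row_j - thomas_P M nab c p (r k) (r j)) 0.

(* The lower right block of [h_ij], [c'] being the chart [x^i] and [c] the chart
   [xbar^i]. *)
Definition tangential_transition c c' p : 'M[R]_(d + 1) :=
  block_mx (\matrix_(i, j) jac M c c' p (r j) (r i)) 0
           (\row_j proj_factor M c c' (r j) p) 1%:M.

Lemma pdm_block_mx m1 m2 n1 n2 c k (F : T -> 'M[R]_(m1, n1)) (G : T -> 'M[R]_(m1, n2))
  (H : T -> 'M[R]_(m2, n1)) (K : T -> 'M[R]_(m2, n2)) p :
  pdm M c k (fun q => block_mx (F q) (G q) (H q) (K q)) p =
  block_mx (pdm M c k F p) (pdm M c k G p) (pdm M c k H p) (pdm M c k K p).
Proof.
apply/matrixP => i j; rewrite pdmE.
case: (split_ordP i) => i' ->; case: (split_ordP j) => j' ->.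
- by under eq_fun do rewrite block_mxEul; rewrite block_mxEul pdmE.
- by under eq_fun do rewrite block_mxEur; rewrite block_mxEur pdmE.
- by under eq_fun do rewrite block_mxEdl; rewrite block_mxEdl pdmE.
- by under eq_fun do rewrite block_mxEdr; rewrite block_mxEdr pdmE.
Qed.

Lemma pdm_cst m1 m2 c k (X : 'M[R]_(m1, m2)) p : chart_at M p c ->
  pdm M c k (fun=> X) p = 0.
Proof.
move=> [ac cp]; apply/matrixP => i j.
by rewrite pdmE (pd_cst aX hM ac (open_in_cdom hM ac) cp cp) mxE.
Qed.

Lemma pdm_matrix m1 m2 c k (F : T -> 'I_m1 -> 'I_m2 -> R) p :
  pdm M c k (fun q => \matrix_(i, j) F q i j) p =
  \matrix_(i, j) pd M c k (fun q => F q i j) p.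
Proof.
apply/matrixP => i j; rewrite pdmE [RHS]mxE; congr (pd _ _ _ _ _).
by apply/funext => q; rewrite mxE.
Qed.

Section Overlap.
Variables (c c' : chart R T (1 + d)) (p : T).
Hypotheses (bc : boundary_chart A c) (bc' : boundary_chart A c').
Hypotheses (cp : cdom c p) (cp' : cdom c' p) (bp : boundary A p).
Hypothesis g : geodesic_boundary A nab c p.
Hypothesis hd : (1 <= d)%N.

Lemma tangential_gauge_transform k :
  tangential_transition c c' p *m
    (tangential_gauge c k p - (proj_factor M c c' (r k) p)%:M) =
  pdm M c (r k) (tangential_transition c c') p +
  (\sum_b jac M c c' p (r k) (r b) *: tangential_gauge c' b p) *m
    tangential_transition c c' p.
Proof.
have pc : chart_at M p c by split=> //; exact: atl_boundary_chart.
(* This is the gauge of [c'] on the [k]-th coordinate field of [c]; its last column holds the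
   components of that field in [c']. *)
have sumE : \sum_b jac M c c' p (r k) (r b) *: tangential_gauge c' b p =
    block_mx (\matrix_(i, j) \sum_b jac M c c' p (r k) (r b) *
                thomas M nab c' p (r i) (r j) (r b))
             (\col_i jac M c c' p (r k) (r i))
             (\row_j - \sum_b jac M c c' p (r k) (r b) *
                thomas_P M nab c' p (r b) (r j)) 0.
  apply/matrixP => i j; rewrite summxE.
  under eq_bigr => b _ do rewrite mxE.
  case: (split_ordP i) => i' ->; case: (split_ordP j) => j' ->.
  - rewrite block_mxEul mxE; apply: eq_bigr => b _.
    by rewrite block_mxEul; congr (_ * _); rewrite mxE.
  - rewrite block_mxEur [RHS]mxE (bigD1 i') //= block_mxEur [delta_mx _ _ _ _]mxE.
    rewrite (ord1 j') !eqxx mulr1 big1 ?addr0 // => b.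
    by rewrite block_mxEur [delta_mx _ _ _ _]mxE eq_sym => /negPf ->; rewrite mulr0.
  - rewrite block_mxEdl mxE -sumrN; apply: eq_bigr => b _.
    by rewrite block_mxEdl -mulrN; congr (_ * _); rewrite mxE.
  - rewrite block_mxEdr mxE big1 // => b _.
    by rewrite block_mxEdr [X in _ * X]mxE mulr0.
rewrite {}sumE pdm_block_mx !pdm_cst // /tangential_transition /tangential_gauge.
rewrite (@scalar_mx_block _ d 1) opp_block_mx add_block_mx !mulmx_block add_block_mx.
rewrite !(mul0mx, mulmx0, mul1mx, mulmx1, addr0, add0r, oppr0).
congr block_mx.
- rewrite pdm_matrix; apply: gauge_block_ul => j i.
  exact: (thomas_tangential hM cnab bc bc' cp cp' bp g k j i).
- exact: (gauge_block_ur (fun j i => jac M c c' p (r j) (r i))).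
- rewrite pdm_matrix; apply: gauge_block_dl => j.
  rewrite (thomas_P_tangential hM cnab tnab bc bc' cp cp' bp g k j hd).
  congr (_ + _ - _ - _); rewrite exchange_big; apply: eq_bigr => a _ /=.
  by rewrite big_distrr; apply: eq_bigr => b _ /=; rewrite [RHS]mulrCA mulrA.
- exact: (gauge_block_dr (fun j => proj_factor M c c' (r j) p)).
Qed.

End Overlap.
End TangentialGauge.

Section SmoothBlocks.
Variables (R : realType) (T : topologicalType) (n : nat) (M : mfd R T n).
Hypothesis hM : is_manifold M.
Implicit Types (W : set T).

Lemma smooth_mx_cst m1 m2 W (X : 'M[R]_(m1, m2)) : smooth_mx M W (fun=> X).
Proof. by move=> i j; exact: smooth_fun_cst. Qed.

Lemma smooth_mx_matrix m1 m2 W (F : T -> 'I_m1 -> 'I_m2 -> R) :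
  (forall i j, smooth_fun M W (fun q => F q i j)) ->
  smooth_mx M W (fun q => \matrix_(i, j) F q i j).
Proof.
move=> hF i j; apply: (eq_smooth_fun hM (F := fun q => F q i j)) => // q _.
by rewrite mxE.
Qed.

Lemma smooth_mx_block m1 m2 n1 n2 W (F : T -> 'M[R]_(m1, n1)) (G : T -> 'M[R]_(m1, n2))
  (H : T -> 'M[R]_(m2, n1)) (K : T -> 'M[R]_(m2, n2)) :
  smooth_mx M W F -> smooth_mx M W G -> smooth_mx M W H -> smooth_mx M W K ->
  smooth_mx M W (fun q => block_mx (F q) (G q) (H q) (K q)).
Proof.
move=> hF hG hH hK i j.
case: (split_ordP i) => i' ->; case: (split_ordP j) => j' ->.
- by apply: (eq_smooth_fun hM (F := fun q => F q i' j')) => // q _; rewrite block_mxEul.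
- by apply: (eq_smooth_fun hM (F := fun q => G q i' j')) => // q _; rewrite block_mxEur.
- by apply: (eq_smooth_fun hM (F := fun q => H q i' j')) => // q _; rewrite block_mxEdl.
- by apply: (eq_smooth_fun hM (F := fun q => K q i' j')) => // q _; rewrite block_mxEdr.
Qed.

End SmoothBlocks.

Section BoundaryAtlas.
Variables (R : realType) (d : nat) (T : topologicalType).
Variable A : set (chart R T (1 + d)).
Hypothesis hM : is_manifold (bmfd A).
Variable nab : connection R T (1 + d).
Hypothesis cnab : is_connection (bmfd A) nab.
Hypothesis tnab : torsion_free (bmfd A) nab.
Implicit Types (c : chart R T (1 + d)) (p q : T).

Local Notation M := (bmfd A).
Local Notation M' := (boundary_mfd A).
Local Notation r := (rshift 1).
Let aX : approachable (msp M) := @approachable_half_space R d.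

Lemma smooth_tangential_gauge c k : boundary_chart A c ->
  smooth_mx M (cdom c) (tangential_gauge A nab c k).
Proof.
move=> bc; have ac := atl_boundary_chart bc.
apply: (smooth_mx_block hM).
- apply: (smooth_mx_matrix hM) => i j.
  apply: (eq_smooth_fun hM (F := fun q => thomas_mx M nab c (r k) q (r j) (r i))).
    by move=> q _; rewrite mxE.
  exact: (smooth_mx_thomas aX hM cnab).
- exact: smooth_mx_cst.
- apply: (smooth_mx_matrix hM (F := fun q _ j => - thomas_P M nab c q (r k) (r j))).
  move=> _ j.
  apply: (@smooth_funN _ _ _ _ hM _ (fun q => thomas_P M nab c q (r k) (r j))).
  exact: (smooth_fun_thomas_P aX hM cnab).
- exact: smooth_mx_cst.
Qed.

Lemma smooth_tangential_transition c c' : boundary_chart A c -> boundary_chart A c' ->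
  smooth_mx M (cdom c `&` cdom c') (tangential_transition A c c').
Proof.
move=> bc bc'; have [ac ac'] := (atl_boundary_chart bc, atl_boundary_chart bc').
apply: (smooth_mx_block hM).
- by apply: (smooth_mx_matrix hM) => i j; exact: smooth_fun_jac.
- exact: smooth_mx_cst.
- apply: (smooth_mx_matrix hM (F := fun q _ j => proj_factor M c c' (r j) q)).
  by move=> _ j; exact: smooth_proj_factor.
- exact: smooth_mx_cst.
Qed.

Lemma tangential_transition_unit c c' p : boundary_chart A c -> boundary_chart A c' ->
  cdom c p -> cdom c' p -> boundary A p ->
  (\matrix_(i, j) jac M c c' p (r j) (r i) : 'M[R]_d) \in unitmx.
Proof.
move=> bc bc' cp cp' bp.
have [uJ _] := mulmx1_unit (jac_restr_inv hM bc bc' cp cp' bp).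
suff -> : \matrix_(i, j) jac M c c' p (r j) (r i) =
    (jac M' (restr_chart A c) (restr_chart A c') p)^T by rewrite unitmx_tr.
by apply/matrixP => i j; rewrite mxE [RHS]mxE jac_restr.
Qed.

Lemma drsubmx_normal_gauge c p v : boundary_chart A c -> cdom c p ->
  drsubmx (normal_gauge A nab c p (dincl A p v)) =
  \sum_k v (restr_chart A c) 0 k *: tangential_gauge A nab c k p.
Proof.
move=> bc cp; rewrite /normal_gauge block_mxKdr.
have vE : dincl A p v c = row_mx 0 (v (restr_chart A c)) by rewrite /dincl asboolT.
have sumE (f : 'I_(1 + d) -> R) : \sum_k f k * dincl A p v c 0 k =
    \sum_k f (r k) * v (restr_chart A c) 0 k.
  rewrite big_split_ord1 vE ord0_lshift row_mxEl mxE mulr0 add0r.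
  by apply: eq_bigr => k _; rewrite row_mxEr.
apply/matrixP => i j; rewrite summxE.
under [RHS]eq_bigr => k _ do rewrite entryZ.
case: (split_ordP i) => i' ->; case: (split_ordP j) => j' ->.
- rewrite block_mxEul !mxE /thomas_form sumE; apply: eq_bigr => k _.
  by rewrite block_mxEul mxE mulrC.
- rewrite block_mxEur !mxE vE row_mxEr (bigD1 i') //= block_mxEur mxE.
  rewrite (ord1 j') !eqxx mulr1.
  rewrite big1 ?addr0 // => k ki; rewrite block_mxEur mxE eq_sym (negPf ki).
  by rewrite mulr0.
- rewrite block_mxEdl !mxE /schouten_form sumE -sumrN; apply: eq_bigr => k _.
  by rewrite block_mxEdl mxE mulrN mulrC.
- rewrite block_mxEdr mxE big1 // => k _.
  by rewrite block_mxEdr [X in _ * X]mxE mulr0.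
Qed.

Lemma ursubmx_normal_gauge c p v : boundary_chart A c -> cdom c p ->
  geodesic_boundary A nab c p ->
  ursubmx (normal_gauge A nab c p (dincl A p v)) = 0.
Proof.
move=> bc cp g; rewrite /normal_gauge block_mxKur.
have vE : dincl A p v c = row_mx 0 (v (restr_chart A c)) by rewrite /dincl asboolT.
apply/rowP => j; rewrite [RHS]mxE; case: (split_ordP j) => j' ->.
  rewrite row_mxEl !mxE /thomas_form big_split_ord1 vE -[lshift _ 0]ord0_lshift.
  have -> : (row_mx 0 (v (restr_chart A c)) : 'rV[R]_(1 + d)) 0 ord0 = 0.
    by rewrite ord0_lshift row_mxEl mxE.
  by rewrite mulr0 add0r big1 // => k _; rewrite g mul0r.
by rewrite row_mxEr !mxE vE (ord1 j') row_mxEl mxE.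
Qed.

End BoundaryAtlas.

(** * The Cartan atlas *)

Section BoundaryCartanAtlas.
Variables (R : realType) (d : nat) (T : topologicalType).
Variable A : set (chart R T (1 + d)).
Hypothesis hM : is_manifold (bmfd A).
Variable nab : connection R T (1 + d).
Hypothesis cnab : is_connection (bmfd A) nab.
Hypothesis tnab : torsion_free (bmfd A) nab.
Implicit Types (c : chart R T (1 + d)) (p q : T).

Local Notation M := (bmfd A).
Local Notation M' := (boundary_mfd A).
Local Notation r := (rshift 1).
Let aX : approachable (msp M) := @approachable_half_space R d.

Definition boundary_gauge c : qform R (1 + (d + 1)) T d := fun p v =>
  coset_of_lie (@grpK R d) (normal_gauge A nab c p (dincl A p v)).

Lemma open_in_boundary c : boundary_chart A c -> open_in M' (cdom c `&` boundary A).
Proof.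
move=> bc; have [ O oO E] := open_in_cdom hM (atl_boundary_chart bc).
by exists O => //; rewrite E /= setIT.
Qed.

Section Gauge.
Variable c : chart R T (1 + d).
Hypothesis bc : boundary_chart A c.
Hypothesis g : forall p, cdom c p -> boundary A p -> geodesic_boundary A nab c p.

(* On the boundary the gauge differs from [theta] by an element of the Lie
   algebra of [grpK]. *)
Let theta p (v : tvec R T d) : 'M[R]_(1 + (d + 1)) :=
  block_mx 0 0 0 (\sum_k v (restr_chart A c) 0 k *: tangential_gauge A nab c k p).

Lemma boundary_gauge_lift p v : cdom c p -> boundary A p ->
  boundary_gauge c p v = coset_of_lie (@grpK R d) (theta p v).
Proof.
move=> cp bp; apply: coset_of_lieK_eq; apply/lie_grpKP.
rewrite ursubmxD drsubmxD ursubmxN drsubmxN.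
rewrite (ursubmx_normal_gauge v bc cp (g cp bp)) drsubmx_normal_gauge //.
by rewrite block_mxKur block_mxKdr !subrr; split=> //; exists 0; rewrite raddf0.
Qed.

Lemma one_form_boundary_gauge a b :
  one_form M' (cdom c `&` boundary A) (fun p v => theta p v a b).
Proof.
split=> [p x v w _ _ _|c0 k [c' bc' <-]].
  rewrite -entryZ -entryD; congr (fun_of_matrix _ a b).
  rewrite /theta scale_block_mx add_block_mx !scaler0 !addr0; congr block_mx.
  rewrite scaler_sumr -big_split; apply: eq_bigr => k _ /=.
  by rewrite !fctE !mxE scalerDl scalerA.
have [ac ac'] := (atl_boundary_chart bc, atl_boundary_chart bc').
(* The value of [theta] on a coordinate field of [c'] is the restriction of a matrix function
   defined on an open part of the ambient manifold, where smoothness is available. *)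
pose G q : 'M[R]_(1 + (d + 1)) :=
  block_mx 0 0 0 (\sum_l jac M c' c q (r k) (r l) *: tangential_gauge A nab c l q).
have sG : smooth_mx M (cdom c' `&` cdom c) G.
  apply: (smooth_mx_block hM); [exact: smooth_mx_cst|exact: smooth_mx_cst|
    exact: smooth_mx_cst|].
  apply: (@smooth_mx_sum R T _ M _ _ _ _ _
    (fun l q => jac M c' c q (r k) (r l) *: tangential_gauge A nab c l q)) => l.
  apply: (@smooth_mxZ R T _ M _ _ _ (fun q => jac M c' c q (r k) (r l))).
    exact: smooth_fun_jac.
  by apply: smooth_mx_sub (smooth_tangential_gauge hM cnab l bc) => q [].
have rc' : atl M' (restr_chart A c') by exists c'.
have := smooth_fun_restr (sG a b) rc'.
move=> /(@smooth_on_sub _ _ _ (cmap (restr_chart A c') @`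
  (cdom (restr_chart A c') `&` (cdom c `&` boundary A)))) sG'.
apply: eq_smooth_on (sG' _) => [y|y]; last first.
  by move=> [q [[cq' bq] [cq _]] <-]; exists q.
move=> [q [[cq' bq] [cq _]] <-] /=.
rewrite (boundary_cmapE bc' cq' bq) (cinvK hM ac' cq').
congr (fun_of_matrix _ a b); rewrite /G /theta; congr block_mx.
apply: eq_bigr => l _; congr (_ *: _).
rewrite coord_field_in; [|exact: boundary_chart_at|exact: boundary_chart_at].
by rewrite [RHS]mxE jac_restr.
Qed.

Lemma cartan_gauge_boundary :
  cartan_gauge M' (proj_klein R d) (cdom c `&` boundary A) (boundary_gauge c).
Proof.
split.
  exists theta; first exact: one_form_boundary_gauge.
  move=> p v [cp bp] _; split; last exact: boundary_gauge_lift.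
  by apply/lie_grpGtP; rewrite block_mxKur.
move=> p X [cp bp] /lie_grpGtP X0.
have pc := boundary_chart_at bc cp bp.
have uE (w : 'rV[R]_d) : ursubmx (\sum_k w 0 k *: tangential_gauge A nab c k p) = w^T.
  apply/colP => i; rewrite [LHS]mxE [LHS]mxE [RHS]mxE summxE.
  rewrite (bigD1 i) //= entryZ block_mxEur [delta_mx _ _ _ _]mxE !eqxx mulr1.
  rewrite big1 ?addr0 // => k ki.
  by rewrite entryZ block_mxEur [delta_mx _ _ _ _]mxE eq_sym (negPf ki) mulr0.
(* Modulo the Lie algebra of [grpHt], an element with vanishing upper right block is determined by
   the column above the corner. For [theta] this column is the vector [v] in the chart [c], so
   bijectivity is read off directly. *)
have subP v : boundary_gauge c p v `<=` coset_of_lie (@grpHt R d) X <->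
    (v (restr_chart A c))^T = ursubmx (drsubmx X).
  have urS : ursubmx (drsubmx (theta p v)) = (v (restr_chart A c))^T.
    by rewrite block_mxKdr uE.
  rewrite boundary_gauge_lift //; split=> [sub|vX].
    have /sub/lie_grpHtP[_] : coset_of_lie (@grpK R d) (theta p v) (theta p v).
      rewrite /coset_of_lie /= subrr; apply/lie_grpKP.
      split; first by apply/matrixP => i j; rewrite !mxE.
      by exists 0; apply/matrixP => i j; rewrite !mxE mul0rn.
    rewrite drsubmxD drsubmxN ursubmxD ursubmxN urS => /eqP.
    by rewrite subr_eq0 => /eqP.
  move=> Y /lie_grpKP[u0 [la dE]]; apply/lie_grpHtP.
  have -> : Y - X = (Y - theta p v) + (theta p v - X) by rewrite addrA subrK.
  rewrite ursubmxD u0 drsubmxD dE [ursubmx (_ - X)]ursubmxD ursubmxN X0 block_mxKur.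
  rewrite oppr0 !addr0; split=> //.
  rewrite drsubmxD drsubmxN !ursubmxD ursubmxN urS vX subrr addr0.
  by rewrite scalar_mx_block block_mxKur.
have [v tv vE] := exists_tangent_boundary hM (ursubmx (drsubmx X))^T bc cp bp.
exists v; split; first by split=> //; apply/subP; rewrite vE trmxK.
move=> v' [tv' /subP vE']; apply: (tangent_inj pc) => //.
by rewrite vE -vE' trmxK.
Qed.

End Gauge.

Section Transition.
Variables (c c' : chart R T (1 + d)).
Hypotheses (bc : boundary_chart A c) (bc' : boundary_chart A c').
Hypothesis g : forall p, cdom c p -> boundary A p -> geodesic_boundary A nab c p.
Hypothesis g' : forall p, cdom c' p -> boundary A p -> geodesic_boundary A nab c' p.
Hypothesis hd : (1 <= d)%N.

(* A lift of [h_ij]: modulo [grpK] its first column can be chosen at will. *)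
Let B q : 'M[R]_(d + 1) := tangential_transition A c c' q.
Let G q : 'M[R]_(1 + (d + 1)) := block_mx 1%:M 0 0 (B q).

Lemma boundary_transition_unit p : cdom c p -> cdom c' p -> boundary A p ->
  B p \in unitmx.
Proof.
move=> cp cp' bp; rewrite unitmxE det_lblock det1 mulr1 -unitmxE.
exact: tangential_transition_unit.
Qed.

Lemma boundary_transition_Ht p : cdom c p -> cdom c' p -> boundary A p ->
  @grpHt R d (G p).
Proof.
move=> cp cp' bp.
exists 1%:M, 0, 0, (\matrix_(i, j) jac M c c' p (r j) (r i)),
  (\row_j proj_factor M c c' (r j) p), 1%:M; split.
- by rewrite mxE oner_eq0.
- by rewrite mxE oner_eq0.
- exact: tangential_transition_unit.
- by rewrite col_mx0.
Qed.

Lemma smooth_boundary_transition : smooth_mx M (cdom c `&` cdom c') G.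
Proof.
apply: (smooth_mx_block hM); [exact: smooth_mx_cst|exact: smooth_mx_cst|
  exact: smooth_mx_cst|exact: smooth_tangential_transition].
Qed.

Lemma dfun_boundary_transition p v (c0 : chart R T d) :
  cdom c p -> cdom c' p -> boundary A p ->
  chart_at M' p c0 -> tangent M' p v ->
  \matrix_(a, b) dfun M' c0 (fun q => G q a b) p v =
  block_mx 0 0 0 (\sum_k v (restr_chart A c) 0 k *: pdm M c (r k) B p).
Proof.
move=> cp cp' bp pc0 tv.
have [ac ac'] := (atl_boundary_chart bc, atl_boundary_chart bc').
have oW := open_in_overlap hM ac ac'.
transitivity (\sum_k v (restr_chart A c) 0 k *: pdm M c (r k) G p).
  apply/matrixP => a b; rewrite mxE summxE.
  have sG := smooth_boundary_transition a b.
  rewrite (dfun_restr_chart hM bc cp bp pc0 oW (conj cp cp') sG tv).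
  by apply: eq_bigr => k _; rewrite entryZ pdmE.
have E k : pdm M c (r k) G p = block_mx 0 0 0 (pdm M c (r k) B p).
  by rewrite pdm_block_mx !(pdm_cst hM _ _ (conj ac cp)).
rewrite (eq_bigr _ (fun k _ => congr1 _ (E k))).
under eq_bigr => k _ do rewrite scale_block_mx !scaler0.
elim: (index_enum _) => [|k s IH]; first by rewrite !big_nil block_mx0.
by rewrite !big_cons IH add_block_mx !addr0.
Qed.

Lemma sum_gauge_transform p v : cdom c p -> cdom c' p -> boundary A p ->
  tangent M' p v ->
  B p *m (\sum_k v (restr_chart A c) 0 k *: tangential_gauge A nab c k p
          - (\sum_k v (restr_chart A c) 0 k * proj_factor M c c' (r k) p)%:M) =
  \sum_k v (restr_chart A c) 0 k *: pdm M c (r k) B p +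
  (\sum_k v (restr_chart A c') 0 k *: tangential_gauge A nab c' k p) *m B p.
Proof.
move=> cp cp' bp tv.
have -> : \sum_k v (restr_chart A c') 0 k *: tangential_gauge A nab c' k p =
    \sum_k v (restr_chart A c) 0 k *:
      \sum_b jac M c c' p (r k) (r b) *: tangential_gauge A nab c' b p.
  rewrite (tangent_restr bc bc' cp cp' bp tv).
  under eq_bigr => b _ do rewrite mxE scaler_suml.
  rewrite exchange_big; apply: eq_bigr => k _ /=; rewrite scaler_sumr.
  by apply: eq_bigr => b _; rewrite scalerA jac_restr.
rewrite raddf_sum -sumrB mulmx_sumr mulmx_suml -big_split; apply: eq_bigr => k _ /=.
rewrite -scale_scalar_mx -scalerBr -scalemxAr -scalemxAl -scalerDr; congr (_ *: _).
exact: (tangential_gauge_transform hM cnab tnab bc bc' cp cp' bp (g cp bp) hd k).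
Qed.

Lemma cartan_transition_boundary :
  cartan_transition M' (proj_klein R d)
    ((cdom c' `&` boundary A) `&` (cdom c `&` boundary A))
    (boundary_gauge c') (boundary_gauge c)
    (fun q => coset_of_grp (@grpK R d) (G q)).
Proof.
move=> p [[cp' bp] [cp _]]; exists setT, G; split=> //.
- exact: openT.
- move=> a b; have := smooth_fun_restr (smooth_boundary_transition a b).
  by apply: smooth_fun_sub => q [_ [[cq' bq] [cq _]]].
- by move=> q [_ [[cq' bq] [cq _]]]; split=> //; exact: boundary_transition_Ht.
move=> q v c0 X [_ [[cq' bq] [cq _]]] tv pc0 /lie_grpKP[uX [la dX]].
rewrite dfun_boundary_transition //.
set w := v (restr_chart A c).
have uB := boundary_transition_unit cq cq' bq.
have uX0 : ursubmx X = 0.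
  move: uX; rewrite ursubmxD ursubmxN (ursubmx_normal_gauge v bc' cq' (g' cq' bq)).
  by rewrite subr0.
have dX0 : drsubmx X =
    \sum_k v (restr_chart A c') 0 k *: tangential_gauge A nab c' k q + la%:M.
  move: dX; rewrite drsubmxD drsubmxN drsubmx_normal_gauge // => /eqP.
  by rewrite subr_eq addrC => /eqP.
have GV : invmx (G q) = block_mx 1%:M 0 0 (invmx (B q)).
  by rewrite /G invmx_block_diag ?invmx1 // block_diag_mx_unit unitmx1.
apply: coset_of_lieK_eq; apply/lie_grpKP.
rewrite GV -[X]submxK uX0 /G -mulmxA -mulmxDr mulmx_block add_block_mx mulmx_block.
rewrite !(mul0mx, mulmx0, mul1mx, mulmx1, addr0, add0r).
rewrite ursubmxD drsubmxD ursubmxN drsubmxN.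
rewrite (ursubmx_normal_gauge v bc cq (g cq bq)) drsubmx_normal_gauge //.
rewrite block_mxKur block_mxKdr subr0.
(* The first term is the scalar of the gauge law on [v]; [la] is the ambiguity in the representative
   [X], which conjugation by [B q] leaves unchanged. *)
split=> //; exists (\sum_k w 0 k * proj_factor M c c' (r k) q - la).
rewrite dX0 mulmxDl addrA -sum_gauge_transform // mulmxDr mulKmx //.
rewrite mul_scalar_mx -mul_mx_scalar mulKmx //.
by rewrite opprD opprB addrA [_ + (_ - _)]addrC subrK raddfB.
Qed.

End Transition.
End BoundaryCartanAtlas.

Theorem proposition4p2 (R : realType) (d : nat) (hd : (1 <= d)%N)
  (T : topologicalType) (A : set (chart R T (1 + d)))
  (hM : is_manifold (bmfd A))
  (P : set (connection R T (1 + d)))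
  (hP : projective_structure (bmfd A) P)
  (nab : connection R T (1 + d)) (hnab : P nab)
  (hPi : forall p, boundary A p ->
     exists2 c, boundary_chart A c /\ cdom c p &
       forall mu : 'I_d, exists a : R, forall v, tangent (bmfd A) p v ->
         thomas_form (bmfd A) nab c p ord0 (rshift 1 mu) v = a * v c 0 ord0)
  (I : Type) (U : I -> chart R T (1 + d))
  (hU : forall i, boundary_chart A (U i))
  (hcov : boundary A `<=` \bigcup_i cdom (U i)) :
  cartan_atlas (boundary_mfd A) (proj_klein R d)
    (fun i => cdom (U i) `&` boundary A)
    (fun i p v => coset_of_lie (@grpK R d)
                    (normal_gauge A nab (U i) p (dincl A p v))).
Proof.
have [cnab tnab] : tf_connection (bmfd A) nab.
  by have [nab0 _ PE] := hP; move: hnab; rewrite PE => -[].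
(* The hypothesis concerns some boundary chart at each point and is transferred to the given
   cover. *)
have g i p : cdom (U i) p -> boundary A p -> geodesic_boundary A nab (U i) p.
  move=> cp bp; have [c [bc cp'] hc] := hPi p bp.
  apply: (geodesic_boundary_transfer hM cnab (hU i) bc cp cp' bp).
  exact: geodesic_boundary_form.
split.
- by move=> i; exact: open_in_boundary.
- apply/seteqP; split=> [p bp|p [i _ [_ bp]] //].
  by have [i _ cp] := hcov p bp; exists i.
- by move=> i; exact: (cartan_gauge_boundary hM cnab (hU i) (g i)).
(* In [h_ij] the unbarred coordinates are those of [U i] and the barred ones those of [U j], so
   [U j] is the chart [c] in which derivatives are taken. *)
- move=> i j; eexists.
  exact: (cartan_transition_boundary hM cnab tnab (hU j) (hU i) (g j) (g i) hd).
Qed.
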